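(* For every $\mu\in\mathcal{M}_{\mathrm{loc},\mathrm{unif}}(\mathbb{R})$ the three operators $H_\mu$, $H_{\mu,\mathrm{SL}}$ and $H_{\mu,\mathrm{F}}$ in $L_2(\mathbb{R})$ coincide (including their domains): $H_\mu=H_{\mu,\mathrm{SL}}=H_{\mu,\mathrm{F}}$.
   Context: A local measure on $\mathbb{R}$ is a map $\mu$ from the bounded Borel subsets of $\mathbb{R}$ to $\mathbb{C}$ such that $\mathbf{1}_K\mu:=\mu(\cdot\cap K)$ is a complex Radon measure for every compact $K\subseteq\mathbb{R}$; $|\mu|$ denotes its total variation. Put $\|\mu\|_{\mathrm{unif}}:=\sup_{a\in\mathbb{R}}|\mu|((a,a+1])$, and let $\mathcal{M}_{\mathrm{loc},\mathrm{unif}}(\mathbb{R})$ be the space of all local measures $\mu$ with $\|\mu\|_{\mathrm{unif}}<\infty$. Integration convention: $\int_s^t\dots d\mu=\int_{(s,t]}\dots d\mu$ if $t\ge s$ and $\int_s^t\dots d\mu=-\int_{(t,s]}\dots d\mu$ if $t<s$. (1) Maximal (distributional) operator: $D(H_\mu):=\{u\in L_2(\mathbb{R})\cap C(\mathbb{R}) : -u''+u\mu\in L_2(\mathbb{R})\}$, $H_\mu u:=-u''+u\mu$ in the sense of distributions; i.e. for $u,f\in L_2(\mathbb{R})$, $u\in D(H_\mu)$ and $H_\mu u=f$ iff $u$ is continuous and $\int f\varphi=-\int u\varphi''+\int u\varphi\,d\mu$ for all $\varphi\in C_c^\infty(\mathbb{R})$. (2) Sturm–Liouville operator: for $u\in W^1_{1,\mathrm{loc}}(\mathbb{R})$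 (taking the continuous representative) define $A_\mu u\in L_{1,\mathrm{loc}}(\mathbb{R})$ by $(A_\mu u)(t):=u'(t)-\int_0^t u(s)\,d\mu(s)$ for a.a. $t\in\mathbb{R}$. Then $D(H_{\mu,\mathrm{SL}}):=\{u\in L_2(\mathbb{R})\cap W^1_{1,\mathrm{loc}}(\mathbb{R}) : A_\mu u\in W^1_{1,\mathrm{loc}}(\mathbb{R}),\ (A_\mu u)'\in L_2(\mathbb{R})\}$ and $H_{\mu,\mathrm{SL}}u:=-(A_\mu u)'$. (3) Form operator: let $D(\tau_\mu):=W^1_2(\mathbb{R})$, $\tau_\mu(u,v):=\int u'\overline{v}'+\int u\overline{v}\,d\mu$ (a closed sectorial form in $L_2(\mathbb{R})$). $H_{\mu,\mathrm{F}}$ is the associated m-sectorial operator: $D(H_{\mu,\mathrm{F}})=\{u\in D(\tau_\mu) : \exists f_u\in L_2(\mathbb{R})\ \forall v\in D(\tau_\mu):\ \tau_\mu(u,v)=(f_u\,|\,v)\}$, $H_{\mu,\mathrm{F}}u=f_u$, where $(f\,|\,g)=\int f\overline g$. *)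

(* Defs.v *)
From HB Require Import structures.
From mathcomp Require Import all_boot all_order all_algebra.
From mathcomp Require Import all_classical all_reals all_analysis.
From mathcomp Require Import complex.

Set Implicit Arguments.
Unset Strict Implicit.
Unset Printing Implicit Defensive.

Import Order.TTheory GRing.Theory Num.Theory.
Import numFieldNormedType.Exports.

Local Open Scope classical_set_scope.
Local Open Scope ring_scope.

(* Continuity, differentiability, measurability and integrals of complex-valued
   functions are taken componentwise: the libraries have no measurable structure
   on R[i] and no integral with values in it. *)

Definition re_fun {R : realType} {T : Type} (f : T -> R[i]) : T -> R :=
  fun x => complex.Re (f x).
Definition im_fun {R : realType} {T : Type} (f : T -> R[i]) : T -> R :=
  fun x => complex.Im (f x).

Definition cintegral {d} {T : measurableType d} {R : realType}
    (m : {measure set T -> \bar R}) (D : set T) (f : T -> R[i]) : R[i] :=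
  Complex (\int[m]_(x in D) re_fun f x) (\int[m]_(x in D) im_fun f x).

Section local_measures.
Context {R : realType}.

(* Every finite real or complex Borel measure on the line is Radon, so
   countable additivity on the Borel sets is the whole condition. *)
Definition complex_measure (nu : set R -> R[i]) : Prop :=
  semi_sigma_additive (fun A : set R => (re_fun nu A)%:E) /\
  semi_sigma_additive (fun A : set R => (im_fun nu A)%:E).

(* The values outside the bounded Borel sets are irrelevant. *)
Record local_measure := LocalMeasure {
  local_measure_fun :> set R -> R[i];
  local_measureP : forall K : set R, compact K ->
    complex_measure (fun A => local_measure_fun (A `&` K)) }.

(* Only meaningful for bounded Borel A. *)
Definition total_variation (mu : local_measure) (A : set R) : \bar R :=
  ereal_sup [set (\sum_(0 <= i <oo) (Normc.normc (mu (B i)))%:E)%E | B in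
    [set B : nat -> set R | [/\ forall i, measurable (B i),
      trivIset setT B & \bigcup_i B i = A]]].

Definition unif_norm (mu : local_measure) : \bar R :=
  ereal_sup [set total_variation mu `]a, a + 1] | a in [set: R]].

Definition real_local_measure (nu : set R -> R) : Prop :=
  forall K : set R, compact K ->
    semi_sigma_additive (fun A : set R => (nu (A `&` K))%:E).

Section upper_variation.
Variable nu : set R -> R.

Definition bounded_borel_sub (A : set R) : set (set R) :=
  [set B : set R | [/\ measurable B, bounded_set (B : set R) & B `<=` A]].

(* The positive part in the Jordan decomposition of nu, extended to all Borel
   sets; the proof argument is what makes it a measure. *)
Definition upper_variation (nuP : real_local_measure nu) (A : set R) : \bar R :=
  ereal_sup [set (nu B)%:E | B in bounded_borel_sub A].

Hypothesis nuP : real_local_measure nu.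

Let bounded_sub (A B : set R) : B `<=` A -> bounded_set A -> bounded_set B.
Proof.
move=> BA [M [Mr HM]]; exists M; split => // x Mx y By.
by apply: HM => //; exact: BA.
Qed.

Let bounded_set0 : bounded_set (set0 : set R).
Proof. by exists 0; split; [exact: num_real|move=> x _ y []]. Qed.

Let bounded_setU (A B : set R) : bounded_set A -> bounded_set B ->
  bounded_set (A `|` B).
Proof.
move=> [M [Mr HM]] [N [Nr HN]]; exists (Num.max M N); split.
  exact: num_real.
by move=> x; rewrite gt_max => /andP[Mx Nx] y [Ay|By]; [exact: HM|exact: HN].
Qed.

Let bounded_compact (B : set R) : bounded_set B ->
  exists2 K : set R, compact K & B `<=` K.
Proof.
move=> [M [Mr HM]]; exists `[- (M + 1), M + 1]%classic.
  exact: segment_compact.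
move=> x Bx; have /(_ x Bx) /= := HM (M + 1) (ltr_pwDr ltr01 (lexx M)).
by rewrite ler_norml in_itv.
Qed.

Let nu0 : nu set0 = 0.
Proof.
have := nuP (@compact0 R) (F := fun=> set0) (fun=> measurable0).
rewrite bigcup0//= set0I => /(_ (@trivIset_set0 _ _ _) measurable0) h.
have h1 : (fun n => (nu set0 *+ n)) @ \oo --> nu set0.
  move/fine_cvgP : h => [_]; apply: cvg_trans; apply: near_eq_cvg.
  by near=> n; rewrite /= sumEFin sumr_const_nat subn0.
have h2 : (fun n => (nu set0 *+ n.+1)) @ \oo --> nu set0.
  by rewrite (cvg_shiftS (fun n => nu set0 *+ n)).
have h3 : (fun n => (nu set0 *+ n.+1)) @ \oo --> nu set0 + nu set0.
  under eq_fun do rewrite mulrS.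
  by apply: cvgD => //; exact: cvg_cst.
have e : nu set0 = nu set0 + nu set0.
  exact: (@cvg_unique _ (@Rhausdorff R) _ _ _ _ h2 h3).
by apply: (addrI (nu set0)); rewrite addr0 -e.
Unshelve. all: by end_near. Qed.

Let nu_series (F : nat -> set R) : (forall i, measurable (F i)) ->
  trivIset setT F -> bounded_set (\bigcup_i F i) ->
  (fun n => \sum_(0 <= i < n) (nu (F i))%:E)%E @ \oo
    --> (nu (\bigcup_i F i))%:E.
Proof.
move=> mF tF /bounded_compact[K cK FK].
have := nuP cK mF tF (bigcup_measurable (fun i _ => mF i)).
rewrite (setIidl FK); apply: cvg_trans; apply: near_eq_cvg; near=> n.
apply: eq_bigr => i _; rewrite setIidl//.
by apply: subset_trans FK; exact: bigcup_sup.
Unshelve. all: by end_near. Qed.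

Let nuU (A B : set R) : measurable A -> measurable B ->
  bounded_set (A `|` B) -> A `&` B = set0 -> nu (A `|` B) = nu A + nu B.
Proof.
move=> mA mB /bounded_compact[K cK ABK] AB0; apply: EFin_inj.
pose m (A : set R) := (nu (A `&` K))%:E.
have m0 : m set0 = 0%E by rewrite /m set0I nu0.
have := semi_additiveW m0 (semi_sigma_additive_is_additive m0 (nuP cK)).
move=> /(_ A B mA mB (measurableU _ _ mA mB) AB0).
rewrite /m !setIidl//; first by move=> x ?; apply: ABK; right.
by move=> x ?; apply: ABK; left.
Qed.

Let uvar0 : upper_variation nuP set0 = 0%E.
Proof.
rewrite /upper_variation (_ : bounded_borel_sub set0 = [set set0]).
  by rewrite image_set1 ereal_sup1 nu0.
by apply/seteqP; split => [B [_ _]|B ->]; [rewrite subset0|split].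
Qed.

Let uvar_ge0 A : (0 <= upper_variation nuP A)%E.
Proof. by apply: ereal_sup_ubound; exists set0; [split|rewrite nu0]. Qed.

Let uvar_ub A B : bounded_borel_sub A B ->
  ((nu B)%:E <= upper_variation nuP A)%E.
Proof. by move=> AB; apply: ereal_sup_ubound; exists B. Qed.

Let uvarS A B : A `<=` B -> (upper_variation nuP A <= upper_variation nuP B)%E.
Proof.
move=> AB; apply: ereal_sup_le => _ [C [mC bC CA] <-]; exists C => //.
by split => //; exact: subset_trans AB.
Qed.

Let uvarU A B : A `&` B = set0 ->
  (upper_variation nuP A + upper_variation nuP B
    <= upper_variation nuP (A `|` B))%E.
Proof.
move=> AB0; set U := upper_variation nuP (A `|` B).
have [->|Uoo] := eqVneq U +oo%E; first by rewrite leey.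
have fin C : C `<=` A `|` B -> upper_variation nuP C \is a fin_num.
  move=> CAB; rewrite ge0_fin_numE//.
  by apply: (le_lt_trans (uvarS CAB)); rewrite ltey.
rewrite -leeBrDr ?fin//; apply: ge_ereal_sup => _ [C [mC bC CA] <-].
rewrite leeBrDr ?fin// addeC -leeBrDr//.
apply: ge_ereal_sup => _ [D [mD bD DB] <-].
rewrite leeBrDr// -EFinD -nuU//; last 2 first.
- exact: bounded_setU.
- by rewrite -subset0 -AB0 => x [/DB ? /CA ?].
apply: uvar_ub; split; [exact: measurableU|exact: bounded_setU|].
by move=> x [/DB|/CA]; [right|left].
Qed.

Let uvar_sum (F : nat -> set R) n : trivIset setT F ->
  (\sum_(0 <= i < n) upper_variation nuP (F i)
    <= upper_variation nuP (\big[setU/set0]_(i < n) F i))%E.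
Proof.
move=> tF; elim: n => [|n ih]; first by rewrite big_nil big_ord0 uvar0.
rewrite big_nat_recr//= big_ord_recr/=; apply: le_trans (uvarU _).
  exact: leeD.
have tF' : trivIset (fun i => predT i) F by move=> i j _ _; exact: tF.
exact: (@trivIset_bigsetUI _ predT F tF' n n isT (leqnn n)).
Qed.

Let uvar_sigma_additive : semi_sigma_additive (upper_variation nuP).
Proof.
move=> F mF tF mUF; set u := (fun n => _)%E.
have cu : cvgn u by apply: is_cvg_nneseries => i _ _.
suff -> : upper_variation nuP (\bigcup_i F i) = limn u by exact: cu.
apply/eqP; rewrite eq_le; apply/andP; split; last first.
  apply: lime_le => //; near=> n; apply: le_trans (uvar_sum n tF) _.
  by apply: uvarS; rewrite -bigcup_mkord; exact: bigcup_subset.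
apply: ge_ereal_sup => _ [B [mB bB BF] <-].
have BE : B = \bigcup_i (B `&` F i) by rewrite -setI_bigcupr setIidl.
have cB : (fun n => \sum_(0 <= i < n) (nu (B `&` F i))%:E)%E @ \oo
    --> (nu B)%:E.
  rewrite [in X in _ --> X]BE; apply: nu_series; last by rewrite -BE.
  - by move=> i; exact: measurableI.
  - exact: trivIset_setIl.
rewrite -(cvg_lim (@ereal_hausdorff R) cB); apply: lee_lim => //.
  by apply/cvg_ex; exists (nu B)%:E.
near=> n; apply: lee_sum => i _; apply: uvar_ub; split.
- exact: measurableI.
- by apply: bounded_sub bB; exact: subIsetl.
- exact: subIsetr.
Unshelve. all: by end_near. Qed.

HB.instance Definition _ := isMeasure.Build _ _ _ (upper_variation nuP)
  uvar0 uvar_ge0 uvar_sigma_additive.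

End upper_variation.

Lemma real_local_measure_re (mu : local_measure) :
  real_local_measure (re_fun mu).
Proof. by move=> K cK; have [] := local_measureP mu cK. Qed.

Lemma real_local_measure_im (mu : local_measure) :
  real_local_measure (im_fun mu).
Proof. by move=> K cK; have [] := local_measureP mu cK. Qed.

Lemma real_local_measureN (nu : set R -> R) :
  real_local_measure nu -> real_local_measure (fun A => - nu A).
Proof.
move=> nuP K cK F mF tF mUF; have := nuP K cK F mF tF mUF.
under [in X in _ -> X]eq_fun do rewrite sumEFin sumrN EFinN.
under eq_fun do rewrite sumEFin.
by rewrite EFinN => h; exact: cvgeN.
Qed.

Arguments real_local_measure_re : clear implicits.
Arguments real_local_measure_im : clear implicits.

(* The Jordan parts of the real and imaginary parts of mu, as measures on the
   whole line. *)
Definition re_pos mu := upper_variation (real_local_measure_re mu).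
Definition re_neg mu :=
  upper_variation (real_local_measureN (real_local_measure_re mu)).
Definition im_pos mu := upper_variation (real_local_measure_im mu).
Definition im_neg mu :=
  upper_variation (real_local_measureN (real_local_measure_im mu)).

HB.instance Definition _ mu := Measure.on (re_pos mu).
HB.instance Definition _ mu := Measure.on (re_neg mu).
HB.instance Definition _ mu := Measure.on (im_pos mu).
HB.instance Definition _ mu := Measure.on (im_neg mu).

Definition local_integral (mu : local_measure) (D : set R) (f : R -> R[i])
    : R[i] :=
  (cintegral (re_pos mu) D f - cintegral (re_neg mu) D f) +
  'i%C * (cintegral (im_pos mu) D f - cintegral (im_neg mu) D f).

Definition oriented_integral (mu : local_measure) (s t : R) (f : R -> R[i])
    : R[i] :=
  if s <= t then local_integral mu `]s, t] f
  else - local_integral mu `]t, s] f.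

End local_measures.
Arguments local_measure : clear implicits.

Section function_spaces.
Context {R : realType}.
Implicit Types (u v f g phi : R -> R[i]).

Local Notation leb := (@lebesgue_measure R).

Definition ccontinuous u := continuous (re_fun u) /\ continuous (im_fun u).

Definition smooth (h : R -> R) := forall n x, derivable (derive1n n h) x 1.

Definition test_function phi :=
  [/\ smooth (re_fun phi), smooth (im_fun phi) &
      compact (closure [set x | phi x != 0])].

Definition cderive phi : R -> R[i] :=
  fun x => Complex (derive1 (re_fun phi) x) (derive1 (im_fun phi) x).

Definition L2 u :=
  re_fun u \in Lfun leb 2%:E /\ im_fun u \in Lfun leb 2%:E.

Definition L1loc u :=
  locally_integrable [set: R] (re_fun u) /\
  locally_integrable [set: R] (im_fun u).

Definition is_weak_derivative u g :=
  [/\ L1loc u, L1loc g & forall phi, test_function phi ->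
    cintegral leb setT (fun x => u x * cderive phi x) =
    - cintegral leb setT (fun x => g x * phi x)].

Definition W11loc u := exists g, is_weak_derivative u g.

(* A representative of the weak derivative, unique up to null sets. *)
Definition weak_derivative u : R -> R[i] :=
  xget (cst 0) [set g | is_weak_derivative u g].

Definition is_continuous_rep u v := ccontinuous v /\ v = u %[ae leb].

(* Elements of L_2 and W^1_{1,loc} are represented by functions, so "u is
   continuous" means that u has a (necessarily unique) continuous
   representative. *)
Definition has_continuous_rep u := exists v, is_continuous_rep u v.

Definition continuous_rep u : R -> R[i] :=
  xget u [set v | is_continuous_rep u v].

Definition W12 u := [/\ L2 u, W11loc u & L2 (weak_derivative u)].

End function_spaces.

(* An operator in L_2 is given by its graph, the set of pairs (u, f) of
   (Borel measurable) square-integrable functions whose classes are related by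
   the operator.  Each graph below is invariant under changing u and f on null
   sets, so equality of graphs is equality of operators including domains. *)
Section operators.
Context {R : realType}.
Variable mu : local_measure R.
Implicit Types (u v f phi : R -> R[i]).

Local Notation leb := (@lebesgue_measure R).

Definition H_max : set ((R -> R[i]) * (R -> R[i])) :=
  [set uf | let: (u, f) := uf in
    [/\ L2 u, L2 f, has_continuous_rep u &
      forall phi, test_function phi ->
        cintegral leb setT (fun x => f x * phi x) =
        - cintegral leb setT (fun x => u x * cderive (cderive phi) x) +
        local_integral mu setT (fun x => continuous_rep u x * phi x)]].

Definition A_SL u : R -> R[i] := fun t =>
  weak_derivative u t - oriented_integral mu 0 t (continuous_rep u).

Definition domain_SL u :=
  [/\ L2 u, W11loc u, W11loc (A_SL u) & L2 (weak_derivative (A_SL u))].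

Definition H_SL : set ((R -> R[i]) * (R -> R[i])) :=
  [set uf | let: (u, f) := uf in
    [/\ domain_SL u, L2 f &
      f = (fun t => - weak_derivative (A_SL u) t) %[ae leb]]].

Definition form_tau u v : R[i] :=
  cintegral leb setT
    (fun x => weak_derivative u x * conjc (weak_derivative v x)) +
  local_integral mu setT
    (fun x => continuous_rep u x * conjc (continuous_rep v x)).

Definition L2_inner f g : R[i] :=
  cintegral leb setT (fun x => f x * conjc (g x)).

Definition H_form : set ((R -> R[i]) * (R -> R[i])) :=
  [set uf | let: (u, f) := uf in
    [/\ W12 u, L2 f & forall v, W12 v -> form_tau u v = L2_inner f v]].

End operators.

(* Main.v *)
From HB Require Import structures.
Require Import Defs.
From mathcomp Require Import all_boot all_order all_algebra.
From mathcomp Require Import all_classical all_reals all_analysis.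
From mathcomp Require Import complex.
From mathcomp Require Import measurable_realfun ring lra.

(** The equation - u'' + u mu = f is equivalent to its integrated form: the
derivative g of u satisfies g (t) = g (s) + int_]s,t] u dmu - int_]s,t] f for all
s <= t ([driven]).  The inclusions H_max <= H_SL <= H_form <= H_max are read off
from it.

From H_max to H_SL: let k be the primitive of u mu minus the primitive of f.
Integration by parts for functions of bounded variation, which is Fubini's theorem
on the triangle s <= t ([integral_by_parts]), shows that u'' and k' agree as
distributions.  By the argument of du Bois-Reymond ([weak_derivative_up_to_cst])
the weak derivative of u is k + c for a constant c, so that
A_mu u = c - int_0^t f.

From H_SL to H_form: the point is that u' is square integrable.  On an interval of
length h <= 1 the oscillation of g = u' is at most a constant times the supremum U
of |u|, plus the integral of |f|, because the Jordan parts of mu have bounded mass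
on unit intervals.  As g is then close to a difference quotient of u, it is
controlled by the local integrals of |u| and |f| and by a multiple of U; for h
small the supremum U is absorbed ([derivative_bound]).  The Cauchy-Schwarz
inequality bounds |g (t)|^2 by the integral of |u|^2 + |f|^2 over the window
]t - h, t], and Tonelli's theorem ([window_integrable]) gives g in L2
([driven_sqr_integrable]).  The same window argument shows that functions of W12
are square integrable with respect to |mu| and that they vanish at infinity.  Since
g is also bounded, integration by parts over ]-n, n] passes to the limit and yields
the form identity ([driven_form]).

From H_form to H_max: conjugates of test functions belong to W12, and one
integration by parts moves the derivative of u to the test function.

The moduli are measured by the equivalent norm |Re z| + |Im z|, and mu enters
through the measures M1, M2, M3, M4 of its decomposition M1 - M2 + i (M3 - M4). *)

Set Implicit Arguments.
Unset Strict Implicit.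
Unset Printing Implicit Defensive.

Import Order.TTheory GRing.Theory Num.Theory.
Import numFieldNormedType.Exports.

Local Open Scope classical_set_scope.
Local Open Scope ring_scope.

(** * Integration by parts *)

Section real_integrals.
Context {R : realType}.
Local Notation RR := (measurableTypeR R).
Local Notation leb := (@lebesgue_measure R).
Implicit Types (m : {measure set RR -> \bar R}) (f g w F W : R -> R) (D : set R).

Lemma EFin_Rintegral m D f : m.-integrable D (EFin \o f) -> measurable D ->
  (\int[m]_(x in D) f x)%:E = (\int[m]_(x in D) (f x)%:E)%E.
Proof. by move=> fi mD; rewrite fineK//; exact: integrable_fin_num. Qed.

Lemma Rintegral_split m f (a b c : R) : a <= b -> b <= c ->
  m.-integrable `]a, c] (EFin \o f) ->
  \int[m]_(x in `]a, c]) f x =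
    \int[m]_(x in `]a, b]) f x + \int[m]_(x in `]b, c]) f x.
Proof.
move=> ab bc fi.
have U : `]a, c]%classic = `]a, b]%classic `|` `]b, c]%classic :> set R.
  by rewrite -itv_bndbnd_setU.
rewrite U Rintegral_setU -?U//.
apply/disj_setPS => x; rewrite /= !in_itv/= => -[/andP[_ xb] /andP[bx _]].
by have := lt_le_trans bx xb; rewrite ltxx.
Qed.

Lemma integrable_sub_itv m f (a b c d : R) : a <= c -> d <= b ->
  m.-integrable `]a, b] (EFin \o f) -> m.-integrable `]c, d] (EFin \o f).
Proof.
move=> ac db; apply: integrableS => // x; rewrite /= !in_itv/= => /andP[cx xd].
by rewrite (le_lt_trans ac cx) (le_trans xd db).
Qed.

(** The indicator restricts a product function f (x) w (y) to a part of the
product space, such as the triangle s <= t below. *)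
Lemma integrable_prod_indic d1 d2 (T1 : measurableType d1)
    (T2 : measurableType d2) (m1 : {sigma_finite_measure set T1 -> \bar R})
    (m2 : {sigma_finite_measure set T2 -> \bar R}) (D : set (T1 * T2))
    (f : T1 -> R) (w : T2 -> R) : measurable D ->
  m1.-integrable setT (EFin \o f) -> m2.-integrable setT (EFin \o w) ->
  (m1 \x m2)%E.-integrable setT (fun p => (f p.1 * w p.2 * \1_D p)%:E).
Proof.
move=> mD fi wi.
pose h (p : T1 * T2) := (f p.1 * w p.2 * \1_D p)%:E.
have mh : measurable_fun setT h.
  apply/measurable_EFinP; apply: measurable_funM; first apply: measurable_funM.
  - apply: (measurableT_comp _ measurable_fst).
    by apply/measurable_EFinP; exact: (measurable_int m1).
  - apply: (measurableT_comp _ measurable_snd).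
    by apply/measurable_EFinP; exact: (measurable_int m2).
  - exact: measurable_indic.
apply/integrable12ltyP => //.
have mw : measurable_fun setT (fun y => `|(w y)%:E|)%E.
  by apply: measurableT_comp => //; exact: (measurable_int m2).
have mf : measurable_fun setT (fun y => `|(f y)%:E|)%E.
  by apply: measurableT_comp => //; exact: (measurable_int m1).
have wfin : (\int[m2]_y `|(w y)%:E| \is a fin_num)%E.
  by apply: integrable_fin_num => //; exact: integrable_abse.
have ffin : (\int[m1]_y `|(f y)%:E| \is a fin_num)%E.
  by apply: integrable_fin_num => //; exact: integrable_abse.
apply: (@le_lt_trans _ _ (\int[m1]_x (`|(f x)%:E| * \int[m2]_y `|(w y)%:E|))%E).
  apply: ge0_le_integral => //.
  - by move=> x _; exact: integral_ge0.
  - apply: (measurable_fun_fubini_tonelli_F (m2 := m2) (fun p => `|h p|%E)) => //.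
    exact: measurableT_comp.
  - by rewrite -(fineK wfin); apply: emeasurable_funM.
  - move=> x _; rewrite -ge0_integralZl_EFin//.
    apply: ge0_le_integral => //.
    + apply: measurableT_comp => //; exact: (measurableT_comp mh (pair1_measurable x)).
    + by apply: emeasurable_funM.
    + move=> y _; rewrite /h -EFinM lee_fin normrM normrM ler_piMr//.
      by rewrite indicE; case: (_ \in _); rewrite ?normr1 ?normr0.
rewrite -(fineK wfin) ge0_integralZr//.
- by rewrite -(fineK ffin) -EFinM ltey.
- by rewrite lee_fin fine_ge0// integral_ge0.
Qed.

Let lower : set (RR * RR) := [set p | (p.1 : R) <= p.2].

Let measurable_lower : measurable lower.
Proof.
rewrite -[X in measurable X]setTI.
by apply: measurable_fun_le.
Qed.

Let lowerE (s t : R) : \1_lower (s, t) = (s <= t)%R%:R :> R.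
Proof.
rewrite indicE; case: (leP s t) => st; last by rewrite memNset//= /lower/= leNgt st.
by rewrite mem_set.
Qed.

(** Integration by parts for a function of bounded variation, given as a
primitive of [f] with respect to a measure, against an absolutely continuous
one.  Both products are integrable because they are partial integrals of an
integrable function of two variables. *)
Lemma integral_by_parts (m : {sigma_finite_measure set RR -> \bar R})
    f w F W (a b : R) : a <= b ->
  m.-integrable `]a, b] (EFin \o f) -> leb.-integrable `]a, b] (EFin \o w) ->
  (forall t, a <= t <= b -> F t = F a + \int[m]_(x in `]a, t]) f x) ->
  (forall t, a <= t <= b -> W t = W a + \int[leb]_(x in `]a, t]) w x) ->
  [/\ leb.-integrable `]a, b] (EFin \o (fun t => F t * w t)),
      m.-integrable `]a, b] (EFin \o (fun t => f t * W t)) &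
      \int[leb]_(t in `]a, b]) (F t * w t) + \int[m]_(t in `]a, b]) (f t * W t)
      = F b * W b - F a * W a].
Proof.
move=> ab fi wi HF HW.
set I := `]a, b]%classic.
have mI : measurable (I : set RR) by exact: measurable_itv.
pose fI : R -> R := f \_ I; pose wI : R -> R := w \_ I.
have fIi : m.-integrable setT (EFin \o fI).
  by rewrite /fI -restrict_EFin; apply/(integrable_mkcond _ mI).
have wIi : leb.-integrable setT (EFin \o wI).
  by rewrite /wI -restrict_EFin; apply/(integrable_mkcond _ mI).
(* Fubini for f s * w t on the triangle s <= t: the inner integrals are
   (F t - F a) * w t and f s * (W b - W s). *)
pose h (p : RR * RR) := (fI p.1 * wI p.2 * \1_lower p)%:E.
have ih : (m \x leb)%E.-integrable setT h.
  exact: (@integrable_prod_indic _ _ RR RR m leb).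
have FE t : (\int[m]_s h (s, t))%E =
    (((fun t => (F t - F a) * w t) \_ I) t)%:E.
  rewrite patchE; case: ifPn => [|tI]; last first.
    under eq_integral => s _ do rewrite /h /wI/= patchE (negbTE tI) mulr0 mul0r.
    by rewrite integral0.
  rewrite inE /I/= in_itv/= => /andP[ta tb].
  rewrite (HF t) ?(ltW ta)//.
  rewrite addrAC subrr add0r EFinM.
  have fit : m.-integrable `]a, t] (EFin \o f) by exact: integrable_sub_itv fi.
  rewrite EFin_Rintegral//.
  rewrite -integralZr// [RHS]integral_mkcond; apply: eq_integral => s _.
  move: (s : R) => {}s.
  rewrite /h /fI /wI/= lowerE !patchE !mem_setE !in_itv/= ta tb/=.
  case: (ltP a s) => //= as_; last by rewrite !mul0r.
  case: (leP s t) => st; last by rewrite mulr0.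
  by rewrite (le_trans st tb) mulr1.
have GE s : (\int[leb]_t h (s, t))%E =
    (((fun s => f s * (W b - W s)) \_ I) s)%:E.
  rewrite patchE; case: ifPn => [|sI]; last first.
    under eq_integral => t _ do rewrite /h /fI/= patchE (negbTE sI) !mul0r.
    by rewrite integral0.
  rewrite inE /I/= in_itv/= => /andP[sa sb].
  have -> : W b - W s = \int[leb]_(x in `]s, b]) w x.
    rewrite (HW s) ?(ltW sa)// (HW b) ?ab ?lexx//.
    by rewrite (Rintegral_split (ltW sa) sb wi); ring.
  have wis : leb.-integrable `]s, b] (EFin \o w).
    by apply: integrable_sub_itv wi => //; exact: ltW.
  have wiI : leb.-integrable I (EFin \o w) by [].
  have wic : leb.-integrable `[s, b] (EFin \o w).
    apply: integrableS wiI => // x; rewrite /I/= !in_itv/= => /andP[sx xb].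
    by rewrite (lt_le_trans sa sx).
  rewrite Rintegral_itv_obnd_cbnd// EFinM EFin_Rintegral//.
  rewrite -integralZl// [RHS]integral_mkcond; apply: eq_integral => t _.
  move: (t : R) => {}t.
  rewrite /h /fI /wI/= lowerE !patchE !mem_setE !in_itv/= sa sb/=.
  case: (leP s t) => //= st; rewrite ?mulr0 ?mulr1//.
  rewrite (lt_le_trans sa st)/=; case: ifP => _; by rewrite ?mulr0.
have iF : leb.-integrable I (EFin \o (fun t => (F t - F a) * w t)).
  apply/integrable_mkcond => //; rewrite restrict_EFin.
  have mupper : measurable [set p : RR * RR | (p.2 : R) <= p.1].
    by rewrite -[X in measurable X]setTI; apply: measurable_fun_le.
  have := @integrable_prod_indic _ _ RR RR leb m _ _ _ mupper wIi fIi.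
  move/integrable_fubini_F; apply: eq_integrable => // t _.
  rewrite -[RHS]/((((fun t => (F t - F a) * w t) \_ I) t)%:E) -FE.
  apply: eq_integral => s _; rewrite /h lowerE /= [wI t * _]mulrC indicE.
  have -> // : ((t, s) \in [set p : RR * RR | (p.2 : R) <= p.1]) = (s <= t)%R.
  by apply/idP/idP; rewrite inE.
have iG : m.-integrable I (EFin \o (fun s => f s * (W b - W s))).
  apply/integrable_mkcond => //; rewrite restrict_EFin.
  have := integrable_fubini_F ih; apply: eq_integrable => // s _.
  exact: GE.
have E : \int[leb]_(t in I) ((F t - F a) * w t) =
         \int[m]_(s in I) (f s * (W b - W s)).
  apply: EFin_inj; rewrite !EFin_Rintegral// integral_mkcond [RHS]integral_mkcond.
  transitivity (\int[leb]_t \int[m]_s h (s, t))%E.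
    by apply: eq_integral => t _; rewrite FE restrict_EFin.
  by rewrite -(Fubini ih); apply: eq_integral => s _; rewrite GE restrict_EFin.
have iFw : leb.-integrable I (EFin \o (fun t => F t * w t)).
  have := integrableD mI iF (integrableZl mI (F a) wi).
  by apply: eq_integrable => // t _ /=; rewrite -EFinM -EFinD; congr EFin; ring.
have ifW : m.-integrable I (EFin \o (fun t => f t * W t)).
  have := integrableB mI (integrableZl mI (W b) fi) iG.
  by apply: eq_integrable => // t _ /=; rewrite -EFinM -EFinB; congr EFin; ring.
split => //.
have -> : \int[leb]_(t in I) (F t * w t) =
    \int[leb]_(t in I) ((F t - F a) * w t) + F a * \int[leb]_(t in I) w t.
  rewrite -RintegralZl// -RintegralD//; last exact: (integrableZl mI (F a) wi).
  by apply: eq_Rintegral => t _; ring.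
have -> : \int[m]_(t in I) (f t * W t) =
    W b * \int[m]_(t in I) f t - \int[m]_(t in I) (f t * (W b - W t)).
  rewrite -RintegralZl// -RintegralB//; last exact: (integrableZl mI (W b) fi).
  by apply: eq_Rintegral => t _; ring.
rewrite E.
have := HF b; have := HW b; rewrite ab lexx => /(_ isT) -> /(_ isT) ->.
ring.
Qed.

End real_integrals.

(** * Smooth functions and bumps *)

Section smooth_functions.
Context {R : realType}.
Implicit Types (S : set (R -> R)) (f g h : R -> R).

(** The linear combinations of members of S. *)
Inductive lin_span (S : set (R -> R)) : (R -> R) -> Prop :=
| lin_span_in f of S f : lin_span S f
| lin_span_comb (a : R) f g of lin_span S f & lin_span S g :
    lin_span S (fun x => a * f x + g x).

(** A family of functions whose derivatives are linear combinations of members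
of the family consists of smooth functions. *)
Lemma smooth_span S :
    (forall f, S f -> exists2 df, lin_span S df &
       forall x, is_derive x (1 : R) f (df x)) ->
  forall f, lin_span S f -> smooth f.
Proof.
move=> Sd.
have step f : lin_span S f -> exists2 df, lin_span S df &
    forall x, is_derive x (1 : R) f (df x).
  elim=> {f} [f Sf|a f g _ [df sf Df] _ [dg sg Dg]]; first exact: Sd.
  exists (fun x => a * df x + dg x); first exact: lin_span_comb.
  move=> x.
  have Df' := Df x; have Dg' := Dg x.
  rewrite (_ : (fun _ => _) = a \*: f + g)//.
  by apply: is_deriveD.
move=> f sf n; suff sn : lin_span S (derive1n n f).
  by move=> x; have [df _ /(_ x) Df] := step _ sn; exact: ex_derive.
elim: n => // n ih; rewrite derive1nS.
have [df sdf Df] := step _ ih.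
rewrite (_ : derive1 _ = df)//; apply/funext => x.
by rewrite derive1E; have Dfx := Df x; rewrite derive_val.
Qed.

Lemma smooth_derivable f : smooth f -> forall x, derivable f x 1.
Proof. by move=> /(_ 0%N). Qed.

Lemma smooth_is_derive f x : smooth f -> is_derive x (1 : R) f (derive1 f x).
Proof.
by move=> /smooth_derivable/(_ x) df; apply: DeriveDef => //; rewrite derive1E.
Qed.

Lemma smooth_continuous f : smooth f -> continuous f.
Proof.
move=> /smooth_derivable sf x.
by apply: differentiable_continuous; apply/derivable1_diffP; exact: sf.
Qed.

Lemma smooth_derive1 f : smooth f -> smooth (derive1 f).
Proof. by move=> sf n x; rewrite -derive1Sn; exact: sf. Qed.

Lemma smoothM f g : smooth f -> smooth g -> smooth (fun x => f x * g x).
Proof.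
move=> sf sg.
pose S : set (R -> R) := [set h | exists f g,
  [/\ smooth f, smooth g & h = (fun x => f x * g x)]].
apply: (@smooth_span S); last by apply: lin_span_in; exists f, g.
move=> _ [{}f [{}g [{}sf {}sg ->]]].
exists (fun x => 1 * (f x * derive1 g x) + g x * derive1 f x).
  apply: lin_span_comb; apply: lin_span_in.
  - exists f, (derive1 g); split; [exact: sf|exact: smooth_derive1|reflexivity].
  - exists g, (derive1 f); split; [exact: sg|exact: smooth_derive1|reflexivity].
move=> x; rewrite mul1r.
have Df := smooth_is_derive x sf; have Dg := smooth_is_derive x sg.
exact: is_deriveM.
Qed.

Lemma smooth_comb (a : R) f g : smooth f -> smooth g ->
  smooth (fun x => a * f x + g x).
Proof.
move=> sf sg; apply: (@smooth_span [set h | smooth h]).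
  move=> h sh; exists (derive1 h).
    by apply: lin_span_in; exact: smooth_derive1.
  by move=> x; exact: smooth_is_derive.
apply: lin_span_comb; apply: lin_span_in; [exact: sf|exact: sg].
Qed.

Lemma smooth_cst (c : R) : smooth (cst c).
Proof.
apply: (@smooth_span [set h | exists c : R, h = cst c]).
  move=> _ [{}c ->]; exists (cst 0); first by apply: lin_span_in; exists 0.
  by move=> x; exact: is_derive_cst.
by apply: lin_span_in; exists c.
Qed.

Lemma smooth_affine (c d : R) f : smooth f -> smooth (fun x => f (c * x + d)).
Proof.
move=> sf; pose S : set (R -> R) := [set h | exists2 g, smooth g &
  h = (fun x => g (c * x + d))].
apply: (@smooth_span S); last by apply: lin_span_in; exists f.
move=> _ [g sg ->]; exists (fun x => c * derive1 g (c * x + d) + 0 ).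
  apply: lin_span_comb; apply: lin_span_in.
    by exists (derive1 g); [exact: smooth_derive1|].
  by exists (cst 0); [exact: smooth_cst|].
move=> x; rewrite addr0 mulrC.
have Dg := smooth_is_derive (c * x + d) sg.
have Dl : is_derive x (1 : R) (fun x => c * x + d) c.
  rewrite (_ : (fun _ => _) = c \*: id + cst d)//.
  by apply: is_derive_eq; rewrite addr0 [_ *: _]mulr1.
exact: (@is_derive1_comp _ g (fun x => c * x + d)).
Qed.

(** The function x ^ (- k) exp (- 1 / x) for positive x, extended by 0.  The
derivative of each function of this family is a combination of two others, so
that all of them are smooth. *)
Definition flat (k : nat) (x : R) : R :=
  if 0 < x then x^-1 ^+ k * expR (- x^-1) else 0.

(** From exp y >= y ^ (k + 1) / (k + 1)! at y = 1 / x; it makes flat k vanish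
to all orders at 0. *)
Lemma flat_bound k x : `|flat k x| <= (k.+1)`!%:R * `|x|.
Proof.
rewrite /flat; case: ifPn => x0; last by rewrite normr0.
rewrite !ger0_norm; last 2 first.
- exact: ltW.
- by rewrite mulr_ge0 ?exprn_ge0 ?invr_ge0 ?expR_ge0// ltW.
rewrite expRN -ler_pdivlMr ?invr_gt0 ?expR_gt0// invrK.
have y0 : 0 <= x^-1 by rewrite invr_ge0 ltW.
have := @expR_ge1Dxn _ _ k y0; move: (expR x^-1) => e he.
have {}he : x^-1 ^+ k.+1 / (k.+1)`!%:R <= e.
  by apply: le_trans he; rewrite lerDr.
rewrite ler_pdivrMr ?ltr0n ?fact_gt0// exprS in he.
rewrite -(ler_pM2l (_ : 0 < x^-1)) ?invr_gt0//.
apply: (le_trans he); rewrite le_eqVlt; apply/orP; left; apply/eqP.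
by field; rewrite gt_eqF.
Qed.

Lemma is_derive_flat k x :
  is_derive x (1 : R) (flat k) (- k%:R * flat k.+1 x + flat k.+2 x).
Proof.
have [x0|x0|->] := ltgtP x 0.
- have e : \forall y \near x, (cst 0 : R -> R) y = flat k y.
    near=> y; rewrite /flat ifF//; apply/negbTE; rewrite -leNgt ltW//.
    by near: y; exact: lt_nbhsl.
  rewrite /flat !ifF ?mulr0 ?addr0; try by apply/negbTE; rewrite -leNgt ltW.
  apply: DeriveDef; first by apply: near_eq_derivable e _; exact: derivable_cst.
  by rewrite -(near_eq_derive _ e) derive_cst.
- pose g : R -> R := fun y => y^-1 ^+ k * expR (- y^-1).
  have e : \forall y \near x, g y = flat k y.
    near=> y; rewrite /flat ifT//.
    by near: y; exact: lt_nbhsr.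
  rewrite /flat x0.
  have xn0 : x != 0 by rewrite gt_eqF.
  have Dinv : is_derive x (1 : R) (fun y : R => y^-1) (- x ^- 2).
    have := @is_deriveV R id x 1 1 xn0 (is_derive_id _ _).
    by rewrite [_ *: _]mulr1.
  have DX : is_derive x (1 : R) (fun y : R => y^-1 ^+ k) (k%:R * x^-1 ^+ k.-1 * (- x ^- 2)).
    rewrite (_ : (fun _ => _) = (fun y : R => y^-1) ^+ k); last by apply/funext => y; rewrite exprfctE.
    exact: is_deriveX.
  have DE : is_derive x (1 : R) (fun y : R => expR (- y^-1)) (expR (- x^-1) * (x ^- 2)).
    have DN : is_derive x (1 : R) (fun y : R => - y^-1) (x ^- 2).
      by rewrite -[x ^- 2]opprK; exact: is_deriveN.
    exact: (@is_derive1_comp _ expR (fun y => - y^-1)).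
  have Dg : is_derive x (1 : R) g
      (- k%:R * (x^-1 ^+ k.+1 * expR (- x^-1)) + x^-1 ^+ k.+2 * expR (- x^-1)).
    rewrite (_ : _ + _ = x^-1 ^+ k *: (expR (- x^-1) * (x ^- 2)) +
       expR (- x^-1) *: (k%:R * x^-1 ^+ k.-1 * (- x ^- 2))).
      exact: (@is_deriveM _ _ (fun y : R => y^-1 ^+ k) (fun y : R => expR (- y^-1))).
    have alg (E y : R) : - k%:R * (y ^+ k.+1 * E) + y ^+ k.+2 * E =
        y ^+ k * (E * y ^+ 2) + E * (k%:R * y ^+ k.-1 * - (y ^+ 2)).
      by case: k {e g DX} => [|k] /=; rewrite !exprS ?expr0; ring.
    by rewrite -[x ^- 2]exprVn; exact: alg.
  apply: DeriveDef; first by apply: near_eq_derivable e _; exact: ex_derive.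
  by rewrite -(near_eq_derive _ e); exact: derive_val.
- have flat0 j : flat j 0 = 0 by rewrite /flat ltxx.
  rewrite !flat0 mulr0 addr0.
  have c : (fun h : R => h^-1 *: ((flat k \o shift 0) (h *: (1 : R)) - flat k 0)) @ 0^' --> 0.
    rewrite flat0; apply: (@cvg_to_0_linear _ _ (k.+2)`!%:R 1) => // r _.
    rewrite subr0/= addr0 [r *: 1]mulr1 [_ *: _](_ : _ = flat k.+1 r).
      exact: flat_bound.
    rewrite /flat; case: ifP => _; last by rewrite scaler0.
    by rewrite exprS -mulrA.
  apply: DeriveDef; first by apply/cvg_ex; exists 0.
  exact: cvg_lim c.
Unshelve. all: by end_near. Qed.

Lemma smooth_flat k : smooth (flat k).
Proof.
apply: (@smooth_span [set h | exists k, h = flat k]); last first.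
  by apply: lin_span_in; exists k.
move=> _ [{}k ->]; exists (fun x => - k%:R * flat k.+1 x + flat k.+2 x).
  by apply: lin_span_comb; apply: lin_span_in; [exists k.+1|exists k.+2].
exact: is_derive_flat.
Qed.

(** Smooth functions supported in [a, b] which increase to the indicator of
]a, b[ as n tends to infinity. *)
Definition bump (a b : R) (n : nat) (x : R) : R :=
  flat 0 (n.+1%:R * x + - (n.+1%:R * a)) *
  flat 0 (- n.+1%:R * x + n.+1%:R * b).

Lemma smooth_bump a b n : smooth (bump a b n).
Proof. by apply: smoothM; apply: smooth_affine; exact: smooth_flat. Qed.

Lemma flat0_ge0 x : 0 <= flat 0 x.
Proof.
by rewrite /flat; case: ifP => // x0; rewrite mulr_ge0 ?exprn_ge0 ?expR_ge0// invr_ge0 ltW.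
Qed.

Lemma flat0_le1 x : flat 0 x <= 1.
Proof.
rewrite /flat; case: ifP => // x0; rewrite expr0 mul1r -expR0 ler_expR.
by rewrite oppr_le0 invr_ge0 ltW.
Qed.

Lemma bump_norm a b n x : `|bump a b n x| <= \1_(`]a, b[) x.
Proof.
rewrite /bump indicE mem_setE in_itv/=.
have -> : n.+1%:R * x + - (n.+1%:R * a) = n.+1%:R * (x - a) by ring.
have -> : - n.+1%:R * x + n.+1%:R * b = n.+1%:R * (b - x) by ring.
rewrite ger0_norm ?mulr_ge0 ?flat0_ge0//.
have [ax|xa] := ltP a x; have [xb|bx] := ltP x b => /=.
- by rewrite mulr_ile1 ?flat0_ge0 ?flat0_le1.
- rewrite [X in _ * X](_ : _ = 0) ?mulr0// /flat pmulr_rgt0// subr_gt0.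
  by rewrite ltNge bx.
- rewrite [X in X * _](_ : _ = 0) ?mul0r// /flat pmulr_rgt0// subr_gt0.
  by rewrite ltNge xa.
- rewrite [X in X * _](_ : _ = 0) ?mul0r// /flat pmulr_rgt0// subr_gt0.
  by rewrite ltNge xa.
Qed.

Lemma flat0_cvg (c : R) : 0 < c -> (fun n => flat 0 (n.+1%:R * c)) @ \oo --> (1 : R).
Proof.
move=> c0.
rewrite (_ : (fun n => _) = (fun n => expR (- (c^-1 * harmonic n)))); last first.
  apply/funext => n; rewrite /flat pmulr_rgt0// c0 expr0 mul1r /harmonic/=.
  by congr (expR (- _)); rewrite invfM mulrC.
rewrite -expR0 -oppr0 -(mulr0 c^-1).
apply: (@continuous_cvg _ _ _ _ _ _ expR); first exact: continuous_expR.
by apply: cvgN; apply: cvgMr; exact: cvg_harmonic.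
Qed.

Lemma bump_cvg a b x : (fun n => bump a b n x) @ \oo --> (\1_(`]a, b[) x : R).
Proof.
rewrite indicE mem_setE; case: (boolP (x \in `]a, b[)) => [|xab]; last first.
  rewrite (_ : (fun n => _) = cst 0); first exact: cvg_cst.
  apply/funext => n; apply/eqP; rewrite -normr_le0.
  by have := bump_norm a b n x; rewrite indicE mem_setE (negbTE xab).
rewrite in_itv/= => /andP[ax xb].
rewrite -[X in _ --> X](mulr1 (1:R)).
rewrite (_ : (fun n => _) = (fun n => flat 0 (n.+1%:R * (x - a)) * flat 0 (n.+1%:R * (b - x)))).
  by apply: cvgM; apply: flat0_cvg; rewrite subr_gt0.
by apply/funext => n; rewrite /bump; congr (flat 0 _ * flat 0 _); ring.
Qed.

End smooth_functions.

(** * Test functions and the fundamental lemma *)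

Section test_functions.
Context {R : realType}.
Local Notation RR := (measurableTypeR R).
Local Notation leb := (@lebesgue_measure R).
Implicit Types (f g w u phi psi : R -> R).

Lemma leb_aeS (P Q : R -> Prop) : (forall x, P x -> Q x) ->
  {ae leb, forall x, P x} -> {ae leb, forall x, Q x}.
Proof. exact: (@filterS _ _ (ae_filter_ringOfSetsType leb)). Qed.

Lemma leb_aeS2 (P P' Q : R -> Prop) : (forall x, P x -> P' x -> Q x) ->
  {ae leb, forall x, P x} -> {ae leb, forall x, P' x} ->
  {ae leb, forall x, Q x}.
Proof. exact: (@filterS2 _ _ (ae_filter_ringOfSetsType leb)). Qed.

(** Real-valued smooth functions of bounded support. *)
Definition real_test phi :=
  smooth phi /\ exists N : R, forall x, N <= `|x| -> phi x = 0.

Let mitv (i : interval R) : measurable ([set` i] : set RR).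
Proof. exact: measurable_itv. Qed.

Lemma bounded_on_itv f (a b : R) : continuous f ->
  exists2 M, 0 <= M & forall x, a <= x <= b -> `|f x| <= M.
Proof.
move=> cf; have [ab|ba] := leP a b; last first.
  by exists 0 => // x /andP[ax xb]; move: ba; rewrite ltNge (le_trans ax xb).
have cnf : {within `[a, b], continuous (fun x => `|f x|)}.
  apply: continuous_subspaceT => x.
  by apply: continuous_comp; [exact: cf|exact: norm_continuous].
have [c _ Hc] := EVT_max ab cnf; exists `|f c| => // x xab; exact: Hc.
Qed.

Lemma integrable_continuous (m : {measure set RR -> \bar R}) f (a b : R) :
  continuous f -> (m `]a, b]%classic < +oo)%E -> m.-integrable `]a, b] (EFin \o f).
Proof.
move=> cf mab; apply: measurable_bounded_integrable => //.
  by apply: measurable_funTS; exact: continuous_measurable_fun.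
have [M _ HM] := bounded_on_itv a b cf.
exists M; split; first exact: num_real.
move=> y My x; rewrite /= in_itv/= => /andP[ax xb].
by rewrite (le_trans _ (ltW My))// HM// (ltW ax).
Qed.

Lemma integrable_mul_continuous (m : {measure set RR -> \bar R}) f g (a b : R) :
  m.-integrable `]a, b] (EFin \o f) -> continuous g ->
  m.-integrable `]a, b] (EFin \o (fun x => f x * g x)).
Proof.
move=> fi cg; rewrite (_ : _ \o _ = (EFin \o f) \* (EFin \o g))%E; last first.
  by apply/funext => x /=; rewrite EFinM.
apply: integrableMl => //.
  by apply: measurable_funTS; exact: continuous_measurable_fun.
have [M _ HM] := bounded_on_itv a b cg.
exists M; split; first exact: num_real.
move=> y My x; rewrite /= in_itv/= => /andP[ax xb].
by rewrite (le_trans _ (ltW My))// HM// (ltW ax).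
Qed.

Lemma locally_integrable_itv f : locally_integrable setT f ->
  forall a b : R, leb.-integrable `]a, b] (EFin \o f).
Proof.
move=> [mf _ fK] a b; apply: (@integrableS _ RR R leb `[a, b]%classic) => //.
  by apply: subset_itvr; rewrite bnd_simp.
apply/integrableP; split.
  by apply/measurable_EFinP; exact: measurable_funTS.
by apply: fK => //; exact: segment_compact.
Qed.

Lemma bigcup_itvT : \bigcup_n `]- n%:R, n%:R]%classic = [set: R].
Proof.
apply/seteqP; split => // x _.
exists (Num.truncn `|x|).+1 => //=; rewrite in_itv/=.
have := truncnS_gt `|x|; rewrite ltr_norml => /andP[-> /ltW].
by [].
Qed.

Lemma itv_locally_integrable f :
  (forall n : nat, leb.-integrable `]- n%:R, n%:R] (EFin \o f)) ->
  locally_integrable setT f.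
Proof.
move=> fi; split; last 1 first.
- move=> K _ cK; have [M [_ HM]] := compact_bounded cK.
  pose n := (Num.truncn (`|M| + 1)).+1.
  have /integrableP[mf] := fi n; apply: le_lt_trans.
  apply: ge0_subset_integral => //.
  - exact: compact_measurable.
  - by apply/measurable_EFinP; apply: measurableT_comp => //; apply/measurable_EFinP.
  - move=> x Kx; rewrite /= in_itv/=.
    have Mx : `|x| <= `|M| + 1.
      by apply: HM => //; rewrite (le_lt_trans (ler_norm _))// ltrDl.
    have := le_lt_trans Mx (truncnS_gt _).
    by rewrite -/n ltr_norml => /andP[-> /ltW].
- rewrite -bigcup_itvT; apply/measurable_fun_bigcup => // n.
  by have /measurable_int/measurable_EFinP := fi n.
- exact: openT.
Qed.

Lemma Rintegral_supp (m : {measure set RR -> \bar R}) f (D : set R) :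
    (forall x, ~ D x -> f x = 0) ->
  \int[m]_(x in setT) f x = \int[m]_(x in D) f x.
Proof.
move=> f0; rewrite [RHS]Rintegral_mkcond; congr Rintegral.
apply/funext => x; rewrite patchE; case: ifPn => // xD.
by rewrite f0// => Dx; move: xD; rewrite mem_set.
Qed.

Lemma integrable_supp (m : {measure set RR -> \bar R}) f (D : set R) :
    measurable (D : set RR) -> (forall x, ~ D x -> f x = 0) ->
  m.-integrable D (EFin \o f) -> m.-integrable setT (EFin \o f).
Proof.
move=> mD f0 /(integrable_mkcond _ mD); rewrite restrict_EFin.
apply: eq_integrable => // x _ /=; congr EFin; rewrite patchE; case: ifPn => // xD.
by rewrite f0// => Dx; move: xD; rewrite mem_set.
Qed.

Lemma supp_itv f N : (forall x : R, N <= `|x| -> f x = 0) ->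
  forall x, ~ (`]- N, N]%classic x) -> f x = 0.
Proof.
move=> f0 x xN; apply: f0; rewrite leNgt; apply/negP => xl; apply: xN.
by rewrite /= in_itv/=; move: xl; rewrite ltr_norml => /andP[-> /ltW].
Qed.

Lemma supp_itv_big f N a b : (forall x : R, N <= `|x| -> f x = 0) ->
  a <= - N -> N <= b -> forall x, ~ (`]a, b]%classic x) -> f x = 0.
Proof.
move=> f0 aN Nb x xN; apply: (supp_itv f0) => xI; apply: xN.
move: xI; rewrite /= !in_itv/= => /andP[Nx xN].
by rewrite (le_lt_trans aN Nx) (le_trans xN Nb).
Qed.

Lemma integrable_mul_test w phi : locally_integrable setT w -> real_test phi ->
  leb.-integrable setT (EFin \o (fun x => w x * phi x)).
Proof.
move=> lw [sphi [N phi0]].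
apply: (@integrable_supp _ _ `]- N, N]) => //.
- by move=> x /(supp_itv phi0) ->; rewrite mulr0.
- apply: integrable_mul_continuous; first exact: locally_integrable_itv.
  exact: smooth_continuous.
Qed.

Lemma real_test_derive1 phi : real_test phi -> real_test (derive1 phi).
Proof.
move=> [sphi [N phi0]]; split; first exact: smooth_derive1.
exists (N + 1) => x Nx; rewrite derive1E.
have e : \forall y \near x, (cst 0 : R -> R) y = phi y.
  near=> y; rewrite phi0//.
  have : `|x - y| < 1 by near: y; apply: cvgr_dist_lt => //; exact: cvg_id.
  have := ler_dist_dist x y; have := ler_norm (`|x| - `|y|).
  by lra.
by rewrite -(near_eq_derive _ e) derive_cst.
Unshelve. all: by end_near. Qed.

Lemma real_test_bump (a b : R) n : real_test (bump a b n).
Proof.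
split; first exact: smooth_bump.
exists (`|a| + `|b|) => x xab; apply/eqP; rewrite -normr_le0.
apply: le_trans (bump_norm a b n x) _.
rewrite indicE mem_setE in_itv/=; case: andP => // -[ax xb].
have := ler_norm b; have := ler_norm (- a); rewrite normrN => h1 h2.
have h3 := normr_ge0 a; have h4 := normr_ge0 b.
have : `|x| < `|a| + `|b| by rewrite ltr_norml; apply/andP; split; lra.
by rewrite ltNge xab.
Qed.

Lemma real_test_comb (a : R) phi psi : real_test phi -> real_test psi ->
  real_test (fun x => a * phi x + psi x).
Proof.
move=> [sphi [N phi0]] [spsi [M psi0]]; split; first exact: smooth_comb.
by exists (Num.max N M) => x; rewrite ge_max => /andP[Nx Mx];
  rewrite phi0// psi0// mulr0 addr0.
Qed.

Lemma bump_integral_cvg w (a b : R) : a < b -> locally_integrable setT w ->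
  (fun n => \int[leb]_x (w x * bump a b n x)) @ \oo
    --> \int[leb]_(x in `]a, b[) w x.
Proof.
move=> ab lw; have [mw _ _] := lw.
have wi : leb.-integrable `]a, b[ (EFin \o w).
  apply: (@integrableS _ RR R leb `]a, b]%classic) => //; last exact: locally_integrable_itv.
  by apply: subset_itvl; rewrite bnd_simp.
have E n : (\int[leb]_x (w x * bump a b n x))%:E =
    (\int[leb]_x (w x * bump a b n x)%:E)%E.
  rewrite EFin_Rintegral//.
  by apply: integrable_mul_test => //; exact: real_test_bump.
have E' : (\int[leb]_(x in `]a, b[) w x)%:E =
    (\int[leb]_x (w x * \1_(`]a, b[) x)%:E)%E.
  rewrite EFin_Rintegral// integral_mkcond; apply: eq_integral => x _.
  by rewrite patchE indicE; case: ifP; rewrite ?mulr1 ?mulr0.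
suff : (\int[leb]_x (w x * bump a b n x)%:E)%E @[n --> \oo] -->
    (\int[leb]_(x in `]a, b[) w x)%:E by exact: fine_cvg.
rewrite E'.
apply: (@dominated_cvg _ _ _ leb setT _ _ _ (fun x => (`|w x| * \1_(`]a, b[) x)%:E)) => //.
- move=> n; apply/measurable_EFinP; apply: measurable_funM => //.
  by apply: continuous_measurable_fun; apply: smooth_continuous; exact: smooth_bump.
- move=> x _; apply: cvg_EFin; first exact: nearW.
  by apply: cvgMr; exact: bump_cvg.
- have := integrable_abse wi; move/(integrable_mkcond _ (mitv _)).
  apply: eq_integrable => // x _; rewrite patchE indicE.
  by case: ifP; rewrite ?mulr1 ?mulr0.
- move=> n x _; rewrite abse_EFin lee_fin normrM ler_wpM2l//.
  exact: bump_norm.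
Qed.

(** By Lebesgue's differentiation theorem, applied to the restrictions of w to
bounded intervals. *)
Lemma itv_integral_ae0 w : locally_integrable setT w ->
  (forall a b : R, a < b -> \int[leb]_(x in `]a, b]) w x = 0) ->
  {ae leb, forall x, w x = 0}.
Proof.
move=> lw w0; have [mw _ _] := lw.
have wN n : {ae leb, forall x, (w \_ `]- n%:R, n%:R]) x = 0}.
  set wn := w \_ _.
  have wni : leb.-integrable setT (EFin \o wn).
    rewrite /wn -restrict_EFin; apply/(integrable_mkcond _ (mitv _)).
    exact: locally_integrable_itv.
  have wny y : leb.-integrable `]-oo, y] (EFin \o wn) by exact: integrableS wni.
  have := FTC1Ny wny (open_integrable_locally openT wni).
  move=> /=; apply: leb_aeS => x [_ <-]; rewrite (_ : (fun _ => _) = cst 0).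
    by rewrite derive1E derive_cst.
  apply/funext => y; rewrite /wn -Rintegral_mkcondr.
  have [yn|yn] := leP y (- n%:R).
    rewrite (_ : _ `&` _ = set0) ?Rintegral_set0//.
    apply/seteqP; split => // z [] /=; rewrite !in_itv/= => zy /andP[nz _].
    by have := lt_le_trans nz (le_trans zy yn); rewrite ltxx.
  rewrite (_ : _ `&` _ = `]- n%:R, (Num.min y n%:R)]%classic).
    have [nz|zn] := ltP (- n%:R) (Num.min y n%:R); first exact: w0.
    by rewrite set_itv_ge ?Rintegral_set0// bnd_simp -leNgt.
  apply/seteqP; split => z /=; rewrite !in_itv/= le_min.
    by move=> [-> /andP[-> ->]].
  by move=> /andP[-> /andP[-> ->]].
have := ae_foralln wN; apply: leb_aeS => x w0x.
have : [set: R] x by []; rewrite -bigcup_itvT => -[n _ nx].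
by have := w0x n; rewrite patchE mem_set.
Qed.

(** The fundamental lemma of the calculus of variations. *)
Lemma test_ae0 w : locally_integrable setT w ->
  (forall phi, real_test phi -> \int[leb]_x (w x * phi x) = 0) ->
  {ae leb, forall x, w x = 0}.
Proof.
move=> lw w0; apply: itv_integral_ae0 => // a b ab.
rewrite -Rintegral_itv_bndo_bndc; last first.
  apply: (@integrableS _ RR R leb `]a, b]%classic) => //; last exact: locally_integrable_itv.
  by apply: subset_itvl; rewrite bnd_simp.
have := bump_integral_cvg ab lw.
rewrite (_ : (fun n => _) = cst 0); last first.
  by apply/funext => n; apply: w0; exact: real_test_bump.
by move=> /(cvg_lim (@Rhausdorff R)) <-; rewrite lim_cst.
Qed.

Lemma locally_integrable_cst (c : R) : locally_integrable setT (cst c).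
Proof.
apply: itv_locally_integrable => n; apply: integrable_continuous.
  exact: cst_continuous.
by rewrite /= lebesgue_measure_itv/=; case: ifP => // _; rewrite -EFinB ltry.
Qed.

(** Some bump on ]0, 1[ has nonzero integral, since the integrals of the bumps
tend to 1. *)
Lemma unit_mass_test : exists2 rho, real_test rho & \int[leb]_x rho x = 1.
Proof.
have [n n0] : exists n, \int[leb]_x (1 * bump 0 1 n x) != 0.
  apply: contrapT => /forallNP h.
  have := bump_integral_cvg ltr01 (locally_integrable_cst 1).
  rewrite (_ : (fun n => _) = cst 0); last first.
    by apply/funext => n; apply/eqP; have /negP := h n; rewrite negbK.
  move=> /(cvg_lim (@Rhausdorff R)); rewrite lim_cst//.
  rewrite Rintegral_cst// mul1r /= lebesgue_measure_itv/= lte_fin ltr01.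
  by rewrite oppr0 adde0 => /eqP; rewrite eq_sym oner_eq0.
pose I := \int[leb]_x (1 * bump 0 1 n x).
have tb := real_test_bump 0 1 n.
exists (fun x => I^-1 * bump 0 1 n x + 0).
  by apply: real_test_comb => //; split; [exact: smooth_cst|exists 0].
have -> : \int[leb]_x (I^-1 * bump 0 1 n x + 0) =
    \int[leb]_x (I^-1 * (1 * bump 0 1 n x)).
  by apply: eq_Rintegral => x _; rewrite addr0 mul1r.
rewrite RintegralZl//; last exact: (integrable_mul_test (locally_integrable_cst 1)).
by rewrite mulVf.
Qed.

(** The primitive from minus infinity vanishes to the right of the support
because the total integral is 0. *)
Lemma test_primitive psi : real_test psi -> \int[leb]_x psi x = 0 ->
  exists2 phi, real_test phi & derive1 phi = psi.
Proof.
move=> tpsi I0; have [spsi [N psi0]] := tpsi.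
have psii : leb.-integrable setT (EFin \o psi).
  have := integrable_mul_test (locally_integrable_cst 1) tpsi.
  by apply: eq_integrable => // x _ /=; rewrite mul1r.
pose phi x := \int[leb]_(t in `]-oo, x]) psi t.
have D x : is_derive x (1 : R) phi (psi x).
  have psiy : leb.-integrable `]-oo, (x + 1)] (EFin \o psi).
    exact: integrableS psii.
  have xx1 : x < x + 1 by rewrite ltrDl.
  have [d e] := continuous_FTC1 xx1 psiy (ltNyr x) (smooth_continuous spsi (x := x)).
  by apply: DeriveDef; [exact: d|rewrite -derive1E; exact: e].
have Dphi : derive1 phi = psi.
  by apply/funext => x; rewrite derive1E; exact: derive_val.
exists phi; last exact: Dphi.
split.
  apply: (@smooth_span _ [set h | h = phi \/ smooth h]); last by apply: lin_span_in; left.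
  move=> h [->|sf]; first by exists psi; [apply: lin_span_in; right|exact: D].
  eexists; last by move=> x; exact: smooth_is_derive.
  by apply: lin_span_in; right; exact: smooth_derive1.
exists (`|N| + 1) => x Nx.
have NN : N <= `|N| := ler_norm N.
have [x0|x0] := ltP x 0.
  rewrite /phi (_ : \int[leb]_(t in _) _ = \int[leb]_(t in `]-oo, x]) cst 0 t).
    by rewrite Rintegral_cst// mul0r.
  apply: eq_Rintegral => t; rewrite mem_setE in_itv/= => tx; apply: psi0.
  move: (t : R) tx => {}t tx.
  rewrite (ltr0_norm x0) in Nx; rewrite ltr0_norm; last exact: le_lt_trans x0.
  by lra.
rewrite -I0; apply/esym; apply: Rintegral_supp => t; rewrite /= in_itv/= => /negP.
rewrite -ltNge => xt; apply: psi0; rewrite (ger0_norm x0) in Nx.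
move: (t : R) xt => {}t xt.
by rewrite gtr0_norm; lra.
Qed.

End test_functions.

(** * Primitives and weak derivatives *)

Section primitives.
Context {R : realType}.
Local Notation RR := (measurableTypeR R).
Local Notation leb := (@lebesgue_measure R).
Implicit Types (f g k w u v phi psi : R -> R).

Let mitv (i : interval R) : measurable ([set` i] : set RR).
Proof. exact: measurable_itv. Qed.

(** The primitive of f with respect to m that vanishes at 0, with the
orientation convention for negative upper bounds. *)
Definition primitive (m : {measure set RR -> \bar R}) f (t : R) : R :=
  if 0 <= t then \int[m]_(x in `]0, t]) f x else - \int[m]_(x in `]t, 0]) f x.

Lemma primitiveB (m : {measure set RR -> \bar R}) f :
  (forall a b : R, m.-integrable `]a, b] (EFin \o f)) ->
  forall s t, s <= t ->
  primitive m f t = primitive m f s + \int[m]_(x in `]s, t]) f x.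
Proof.
move=> fi s t st; rewrite /primitive.
have [t0|t0] := leP 0 t; have [s0|s0] := leP 0 s.
- exact: Rintegral_split.
- by rewrite (Rintegral_split (ltW s0) t0 (fi s t)); ring.
- by have := lt_le_trans t0 s0; rewrite ltNge st.
- by rewrite (Rintegral_split st (ltW t0) (fi s 0)); ring.
Qed.

Lemma leb_itv_fin (a b : R) : (leb `]a, b]%classic < +oo)%E.
Proof.
by rewrite lebesgue_measure_itv/=; case: ifP => // _; rewrite -EFinB ltry.
Qed.

Lemma primitive_continuous g v : locally_integrable setT g ->
  (forall s t, s <= t -> v t = v s + \int[leb]_(x in `]s, t]) g x) ->
  continuous v.
Proof.
move=> lg vE x.
have gi := locally_integrable_itv lg.
pose a := x - 1; pose b := x + 1.
have ab : a < b by rewrite /a /b; lra.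
have gic y : leb.-integrable `[a, y] (EFin \o g).
  apply: (@integrableS _ RR R leb `]a - 1, y]%classic) => // z.
  by rewrite /= !in_itv/= => /andP[az ->]; rewrite andbT (lt_le_trans _ az)// gtrBl.
have /(continuous_within_itvP _ ab)[+ _ _] :=
  parameterized_integral_continuous (ltW ab) (gic b).
have xab : x \in `]a, b[ by rewrite in_itv/= /a /b; apply/andP; split; lra.
move=> /(_ x xab) cx.
have E : \forall y \near x, v a + parameterized_integral leb a y g = v y.
  near=> y; rewrite (vE a y).
    by congr (_ + _); rewrite /parameterized_integral Rintegral_itv_obnd_cbnd.
  have : `|x - y| < 1 by near: y; apply: cvgr_dist_lt => //; exact: cvg_id.
  by rewrite ltr_distlC /a => /andP[/ltW].
rewrite /continuous_at -(nbhs_singleton E).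
have vc : (fun y => v a + parameterized_integral leb a y g) y @[y --> x] -->
    v a + parameterized_integral leb a x g.
  by apply: cvgD; [exact: cvg_cst|exact: cx].
exact: (cvg_trans (near_eq_cvg E) vc).
Unshelve. all: by end_near. Qed.

Lemma smooth_FTC phi : smooth phi -> forall s t : R, s <= t ->
  phi t = phi s + \int[leb]_(x in `]s, t]) derive1 phi x.
Proof.
move=> sphi s t; rewrite le_eqVlt => /predU1P[->|st].
  by rewrite set_itvoc0 Rintegral_set0 addr0.
have cphi := smooth_continuous sphi.
have cd := smooth_continuous (smooth_derive1 sphi).
rewrite Rintegral_itv_obnd_cbnd; last first.
  by apply: integrable_continuous; [exact: cd|exact: leb_itv_fin].
rewrite /Rintegral (@continuous_FTC2 _ _ phi)//=; first by ring.
- exact: continuous_subspaceT.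
- split.
  + by move=> x _; exact: smooth_derivable.
  + by apply: cvg_at_right_filter; exact: cphi.
  + by apply: cvg_at_left_filter; exact: cphi.
Qed.

(** g is the distributional derivative of u, for locally integrable real
functions. *)
Definition real_weak_derivative u g :=
  [/\ locally_integrable setT u, locally_integrable setT g &
    forall phi, real_test phi ->
      \int[leb]_x (u x * derive1 phi x) = - \int[leb]_x (g x * phi x)].

Lemma locally_integrable_continuous f : continuous f ->
  locally_integrable setT f.
Proof.
move=> cf; apply: itv_locally_integrable => n; apply: integrable_continuous => //.
exact: leb_itv_fin.
Qed.

(** Integration by parts against a test function kills the boundary terms. *)
Lemma primitive_test_parts (m : {sigma_finite_measure set RR -> \bar R}) f F phi :
  (forall a b : R, m.-integrable `]a, b] (EFin \o f)) ->
  (forall s t, s <= t -> F t = F s + \int[m]_(x in `]s, t]) f x) ->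
  real_test phi ->
  \int[leb]_x (F x * derive1 phi x) = - \int[m]_x (f x * phi x).
Proof.
move=> fi FE tphi; have [sphi [N phi0]] := tphi.
have [_ [M dphi0]] := real_test_derive1 tphi.
pose b := `|N| + `|M|; pose a := - b.
have bN : N <= b by rewrite /b; have := ler_norm N; have := normr_ge0 M; lra.
have bM : M <= b by rewrite /b; have := ler_norm M; have := normr_ge0 N; lra.
have b0 : 0 <= b by rewrite addr_ge0.
have ab : a <= b by rewrite /a; lra.
have di : leb.-integrable `]a, b] (EFin \o derive1 phi).
  apply: integrable_continuous; last exact: leb_itv_fin.
  by apply: smooth_continuous; exact: smooth_derive1.
have [_ _] := integral_by_parts ab (fi a b) di
  (fun t h => FE a t (proj1 (andP h))) (fun t h => smooth_FTC sphi (proj1 (andP h))).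
rewrite [phi b]phi0 ?ger0_norm// [phi a]phi0 ?normrN ?ger0_norm//.
rewrite !mulr0 subr0 => /eqP; rewrite addr_eq0 => /eqP E.
rewrite (@Rintegral_supp _ _ _ `]a, b]); last first.
  by move=> x /(supp_itv_big dphi0) ->; rewrite ?mulr0// /a; lra.
rewrite E; congr (- _); apply/esym; apply: Rintegral_supp.
by move=> x /(supp_itv_big phi0) ->; rewrite ?mulr0// /a; lra.
Qed.

Lemma primitive_weak_derivative g v : locally_integrable setT g ->
  (forall s t, s <= t -> v t = v s + \int[leb]_(x in `]s, t]) g x) ->
  real_weak_derivative v g.
Proof.
move=> lg vE; split => //.
  by apply: locally_integrable_continuous; exact: primitive_continuous vE.
by move=> phi; apply: primitive_test_parts => //; exact: locally_integrable_itv.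
Qed.

Lemma eq_RintegralT f g : f =1 g -> \int[leb]_x f x = \int[leb]_x g x.
Proof. by move=> fg; apply: eq_Rintegral => x _; exact: fg. Qed.

Lemma RintegralD_test w w' phi psi : locally_integrable setT w ->
  locally_integrable setT w' -> real_test phi -> real_test psi ->
  \int[leb]_x (w x * phi x + w' x * psi x) =
  \int[leb]_x (w x * phi x) + \int[leb]_x (w' x * psi x).
Proof. by move=> *; rewrite RintegralD//; exact: integrable_mul_test. Qed.

Lemma RintegralM_test (c : R) w phi : locally_integrable setT w ->
  real_test phi -> \int[leb]_x (w x * (c * phi x)) = c * \int[leb]_x (w x * phi x).
Proof.
move=> lw tphi; rewrite -RintegralZl//; last exact: integrable_mul_test.
by apply: eq_Rintegral => x _; ring.
Qed.

Lemma real_test0 : real_test (cst 0 : R -> R).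
Proof. by split; [exact: smooth_cst|exists 0]. Qed.

Lemma real_testZ (c : R) phi : real_test phi -> real_test (fun x => c * phi x).
Proof.
move=> tphi; rewrite (_ : (fun _ => _) = (fun x => c * phi x + cst 0 x)).
  by apply: real_test_comb => //; exact: real_test0.
by apply/funext => x; rewrite addr0.
Qed.

(** A test function, minus the multiple of rho of the same integral, is the
derivative of a test function. *)
Lemma test_split rho psi : real_test rho -> \int[leb]_x rho x = 1 -> real_test psi ->
  exists2 phi, real_test phi &
    forall x, derive1 phi x = - (\int[leb]_x psi x) * rho x + psi x.
Proof.
move=> trho rho1 tpsi.
have tt := real_test_comb (- (\int[leb]_x psi x)) trho tpsi.
have l1 : locally_integrable setT (cst 1 : R -> R) := locally_integrable_cst 1.
have int1 phi : real_test phi -> leb.-integrable setT (EFin \o phi).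
  move=> tphi; have := integrable_mul_test l1 tphi.
  by apply: eq_integrable => // x _ /=; rewrite mul1r.
have [|phi tphi E] := test_primitive tt; last by exists phi => // x; rewrite E.
rewrite RintegralD//; first by rewrite RintegralZl ?int1// rho1; ring.
- exact: int1 (real_testZ _ trho).
- exact: int1.
Qed.

Lemma derive1_comb (a : R) phi psi : smooth phi -> smooth psi ->
  derive1 (fun x => a * phi x + psi x) =
  (fun x => a * derive1 phi x + derive1 psi x).
Proof.
move=> sphi spsi; apply/funext => x.
have Dphi := smooth_is_derive x sphi; have Dpsi := smooth_is_derive x spsi.
have D : is_derive x (1 : R) (a \*: phi + psi) (a * derive1 phi x + derive1 psi x).
  exact: is_deriveD.
by rewrite derive1E; exact: (derive_val (f := a \*: phi + psi)).
Qed.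

(** The lemma of du Bois-Reymond. *)
Lemma weak_derivative0_cst w : locally_integrable setT w ->
  (forall phi, real_test phi -> \int[leb]_x (w x * derive1 phi x) = 0) ->
  exists c, {ae leb, forall x, w x = c}.
Proof.
move=> lw w0; have [rho trho rho1] := @unit_mass_test R.
pose c := \int[leb]_x (w x * rho x); exists c.
have lwc : locally_integrable setT (fun x => w x - c).
  exact: (locally_integrableB lw (locally_integrable_cst c)).
suff : {ae leb, forall x, w x - c = 0}.
  by apply: leb_aeS => x /eqP; rewrite subr_eq0 => /eqP.
apply: test_ae0 => // psi tpsi.
have [phi tphi dphi] := test_split trho rho1 tpsi.
have := w0 phi tphi.
set I := \int[leb]_x psi x in dphi.
rewrite (@eq_RintegralT _ (fun x => w x * (- I * rho x) + w x * psi x)); last first.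
  by move=> x; rewrite dphi mulrDr.
rewrite (RintegralD_test lw lw (real_testZ _ trho) tpsi).
rewrite (RintegralM_test _ lw trho) -/c => E.
rewrite (@eq_RintegralT (fun x => (w x - c) * psi x) (fun x => w x * psi x + cst 1 x * (- c * psi x))); last first.
  by move=> x /=; ring.
have l1 := @locally_integrable_cst R 1.
rewrite (RintegralD_test lw l1 tpsi (real_testZ _ tpsi)) (RintegralM_test _ l1 tpsi).
rewrite [X in _ + - c * X](_ : _ = I); last by apply: eq_Rintegral => x _; rewrite mul1r.
by rewrite -E; ring.
Qed.

(** If the second distributional derivative of u is the derivative of k, then
k is a derivative of u up to a constant. *)
Lemma weak_derivative_up_to_cst u k : locally_integrable setT u ->
  locally_integrable setT k ->
  (forall phi, real_test phi ->
    \int[leb]_x (u x * derive1 (derive1 phi) x) =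
    - \int[leb]_x (k x * derive1 phi x)) ->
  exists c, real_weak_derivative u (fun x => k x + c).
Proof.
move=> lu lk uk; have [rho trho rho1] := @unit_mass_test R.
pose c := - (\int[leb]_x (u x * derive1 rho x) + \int[leb]_x (k x * rho x)).
exists c; split => //.
  exact: (locally_integrableD lk (locally_integrable_cst c)).
move=> psi tpsi.
have [phi tphi dphi] := test_split trho rho1 tpsi.
have := uk phi tphi.
have {}dphi := funext dphi.
set I := \int[leb]_x psi x in dphi.
have [srho _] := trho; have [spsi _] := tpsi.
rewrite dphi derive1_comb//.
rewrite (@eq_RintegralT _ (fun x => u x * (- I * derive1 rho x) + u x * derive1 psi x)); last first.
  by move=> x; rewrite mulrDr.
have trho' := real_test_derive1 trho; have tpsi' := real_test_derive1 tpsi.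
rewrite (RintegralD_test lu lu (real_testZ _ trho') tpsi').
rewrite (RintegralM_test _ lu trho').
rewrite (@eq_RintegralT (fun x => k x * (- I * rho x + psi x)) (fun x => k x * (- I * rho x) + k x * psi x)); last first.
  by move=> x; rewrite mulrDr.
rewrite (RintegralD_test lk lk (real_testZ _ trho) tpsi).
rewrite (RintegralM_test _ lk trho) => E.
rewrite (@eq_RintegralT (fun x => (k x + c) * psi x) (fun x => k x * psi x + cst 1 x * (c * psi x))); last first.
  by move=> x /=; ring.
have l1 := @locally_integrable_cst R 1.
rewrite (RintegralD_test lk l1 tpsi (real_testZ _ tpsi)) (RintegralM_test _ l1 tpsi).
rewrite [X in _ + c * X](_ : _ = I); last by apply: eq_Rintegral => x _; rewrite mul1r.
rewrite /c; move: E.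
move: (Rintegral _ _ _) => A; move: (Rintegral _ _ _) => B.
move: (Rintegral _ _ _) => C; move: (Rintegral _ _ _) => D.
by move=> E; lra.
Qed.

Lemma ae_eq_Rintegral (m : {measure set RR -> \bar R}) (D : set R) f g :
  measurable (D : set RR) -> measurable_fun D f -> measurable_fun D g ->
  {ae m, forall x, f x = g x} ->
  \int[m]_(x in D) f x = \int[m]_(x in D) g x.
Proof.
move=> mD mf mg fg; congr fine; apply: ae_eq_integral => //.
- exact/measurable_EFinP.
- exact/measurable_EFinP.
- apply: (@filterS _ _ (ae_filter_ringOfSetsType m) _ _ _ fg) => x e _.
  by rewrite e.
Qed.

Lemma eq_ae_weak_derivative u u' g g' : real_weak_derivative u g ->
  measurable_fun setT u' -> measurable_fun setT g' ->
  {ae leb, forall x, u x = u' x} -> {ae leb, forall x, g x = g' x} ->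
  real_weak_derivative u' g'.
Proof.
have loc h h' : locally_integrable setT h -> measurable_fun setT h' ->
    {ae leb, forall x, h x = h' x} -> locally_integrable setT h'.
  move=> [mh oT hK] mh' e; split => // K _ cK.
  rewrite -(@ae_eq_integral _ RR R leb K (fun x => `|h' x|%:E) (fun x => `|h x|%:E)); first exact: hK.
  - exact: compact_measurable.
  - by apply/measurable_EFinP; apply: measurableT_comp => //; exact: measurable_funTS.
  - by apply/measurable_EFinP; apply: measurableT_comp => //; exact: measurable_funTS.
  - by move: e; apply: leb_aeS => x -> _.
move=> [lu lg ug] mu' mg' uu' gg'; split; [exact: loc uu'|exact: loc gg'|].
move=> phi tphi; have [mu _ _] := lu; have [mg _ _] := lg.
have mt psi : real_test psi -> measurable_fun setT psi.
  by move=> [sp _]; apply: continuous_measurable_fun; exact: smooth_continuous.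
have := ug phi tphi.
rewrite (@ae_eq_Rintegral leb _ _ (fun x => u' x * derive1 phi x))//.
- move=> ->; congr (- _); apply: ae_eq_Rintegral => //.
  + by apply: measurable_funM => //; exact: mt.
  + by apply: measurable_funM => //; exact: mt.
  + by move: gg'; apply: leb_aeS => x ->.
- by apply: measurable_funM => //; exact: mt (real_test_derive1 tphi).
- by apply: measurable_funM => //; exact: mt (real_test_derive1 tphi).
- by move: uu'; apply: leb_aeS => x ->.
Qed.

Lemma weak_derivative_unique u g g' : real_weak_derivative u g ->
  real_weak_derivative u g' -> {ae leb, forall x, g x = g' x}.
Proof.
move=> [_ lg ug] [_ lg' ug'].
suff : {ae leb, forall x, g x - g' x = 0}.
  by apply: leb_aeS => x /eqP; rewrite subr_eq0 => /eqP.
apply: test_ae0; first exact: (locally_integrableB lg lg').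
move=> phi tphi.
rewrite (@eq_RintegralT _ (fun x => g x * phi x - g' x * phi x)); last first.
  by move=> x; rewrite mulrBl.
rewrite RintegralB//; last 2 first.
- exact: integrable_mul_test.
- exact: integrable_mul_test.
by apply/eqP; rewrite subr_eq0 -eqr_opp -ug// -ug'.
Qed.

Lemma weak_derivative_primitive u g : real_weak_derivative u g ->
  exists2 v, {ae leb, forall x, u x = v x} &
    forall s t, s <= t -> v t = v s + \int[leb]_(x in `]s, t]) g x.
Proof.
move=> [lu lg ug].
have PE := primitiveB (locally_integrable_itv lg).
have [_ _ Pg] := primitive_weak_derivative lg PE.
have lP : locally_integrable setT (primitive leb g).
  by apply: locally_integrable_continuous; exact: primitive_continuous PE.
have [||c uc] := @weak_derivative0_cst (fun x => u x - primitive leb g x).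
- exact: (locally_integrableB lu lP).
- move=> phi tphi; have tphi' := real_test_derive1 tphi.
  rewrite (@eq_RintegralT _ (fun x => u x * derive1 phi x -
      primitive leb g x * derive1 phi x)); last first.
    by move=> x; rewrite mulrBl.
  rewrite RintegralB//; last 2 first.
  + exact: integrable_mul_test.
  + exact: integrable_mul_test.
  by rewrite ug// Pg// subrr.
exists (fun x => c + primitive leb g x).
  by move: uc; apply: leb_aeS => x <-; rewrite subrK.
by move=> s t st; rewrite (PE s t st) addrA.
Qed.

End primitives.

(** * Complex-valued integrals *)

Local Notation Re := complex.Re.
Local Notation Im := complex.Im.

Section complex_integrals.
Context {R : realType}.
Local Notation RR := (measurableTypeR R).
Local Notation leb := (@lebesgue_measure R).
Implicit Types (m : {measure set RR -> \bar R}) (f g w u v : R -> R[i])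
  (z : R[i]) (D : set R).

Lemma Re_mul z z' : Re (z * z') = Re z * Re z' - Im z * Im z'.
Proof. by case: z; case: z'. Qed.

Lemma Im_mul z z' : Im (z * z') = Re z * Im z' + Im z * Re z'.
Proof. by case: z; case: z'. Qed.

Lemma Re_add z z' : Re (z + z') = Re z + Re z'.
Proof. by case: z; case: z'. Qed.

Lemma Im_add z z' : Im (z + z') = Im z + Im z'.
Proof. by case: z; case: z'. Qed.

Lemma Re_opp z : Re (- z) = - Re z. Proof. by case: z. Qed.
Lemma Im_opp z : Im (- z) = - Im z. Proof. by case: z. Qed.
Lemma Re_conjc z : Re (conjc z) = Re z. Proof. by case: z. Qed.
Lemma Im_conjc z : Im (conjc z) = - Im z. Proof. by case: z. Qed.

Lemma complex_ext z z' : Re z = Re z' -> Im z = Im z' -> z = z'.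
Proof. by case: z => a b; case: z' => c d /= -> ->. Qed.

(** Integrability of both components. *)
Definition cintegrable m D f :=
  m.-integrable D (EFin \o re_fun f) /\ m.-integrable D (EFin \o im_fun f).

Lemma eq_cintegral m D f g : (forall x, D x -> f x = g x) ->
  cintegral m D f = cintegral m D g.
Proof.
move=> fg; apply: complex_ext; apply: eq_Rintegral => x /[!inE] Dx;
  by rewrite /re_fun /im_fun fg.
Qed.

Lemma cintegrableD m D f g : measurable (D : set RR) ->
  cintegrable m D f -> cintegrable m D g -> cintegrable m D (fun x => f x + g x).
Proof.
move=> mD [f1 f2] [g1 g2]; split.
- have := integrableD mD f1 g1; congr (m.-integrable D _).
  by apply/funext => x /=; rewrite /re_fun Re_add EFinD.
- have := integrableD mD f2 g2; congr (m.-integrable D _).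
  by apply/funext => x /=; rewrite /im_fun Im_add EFinD.
Qed.

Lemma cintegralD m D f g : measurable (D : set RR) ->
  cintegrable m D f -> cintegrable m D g ->
  cintegral m D (fun x => f x + g x) = cintegral m D f + cintegral m D g.
Proof.
move=> mD [f1 f2] [g1 g2]; apply: complex_ext; rewrite ?Re_add ?Im_add /=.
- by rewrite -RintegralD//; apply: eq_Rintegral => x _; rewrite /re_fun Re_add.
- by rewrite -RintegralD//; apply: eq_Rintegral => x _; rewrite /im_fun Im_add.
Qed.

Lemma cintegrableZ m D z f : measurable (D : set RR) ->
  cintegrable m D f -> cintegrable m D (fun x => z * f x).
Proof.
move=> mD [f1 f2]; split.
- have := integrableB mD (integrableZl mD (Re z) f1) (integrableZl mD (Im z) f2).
  congr (m.-integrable D _); apply/funext => x /=.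
  by rewrite /re_fun Re_mul EFinB !EFinM.
- have := integrableD mD (integrableZl mD (Re z) f2) (integrableZl mD (Im z) f1).
  congr (m.-integrable D _); apply/funext => x /=.
  by rewrite /im_fun Im_mul EFinD !EFinM.
Qed.

Lemma cintegralZ m D z f : measurable (D : set RR) -> cintegrable m D f ->
  cintegral m D (fun x => z * f x) = z * cintegral m D f.
Proof.
move=> mD [f1 f2]; apply: complex_ext; rewrite ?Re_mul ?Im_mul /=.
- rewrite -!RintegralZl// -RintegralB//.
  + by apply: eq_Rintegral => x _; rewrite /re_fun Re_mul.
  + exact: (integrableZl mD (Re z) f1).
  + exact: (integrableZl mD (Im z) f2).
- rewrite -!RintegralZl// -RintegralD//.
  + by apply: eq_Rintegral => x _; rewrite /im_fun Im_mul.
  + exact: (integrableZl mD (Re z) f2).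
  + exact: (integrableZl mD (Im z) f1).
Qed.

Lemma cintegrableB m D f g : measurable (D : set RR) ->
  cintegrable m D f -> cintegrable m D g -> cintegrable m D (fun x => f x - g x).
Proof.
move=> mD fi gi; have := cintegrableD mD fi (cintegrableZ (- 1) mD gi).
by congr cintegrable; apply/funext => x; rewrite mulN1r.
Qed.

Lemma cintegralB m D f g : measurable (D : set RR) ->
  cintegrable m D f -> cintegrable m D g ->
  cintegral m D (fun x => f x - g x) = cintegral m D f - cintegral m D g.
Proof.
move=> mD fi gi; rewrite -mulN1r -cintegralZ// -cintegralD//.
  by congr cintegral; apply/funext => x; rewrite mulN1r.
exact: cintegrableZ.
Qed.

(** The norm |Re z| + |Im z|: equivalent to the modulus, and it dominates both
components without square roots. *)
Definition nrm z : R := `|Re z| + `|Im z|.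

Lemma nrm_ge0 z : 0 <= nrm z. Proof. by rewrite addr_ge0. Qed.

Lemma nrm_Re z : `|Re z| <= nrm z. Proof. by rewrite lerDl. Qed.
Lemma nrm_Im z : `|Im z| <= nrm z. Proof. by rewrite lerDr. Qed.

Lemma nrmD z z' : nrm (z + z') <= nrm z + nrm z'.
Proof.
rewrite /nrm Re_add Im_add addrACA; apply: lerD; exact: ler_normD.
Qed.

Lemma nrmN z : nrm (- z) = nrm z.
Proof. by rewrite /nrm Re_opp Im_opp !normrN. Qed.

Lemma nrmB z z' : nrm (z - z') <= nrm z + nrm z'.
Proof. by apply: le_trans (nrmD _ _) _; rewrite nrmN. Qed.

Lemma nrm_conj z : nrm (conjc z) = nrm z.
Proof. by rewrite /nrm Re_conjc Im_conjc normrN. Qed.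

Lemma nrmM z z' : nrm (z * z') <= nrm z * nrm z'.
Proof.
rewrite /nrm Re_mul Im_mul.
have h1 := ler_normB (Re z * Re z') (Im z * Im z').
have h2 := ler_normD (Re z * Im z') (Im z * Re z').
rewrite !normrM in h1 h2.
by rewrite mulrDl !mulrDr; lra.
Qed.

Lemma nrm_i z : nrm ('i%C * z) = nrm z.
Proof.
by rewrite /nrm Re_mul Im_mul /= !mul0r !mul1r sub0r add0r normrN addrC.
Qed.

Lemma integrable_nrm m D f : measurable (D : set RR) -> cintegrable m D f ->
  m.-integrable D (EFin \o (fun x => nrm (f x))).
Proof.
move=> mD [f1 f2].
exact: (integrableD mD (integrable_norm f1) (integrable_norm f2)).
Qed.

Lemma cintegrable_le m D f (h : R -> R) : measurable (D : set RR) ->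
  measurable_fun D (re_fun f) -> measurable_fun D (im_fun f) ->
  m.-integrable D (EFin \o h) -> (forall x, D x -> nrm (f x) <= h x) ->
  cintegrable m D f.
Proof.
move=> mD mf1 mf2 hi fh; split; apply: (le_integrable mD _ _ hi).
- exact/measurable_EFinP.
- move=> x Dx /=; rewrite lee_fin (le_trans (nrm_Re (f x)))//.
  by rewrite (le_trans (fh _ Dx))// ler_norm.
- exact/measurable_EFinP.
- move=> x Dx /=; rewrite lee_fin (le_trans (nrm_Im (f x)))//.
  by rewrite (le_trans (fh _ Dx))// ler_norm.
Qed.

Lemma nrm_cintegral m D f : measurable (D : set RR) -> cintegrable m D f ->
  nrm (cintegral m D f) <= \int[m]_(x in D) nrm (f x).
Proof.
move=> mD [f1 f2]; rewrite /nrm/= RintegralD//; last 2 first.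
- exact: integrable_norm f1.
- exact: integrable_norm f2.
by apply: lerD; exact: le_normr_Rintegral.
Qed.

Lemma cintegrable_sub m f (a b c d : R) : a <= c -> d <= b ->
  cintegrable m `]a, b] f -> cintegrable m `]c, d] f.
Proof. by move=> ac db [f1 f2]; split; [exact: integrable_sub_itv f1|exact: integrable_sub_itv f2]. Qed.

Lemma cintegrable_continuous m f (a b : R) : ccontinuous f ->
  (m `]a, b]%classic < +oo)%E -> cintegrable m `]a, b] f.
Proof. by move=> [c1 c2] mab; split; exact: integrable_continuous. Qed.

Lemma cintegral_by_parts (m : {sigma_finite_measure set RR -> \bar R})
    f w F W (a b : R) : a <= b ->
  cintegrable m `]a, b] f -> cintegrable leb `]a, b] w ->
  (forall t, a <= t <= b -> F t = F a + cintegral m `]a, t] f) ->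
  (forall t, a <= t <= b -> W t = W a + cintegral leb `]a, t] w) ->
  [/\ cintegrable leb `]a, b] (fun t => F t * w t),
      cintegrable m `]a, b] (fun t => f t * W t) &
      cintegral leb `]a, b] (fun t => F t * w t) +
        cintegral m `]a, b] (fun t => f t * W t) = F b * W b - F a * W a].
Proof.
move=> ab [f1 f2] [w1 w2] FE WE.
have mab : measurable (`]a, b]%classic : set RR) by exact: measurable_itv.
have F1 t : a <= t <= b ->
    re_fun F t = re_fun F a + \int[m]_(x in `]a, t]) re_fun f x.
  by move=> /FE; rewrite /re_fun => ->; rewrite Re_add.
have F2 t : a <= t <= b ->
    im_fun F t = im_fun F a + \int[m]_(x in `]a, t]) im_fun f x.
  by move=> /FE; rewrite /im_fun => ->; rewrite Im_add.
have W1 t : a <= t <= b ->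
    re_fun W t = re_fun W a + \int[leb]_(x in `]a, t]) re_fun w x.
  by move=> /WE; rewrite /re_fun => ->; rewrite Re_add.
have W2 t : a <= t <= b ->
    im_fun W t = im_fun W a + \int[leb]_(x in `]a, t]) im_fun w x.
  by move=> /WE; rewrite /im_fun => ->; rewrite Im_add.
have [i11 j11 e11] := integral_by_parts ab f1 w1 F1 W1.
have [i12 j12 e12] := integral_by_parts ab f1 w2 F1 W2.
have [i21 j21 e21] := integral_by_parts ab f2 w1 F2 W1.
have [i22 j22 e22] := integral_by_parts ab f2 w2 F2 W2.
have reM u v : re_fun (fun t => u t * v t) =
    (fun t => re_fun u t * re_fun v t - im_fun u t * im_fun v t).
  by apply/funext => t; rewrite /re_fun Re_mul.
have imM u v : im_fun (fun t => u t * v t) =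
    (fun t => re_fun u t * im_fun v t + im_fun u t * re_fun v t).
  by apply/funext => t; rewrite /im_fun Im_mul.
split.
- split; rewrite ?reM ?imM; [exact: (integrableB mab i11 i22)|].
  exact: (integrableD mab i12 i21).
- split; rewrite ?reM ?imM; [exact: (integrableB mab j11 j22)|].
  exact: (integrableD mab j12 j21).
- apply: complex_ext; rewrite !(Re_add, Im_add, Re_opp, Im_opp, Re_mul, Im_mul)/=.
  + rewrite !reM !RintegralB//; move: e11 e22; rewrite /re_fun /im_fun; lra.
  + rewrite !imM !RintegralD//; move: e12 e21; rewrite /re_fun /im_fun; lra.
Qed.

(** Convergence of sequences of complex numbers, componentwise. *)
Definition ccvg (s : nat -> R[i]) (l : R[i]) :=
  (fun n => Re (s n)) @ \oo --> Re l /\ (fun n => Im (s n)) @ \oo --> Im l.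

Lemma ccvgD s t k l : ccvg s k -> ccvg t l -> ccvg (fun n => s n + t n) (k + l).
Proof.
move=> [s1 s2] [t1 t2]; split; rewrite ?Re_add ?Im_add.
- by under eq_fun do rewrite Re_add; exact: cvgD.
- by under eq_fun do rewrite Im_add; exact: cvgD.
Qed.

Lemma ccvgZ z s k : ccvg s k -> ccvg (fun n => z * s n) (z * k).
Proof.
move=> [s1 s2]; split; rewrite ?Re_mul ?Im_mul.
- by under eq_fun do rewrite Re_mul; apply: cvgB; exact: cvgMr.
- by under eq_fun do rewrite Im_mul; apply: cvgD; exact: cvgMr.
Qed.

Lemma ccvgB s t k l : ccvg s k -> ccvg t l -> ccvg (fun n => s n - t n) (k - l).
Proof.
move=> sk /(ccvgZ (-1)) tl; have := ccvgD sk tl.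
by rewrite mulN1r; under eq_fun do rewrite mulN1r.
Qed.

Lemma ccvg_unique s k l : ccvg s k -> ccvg s l -> k = l.
Proof.
move=> [s1 s2] [t1 t2]; apply: complex_ext.
- exact: (cvg_unique (@Rhausdorff R) s1 t1).
- exact: (cvg_unique (@Rhausdorff R) s2 t2).
Qed.

Lemma ccvg_nrm0 s : (fun n => nrm (s n)) @ \oo --> (0 : R) -> ccvg s 0.
Proof.
move=> s0; have s0' : (fun n => - nrm (s n)) @ \oo --> (0 : R).
  by rewrite -oppr0; exact: cvgN.
split; apply: (squeeze_cvgr _ s0' s0); apply: nearW => n; rewrite -ler_norml.
- exact: nrm_Re.
- exact: nrm_Im.
Qed.

Lemma Rintegral_itv_cvg m (h : R -> R) : m.-integrable setT (EFin \o h) ->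
  (fun n : nat => \int[m]_(x in `]- n%:R, n%:R]) h x) @ \oo --> \int[m]_x h x.
Proof.
move=> hi.
have mI (n : nat) : measurable (`]- n%:R, n%:R]%classic : set RR).
  exact: measurable_itv.
have hn n : m.-integrable `]- n%:R, n%:R] (EFin \o h).
  exact: integrableS hi.
pose I (n : nat) : set R := `]- n%:R, n%:R]%classic.
suff : (\int[m]_x ((EFin \o h) \_ (I n)) x)%E @[n --> \oo] -->
    (\int[m]_x h x)%:E.
  move=> H; apply: fine_cvg; apply: cvg_trans H; apply: near_eq_cvg.
  by apply: nearW => n; rewrite /Rintegral/= -integral_mkcond.
rewrite EFin_Rintegral//.
apply: (@dominated_cvg _ _ _ m setT measurableT _ _ (fun x => `|h x|%:E)) => //.
- move=> n; apply/(measurable_restrictT _ (mI n)).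
  exact: (measurable_int m (hn n)).
- move=> x _; apply: cvg_near_cst.
  have : [set: R] x by []; rewrite -bigcup_itvT => -[N _ /= ]; rewrite in_itv/= => /andP[Nx xN].
  near=> n; rewrite patchE mem_set// /I/= in_itv/=.
  have Nn : N%:R <= n%:R :> R by rewrite ler_nat; near: n; exact: nbhs_infty_ge.
  by rewrite (le_trans xN Nn) andbT (le_lt_trans _ Nx)// lerN2.
- exact: (integrable_abse hi).
- move=> n x _; rewrite patchE; case: ifP => _ //=.
  by rewrite normr0 lee_fin.
Unshelve. all: by end_near. Qed.

Lemma cintegral_itv_cvg m f : cintegrable m setT f ->
  ccvg (fun n => cintegral m `]- n%:R, n%:R] f) (cintegral m setT f).
Proof. by move=> [f1 f2]; split; exact: Rintegral_itv_cvg. Qed.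

End complex_integrals.

(** * Local measures *)

Section line_measures.
Context {R : realType}.
Local Notation RR := (measurableTypeR R).
Implicit Types (C : R).

(** Mass at most C on every half-open interval of length 1. *)
Definition unif_bounded C (m : set R -> \bar R) :=
  forall a : R, (m `]a, (a + 1)%R]%classic <= C%:E)%E.

Lemma unif_bounded_itvn (m : {measure set RR -> \bar R}) C (n : nat) (a : R) :
  unif_bounded C m ->
  (m `]a, (a + n%:R)%R]%classic <= (n%:R * C)%:E)%E.
Proof.
move=> mC; elim: n => [|n ih]; first by rewrite addr0 set_itvoc0 measure0 mul0r.
have U : `]a, a + n.+1%:R]%classic =
    `]a, a + n%:R]%classic `|` `]a + n%:R, a + n%:R + 1]%classic.
  rewrite -natr1 addrA; apply: itv_bndbnd_setU; rewrite bnd_simp ?lerDl//.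
rewrite U; apply: le_trans (measureU2 _ _ _) _ => //.
by rewrite -natr1 mulrDl mul1r EFinD; apply: leeD => //; exact: mC.
Qed.

Lemma unif_bounded_itv (m : {measure set RR -> \bar R}) C (a b : R) :
  unif_bounded C m -> (m `]a, b]%classic < +oo)%E.
Proof.
move=> mC; pose n := (Num.truncn (b - a)).+1.
apply: le_lt_trans (ltry (n%:R * C)); apply: le_trans (unif_bounded_itvn n a mC).
apply: le_measure; rewrite ?inE//; apply: subset_itvl; rewrite bnd_simp.
by have := ltW (truncnS_gt (b - a)); rewrite -/n; lra.
Qed.

Section line_measure.
Variables (m : {measure set R -> \bar R}) (C : R).

(** A measure on the line of bounded mass on unit intervals, transported to the
copy of the line that carries Lebesgue measure; the bound makes it
sigma-finite. *)
Definition line_measure (mC : unif_bounded C m) : set RR -> \bar R := m.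

Hypothesis mC : unif_bounded C m.

Let line_measure0 : line_measure mC set0 = 0%E.
Proof. exact: (@measure0 _ _ _ m). Qed.

Let line_measure_ge0 A : (0 <= line_measure mC A)%E.
Proof. exact: (@measure_ge0 _ _ _ m). Qed.

Let line_measure_semi_sigma_additive : semi_sigma_additive (line_measure mC).
Proof. exact: (@measure_semi_sigma_additive _ _ _ m). Qed.

HB.instance Definition _ := isMeasure.Build _ _ _ (line_measure mC)
  line_measure0 line_measure_ge0 line_measure_semi_sigma_additive.

Let line_measure_sigma_finite : sigma_finite [set: RR] (line_measure mC).
Proof.
exists (fun n : nat => `]- n%:R, n%:R]%classic : set R).
  by rewrite (@bigcup_itvT R).
by move=> n; split; [exact: measurable_itv|exact: (unif_bounded_itv (m := line_measure mC) _ _ mC)].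
Qed.

HB.instance Definition _ := Measure_isSigmaFinite.Build _ _ _ (line_measure mC)
  line_measure_sigma_finite.

Let mid : measurable_fun [set: R] (idfun : R -> RR).
Proof. by move=> _ Y mY; rewrite setTI. Qed.

(** The two copies of the line have the same measurable sets. *)
Lemma integral_line_measure (D : set R) (f : R -> \bar R) : measurable D ->
  measurable_fun D f ->
  (\int[m]_(x in D) f x = \int[line_measure mC]_(x in D) f x)%E.
Proof.
move=> mD mf.
have ge0E (g : R -> \bar R) : measurable_fun D g -> (forall x, 0 <= g x)%E ->
    (\int[m]_(x in D) g x = \int[line_measure mC]_(x in D) g x)%E.
  move=> mg g0.
  have E := @ge0_integral_pushforward _ _ R RR R idfun mid m D g mD mg (fun y _ => g0 y).
  by rewrite -[LHS]E; apply: eq_measure_integral => A mA _.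
rewrite integralE [RHS]integralE; congr (_ - _)%E; apply: ge0E => //.
- exact: measurable_funepos.
- exact: measurable_funeneg.
Qed.

Lemma cintegral_line_measure (D : set R) (f : R -> R[i]) : measurable D ->
  measurable_fun D (re_fun f) -> measurable_fun D (im_fun f) ->
  cintegral m D f = cintegral (line_measure mC) D f.
Proof.
move=> mD m1 m2; apply: complex_ext; rewrite /=; congr fine.
- by apply: integral_line_measure => //; exact/measurable_EFinP.
- by apply: integral_line_measure => //; exact/measurable_EFinP.
Qed.

End line_measure.

(** The partition of A into B and its complement in A bounds the variation
from below. *)
Lemma total_variation_ge (mu : local_measure R) (A B : set R) :
  measurable A -> measurable B -> B `<=` A ->
  ((Normc.normc (mu B))%:E <= Defs.total_variation mu A)%E.
Proof.
move=> mA mB BA; rewrite /Defs.total_variation.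
have mBA : measurable (A `\` B) by exact: measurableD.
have nn z : 0 <= Normc.normc (z : R[i]) by case: z => a b; exact: sqrtr_ge0.
apply: (@le_trans _ _ (\sum_(0 <= i <oo) (Normc.normc (mu (bigcup2 B (A `\` B) i)))%:E)%E).
  apply: le_trans (nneseries_lim_ge 1 _); first by rewrite big_nat1.
  by move=> n _ _; rewrite lee_fin.
apply: ereal_sup_ubound; exists (bigcup2 B (A `\` B)) => //; split.
- by move=> [|[|i]] /=.
- by rewrite -trivIset_bigcup2 setDIK.
- by rewrite bigcup2E setDUK.
Qed.

Lemma normc_Re (z : R[i]) : `|Re z| <= Normc.normc z.
Proof.
case: z => a b /=; rewrite -sqrtr_sqr ler_sqrt ?lerDl ?sqr_ge0//.
by rewrite addr_ge0 ?sqr_ge0.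
Qed.

Lemma normc_Im (z : R[i]) : `|Im z| <= Normc.normc z.
Proof.
case: z => a b /=; rewrite -sqrtr_sqr ler_sqrt ?lerDr ?sqr_ge0//.
by rewrite addr_ge0 ?sqr_ge0.
Qed.

Section jordan_bounds.
Variable mu : local_measure R.
Hypothesis mu_unif : (unif_norm mu < +oo)%E.

(** The uniform norm as a real number; the four Jordan parts are bounded by it
on unit intervals. *)
Definition unif_cst : R := fine (unif_norm mu).

Let variation_le a : (Defs.total_variation mu `]a, (a + 1)%R] <= unif_norm mu)%E.
Proof. by apply: ereal_sup_ubound; exists a. Qed.

Let variation_ge0 (a : R) : (0 <= Defs.total_variation mu `]a, (a + 1)%R])%E.
Proof.
have s0 : set0 `<=` `]a, a + 1]%classic by [].
apply: le_trans (@total_variation_ge mu _ _ (measurable_itv _) measurable0 s0).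
by rewrite lee_fin; case: (mu set0) => x y; exact: sqrtr_ge0.
Qed.

Let unif_cstE : unif_cst%:E = unif_norm mu.
Proof.
rewrite fineK// ge0_fin_numE//; exact: le_trans (variation_ge0 0) (variation_le 0).
Qed.

Lemma unif_cst_ge0 : 0 <= unif_cst.
Proof.
rewrite -lee_fin unif_cstE; exact: le_trans (variation_ge0 0) (variation_le 0).
Qed.

Let jordan_le (nu : set R -> R) (nuP : real_local_measure nu) :
  (forall B, nu B <= Normc.normc (mu B)) ->
  unif_bounded unif_cst (upper_variation nuP).
Proof.
move=> nule a; rewrite unif_cstE; apply: ge_ereal_sup => _ [B [mB _ BA] <-].
apply: le_trans (variation_le a).
apply: le_trans (@total_variation_ge mu _ _ (measurable_itv _) mB BA).
by rewrite lee_fin.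
Qed.

Lemma unif_re_pos : unif_bounded unif_cst (re_pos mu).
Proof.
by apply: jordan_le => B; exact: le_trans (ler_norm _) (normc_Re _).
Qed.

Lemma unif_re_neg : unif_bounded unif_cst (re_neg mu).
Proof.
apply: jordan_le => B; apply: le_trans (ler_norm _) _.
by rewrite normrN; exact: normc_Re.
Qed.

Lemma unif_im_pos : unif_bounded unif_cst (im_pos mu).
Proof.
by apply: jordan_le => B; exact: le_trans (ler_norm _) (normc_Im _).
Qed.

Lemma unif_im_neg : unif_bounded unif_cst (im_neg mu).
Proof.
apply: jordan_le => B; apply: le_trans (ler_norm _) _.
by rewrite normrN; exact: normc_Im.
Qed.

End jordan_bounds.
End line_measures.

(** * Local estimates *)

Section estimates.
Context {R : realType}.
Local Notation RR := (measurableTypeR R).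
Local Notation leb := (@lebesgue_measure R).
Implicit Types (f g u : R -> R[i]) (q r : R -> R).

Let mitv (i : interval R) : measurable ([set` i] : set RR).
Proof. exact: measurable_itv. Qed.

Lemma unif_bounded_leb : unif_bounded 1 leb.
Proof.
move=> a; rewrite lebesgue_measure_itv/= lte_fin ltrDl ltr01 -EFinB.
by rewrite addrAC subrr add0r.
Qed.

(** By Tonelli: a point s lies in the window of t only for t in [s, s + h[, a
set of mass at most 2 C.  Integrals over a sliding window of a Lebesgue
integrable function are thus integrable with respect to every measure of bounded
mass on unit intervals. *)
Lemma window_integrable (M : {sigma_finite_measure set RR -> \bar R}) (C h : R) q :
  0 < h -> h <= 1 -> unif_bounded C M -> (forall x, 0 <= q x) ->
  leb.-integrable setT (EFin \o q) ->
  M.-integrable setT (EFin \o (fun t => \int[leb]_(s in `]t - h, t]) q s)).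
Proof.
move=> h0 h1 MC q0 qi.
pose D : set (RR * RR) := [set p | (p.1 : R) - h < p.2] `&` [set p | (p.2 : R) <= p.1].
have mp1 : measurable_fun [set: RR * RR] (fun p => p.1 : R) by exact: measurable_fst.
have mp2 : measurable_fun [set: RR * RR] (fun p => p.2 : R) by exact: measurable_snd.
have mD : measurable D.
  apply: measurableI; last by rewrite -[X in measurable X]setTI; exact: measurable_fun_le.
  rewrite (_ : [set p | _] = ~` [set p : RR * RR | (p.2 : R) <= (p.1 : R) - h]).
    apply: measurableC; rewrite -[X in measurable X]setTI.
    by apply: measurable_fun_le => //; apply: measurable_funB.
  by apply/seteqP; split => p /=; rewrite ltNge => /negP.
pose k (p : RR * RR) := (q p.2 * \1_D p)%:E.
have mq : measurable_fun setT q by apply/measurable_EFinP; exact: (measurable_int leb).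
have mk : measurable_fun [set: RR * RR] k.
  apply/measurable_EFinP; apply: measurable_funM; last exact: measurable_indic.
  exact: (measurableT_comp mq).
have k0 p : (0 <= k p)%E by rewrite lee_fin mulr_ge0.
have wE t : (\int[leb]_s k (t, s))%E = (\int[leb]_(s in `]t - h, t]) q s)%:E.
  rewrite EFin_Rintegral//; last exact: integrableS qi.
  rewrite [RHS]integral_mkcond; apply: eq_integral => s _.
  rewrite /k/= patchE indicE mem_setE in_itv/=.
  have -> : ((t, s) \in D) = ((t : R) - h < s <= t)%R.
    by apply/idP/idP; rewrite inE; [case=> /= -> ->|move=> /andP[]].
  by case: ifP; rewrite ?mulr1 ?mulr0.
apply/integrableP; split.
  rewrite (_ : EFin \o _ = fubini_F leb k).
    exact: measurable_fun_fubini_tonelli_F.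
  by apply/funext => t; rewrite /= -wE.
rewrite (eq_integral (fun t => \int[leb]_s k (t, s)))%E; last first.
  move=> t _; rewrite wE/= ger0_norm// Rintegral_ge0//.
rewrite (fubini_tonelli k mk k0).
apply: (@le_lt_trans _ _ (\int[leb]_s ((q s)%:E * (2 * C)%:E))%E); last first.
  rewrite integralZr// -EFin_Rintegral// -EFinM.
  exact: ltry.
apply: ge0_le_integral => //.
- by move=> s _; exact: integral_ge0.
- exact: (measurable_fun_fubini_tonelli_G (m1 := M) k mk k0).
- by apply: emeasurable_funM => //; exact/measurable_EFinP.
- move=> s _.
  rewrite (eq_integral (fun t : RR => (q s)%:E * (\1_(`[(s : R), (s : R) + h[) (t : R))%:E))%E; last first.
    move=> t _; rewrite /k EFinM; congr (_ * _%:E)%E; rewrite !indicE; congr ((nat_of_bool _)%:R).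
    apply/idP/idP => /set_mem H; apply/mem_set; move: H; rewrite /= in_itv/=.
      by case=> /= ts ->; rewrite -ltrBlDr ts.
    by move=> /andP[st ts]; split => //=; rewrite ltrBlDr.
  rewrite ge0_integralZl_EFin//; last first.
    by apply/measurable_EFinP; exact: measurable_indic.
  rewrite integral_indic// setIT; apply: lee_wpmul2l; first by rewrite lee_fin.
  (* Half-open intervals of the form ]a, a + 1] only are controlled, and [s, s + h[
     contains its left end point: two of them are needed. *)
  have sub : `[(s : R), (s : R) + h[%classic `<=`
      `](s : R) - 1, (s : R) - 1 + 1]%classic `|` `](s : R), (s : R) + 1]%classic.
    move=> t; rewrite /= !in_itv/= => /andP[st ts].
    have [e|ne] := leP t (s : R); [left|right]; apply/andP; split => //; move: st ts; lra.
  set A := [set` _] in sub *; set B1 := [set` _] in sub; set B2 := [set` _] in sub.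
  have mB1 : measurable (B1 : set RR) by exact: mitv.
  have mB2 : measurable (B2 : set RR) by exact: mitv.
  have AB : (M A <= M (B1 `|` B2))%E.
    apply: le_measure => //; rewrite inE; first exact: mitv.
    exact: measurableU.
  apply: (le_trans AB); apply: le_trans (measureU2 _ mB1 mB2) _.
  by rewrite mulrDl mul1r EFinD; apply: leeD; exact: MC.
Qed.

(** Jensen's inequality for the square on an interval of length at most 1. *)
Lemma sqr_Rintegral_le (a b : R) r : a <= b -> b - a <= 1 ->
  leb.-integrable `]a, b] (EFin \o r) ->
  leb.-integrable `]a, b] (EFin \o (fun x => r x ^+ 2)) ->
  (\int[leb]_(x in `]a, b]) r x) ^+ 2 <= \int[leb]_(x in `]a, b]) (r x ^+ 2).
Proof.
move=> ab ba1 ri r2i; set l := \int[leb]_(x in _) r x.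
have ci (c : R) : leb.-integrable `]a, b] (EFin \o cst c).
  by apply: integrable_continuous; [exact: cst_continuous|exact: leb_itv_fin].
have : 0 <= \int[leb]_(x in `]a, b]) (r x - l) ^+ 2.
  by apply: Rintegral_ge0 => x _; exact: sqr_ge0.
have lri := integrableZl (mitv `]a, b]) (2 * l) ri.
have -> : \int[leb]_(x in `]a, b]) (r x - l) ^+ 2 =
    \int[leb]_(x in `]a, b]) (r x ^+ 2 - (2 * l * r x - cst (l ^+ 2) x)).
  by apply: eq_Rintegral => x _ /=; ring.
rewrite RintegralB//; last exact: (integrableB (mitv `]a, b]) lri (ci _)).
rewrite RintegralB// RintegralZl// -/l Rintegral_cst//= lebesgue_measure_itv/=.
have -> : fine (if (a%:E < b%:E)%E then (b%:E - a%:E)%E else 0%E) = b - a.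
  rewrite lte_fin; case: ltP => // ba; apply/esym/eqP; rewrite subr_eq0.
  by rewrite eq_le ab ba.
have := sqr_ge0 l; set S := Rintegral _ _ _; move: ba1 => ? ? ?; nra.
Qed.

Lemma leb_itvE (a b : R) : a <= b -> fine (leb `]a, b]%classic) = b - a.
Proof.
move=> ab; rewrite lebesgue_measure_itv/= lte_fin; case: ltP => // ba.
by apply/esym/eqP; rewrite subr_eq0 eq_le ab ba.
Qed.

(** If the derivative g1 of u1 deviates from c by at most w on [x, y], then c is
the difference quotient of u1 up to w. *)
Lemma mean_bound (u1 g1 : R -> R) (x y c w : R) : x <= y ->
  leb.-integrable `]x, y] (EFin \o g1) ->
  u1 y = u1 x + \int[leb]_(s in `]x, y]) g1 s ->
  (forall s, x <= s <= y -> `|c - g1 s| <= w) ->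
  `|c| * (y - x) <= `|u1 x| + `|u1 y| + w * (y - x).
Proof.
move=> xy gi uE cw.
have ci (z : R) : leb.-integrable `]x, y] (EFin \o cst z).
  by apply: integrable_continuous; [exact: cst_continuous|exact: leb_itv_fin].
have cE (z : R) : \int[leb]_(s in `]x, y]) cst z s = z * (y - x).
  by rewrite Rintegral_cst// leb_itvE.
have lo : (c - w) * (y - x) <= \int[leb]_(s in `]x, y]) g1 s.
  rewrite -cE; apply: le_Rintegral => // s; rewrite /= in_itv/= => /andP[xs sy].
  move: (s : R) xs sy => {}s xs sy.
  by have := cw s; rewrite (ltW xs) sy => /(_ isT); rewrite ler_norml => /andP[]; lra.
have hi : \int[leb]_(s in `]x, y]) g1 s <= (c + w) * (y - x).
  clear lo; rewrite -cE; apply: le_Rintegral => // s; rewrite /= in_itv/= => /andP[xs sy].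
  move: (s : R) xs sy => {}s xs sy.
  by have := cw s; rewrite (ltW xs) sy => /(_ isT); rewrite ler_norml => /andP[]; lra.
move: (Rintegral _ _ _) uE lo hi => I uE lo hi.
have : `|c * (y - x)| <= `|u1 x| + `|u1 y| + w * (y - x).
  have := ler_norm (u1 x); have := ler_norm (u1 y).
  have := ler_norm (- u1 x); have := ler_norm (- u1 y); rewrite !normrN.
  by rewrite ler_norml => *; apply/andP; split; nra.
by rewrite normrM (ger0_norm (_ : 0 <= y - x))// subr_ge0.
Qed.

Lemma Rintegral_le_sub r (a b c d : R) : a <= c -> d <= b -> (forall x, 0 <= r x) ->
  leb.-integrable `]a, b] (EFin \o r) ->
  \int[leb]_(x in `]c, d]) r x <= \int[leb]_(x in `]a, b]) r x.
Proof.
move=> ac db r0 ri.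
have ri' := integrable_sub_itv ac db ri.
rewrite -lee_fin !EFin_Rintegral//.
apply: ge0_subset_integral => //.
- exact: (measurable_int leb ri).
- by move=> x _; rewrite /= lee_fin.
- by move=> x; rewrite /= !in_itv/= => /andP[cx xd];
    rewrite (le_lt_trans ac cx) (le_trans xd db).
Qed.

Lemma continuous_nrm u : ccontinuous u -> continuous (fun x => nrm (u x)).
Proof.
move=> [c1 c2] x; apply: cvgD.
- by apply: continuous_comp; [exact: c1|exact: norm_continuous].
- by apply: continuous_comp; [exact: c2|exact: norm_continuous].
Qed.

(** A continuous function takes a value not larger than its mean. *)
Lemma continuous_min r (a b : R) : a <= b -> continuous r ->
  leb.-integrable `]a, b] (EFin \o r) ->
  exists2 x, a <= x <= b & r x * (b - a) <= \int[leb]_(x in `]a, b]) r x.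
Proof.
move=> ab cr ri; have cr' : {within `[a, b], continuous r}.
  exact: continuous_subspaceT.
have [x xab rx] := EVT_min ab cr'; exists x.
  by move: xab; rewrite in_itv.
rewrite -leb_itvE// -Rintegral_cst//; apply: le_Rintegral => //.
  by apply: integrable_continuous; [exact: cst_continuous|exact: leb_itv_fin].
move=> y; rewrite /= in_itv/= => /andP[ay yb]; apply: rx.
by rewrite in_itv/= (ltW ay).
Qed.

Lemma integral_nrm_le g (a b c d G : R) : a <= c -> c <= d -> d <= b ->
  cintegrable leb `]a, b] g ->
  (forall s, a <= s <= b -> nrm (g s) <= G) ->
  nrm (cintegral leb `]c, d] g) <= G * (d - c).
Proof.
move=> ac cd db gi gG; have gi' := cintegrable_sub ac db gi.
apply: le_trans (nrm_cintegral (mitv _) gi') _.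
rewrite -leb_itvE// -Rintegral_cst//; apply: le_Rintegral => //.
- exact: integrable_nrm.
- by apply: integrable_continuous; [exact: cst_continuous|exact: leb_itv_fin].
- move=> s; rewrite /= in_itv/= => /andP[cs sd]; apply: gG.
  by rewrite (le_trans ac (ltW cs)) (le_trans sd db).
Qed.

(** Pointwise control of u by the local L1 norms of u and of its derivative. *)
Lemma primitive_bound u g :
  ccontinuous u -> (forall a b : R, cintegrable leb `]a, b] g) ->
  (forall s t : R, s <= t -> u t = u s + cintegral leb `]s, t] g) ->
  forall t, nrm (u t) <= \int[leb]_(s in `]t - 1, t]) nrm (u s) +
    \int[leb]_(s in `]t - 1, t]) nrm (g s).
Proof.
move=> cu gi uE t; set phi := \int[leb]_(s in _) nrm (g s).
have t1 : t - 1 <= t by rewrite gerBl.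
have nui : leb.-integrable `]t - 1, t] (EFin \o (fun s => nrm (u s))).
  by apply: integrable_nrm => //; apply: cintegrable_continuous => //; exact: leb_itv_fin.
have ngi : leb.-integrable `]t - 1, t] (EFin \o (fun s => nrm (g s))).
  exact: integrable_nrm.
have [x /andP[tx xt] ] := continuous_min t1 (continuous_nrm cu) nui.
rewrite opprB addrCA subrr addr0 mulr1 => ux.
rewrite (uE x t xt); apply: le_trans (nrmD _ _) _; apply: lerD => //.
apply: le_trans (nrm_cintegral _ _) _ => //.
by apply: Rintegral_le_sub => // s; exact: nrm_ge0.
Qed.

Let derivative_bound_aux (C H nu phi U : R) : 0 <= C -> 0 <= H -> 0 <= nu ->
  0 <= phi -> U <= 42 * nu * H + 4 * phi ->
  18 * nu * H ^+ 2 + 2 * (C * U + phi) <=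
  (18 * H ^+ 2 + 84 * C * H + 8 * C + 2) * (nu + phi).
Proof.
move=> C0 H0 nu0 phi0 Ub.
have CU : C * U <= 42 * C * nu * H + 4 * C * phi.
  by have := ler_wpM2l C0 Ub; rewrite mulrDr; lra.
have p1 : 0 <= C * nu by rewrite mulr_ge0.
have p2 : 0 <= C * H * phi by rewrite !mulr_ge0.
have p3 : 0 <= H ^+ 2 * phi by rewrite mulr_ge0 ?exprn_ge0.
by rewrite mulrDr !mulrDl; lra.
Qed.

(** If g is a derivative of u whose oscillation on short intervals is controlled
by the supremum of u and by the integral of f, then g is controlled pointwise by
the local L1 norms of u and f: on an interval of length h with 4 h C <= 1 the
supremum of u is absorbed. *)
Lemma derivative_bound u f g (C h : R) :
  0 <= C -> 0 < h -> h <= 1 -> 4 * h * C <= 1 ->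
  ccontinuous u -> (forall a b : R, cintegrable leb `]a, b] g) ->
  (forall a b : R, cintegrable leb `]a, b] f) ->
  (forall s t : R, s <= t -> u t = u s + cintegral leb `]s, t] g) ->
  (forall s t U, s <= t -> t - s <= 1 ->
    (forall x, s <= x <= t -> nrm (u x) <= U) ->
    nrm (g t - g s) <= C * U + \int[leb]_(x in `]s, t]) nrm (f x)) ->
  forall t, nrm (g t) <= (18 * h^-1 ^+ 2 + 84 * C * h^-1 + 8 * C + 2) *
    (\int[leb]_(s in `]t - h, t]) nrm (u s) +
     \int[leb]_(s in `]t - h, t]) nrm (f s)).
Proof.
move=> C0 h0 h1 hC cu gi fi uE gosc t.
pose a := t - h; rewrite -/a.
have at_ : a <= t by rewrite /a; lra.
have nui c d : leb.-integrable `]c, d] (EFin \o (fun s => nrm (u s))).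
  by apply: integrable_nrm => //; apply: cintegrable_continuous => //; exact: leb_itv_fin.
have nfi c d : leb.-integrable `]c, d] (EFin \o (fun s => nrm (f s))).
  exact: integrable_nrm.
set nu := \int[leb]_(s in _) nrm (u s); set phi := \int[leb]_(s in _) nrm (f s).
have nu0 : 0 <= nu by apply: Rintegral_ge0 => s _; exact: nrm_ge0.
have phi0 : 0 <= phi by apply: Rintegral_ge0 => s _; exact: nrm_ge0.
have cn := continuous_nrm cu.
have [t0 t0I Umax] : exists2 t0, t0 \in `[a, t] &
    forall s, s \in `[a, t] -> nrm (u s) <= nrm (u t0).
  by apply: EVT_max => //; exact: continuous_subspaceT.
set U := nrm (u t0) in Umax.
have U0 : 0 <= U by exact: nrm_ge0.
(* In the first and in the last third of [t - h, t] there are points where nrm u is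
   at most its mean there; they are at distance at least h / 3. *)
have [x /andP[ax xa] nux] : exists2 x, a <= x <= a + h / 3 & nrm (u x) * (h / 3) <= nu.
  have ah3 : a <= a + h / 3 by lra.
  have [x xI xm] := continuous_min ah3 cn (nui _ _).
  exists x => //; have := @Rintegral_le_sub (fun s => nrm (u s)) a t a (a + h / 3)
    (lexx _) _ (fun s => nrm_ge0 _) (nui _ _).
  rewrite -/nu => /(_ _); rewrite /a in xm *; move: xm.
  rewrite (_ : t - h + h / 3 - (t - h) = h / 3); last by ring.
  move=> xm /(_ _)/(le_trans xm); apply; lra.
have [y /andP[ay yt] nuy] : exists2 y, t - h / 3 <= y <= t & nrm (u y) * (h / 3) <= nu.
  have ah3 : t - h / 3 <= t by lra.
  have [y yI ym] := continuous_min ah3 cn (nui _ _).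
  exists y => //; have := @Rintegral_le_sub (fun s => nrm (u s)) a t (t - h / 3) t
    _ (lexx _) (fun s => nrm_ge0 _) (nui _ _).
  rewrite -/nu => /(_ _); move: ym.
  rewrite (_ : t - (t - h / 3) = h / 3); last by ring.
  move=> ym /(_ _)/(le_trans ym); apply; rewrite /a; lra.
have hx : a + h / 3 < t - h / 3 by rewrite /a; lra.
have yx : h / 3 <= y - x by move: xa ay; rewrite /a; lra.
have xy : x <= y by lra.
pose w := C * U + phi.
have w0 : 0 <= w by rewrite addr_ge0// mulr_ge0.
have osc s s' : a <= s -> s <= s' -> s' <= t -> nrm (g s' - g s) <= w.
  move=> as_ ss' s't; apply: le_trans (gosc s s' U ss' _ _) _.
  - by move: as_ s't; rewrite /a; lra.
  - move=> z /andP[sz zs']; apply: Umax; rewrite in_itv/=.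
    by rewrite (le_trans as_ sz) (le_trans zs' s't).
  - rewrite lerD2l; apply: Rintegral_le_sub => // z; exact: nrm_ge0.
have osc' s s' : a <= s <= t -> a <= s' <= t -> nrm (g s' - g s) <= w.
  move=> /andP[as_ st] /andP[as' s't]; have [ss'|s's] := leP s s'; first exact: osc.
  by rewrite -opprB nrmN; apply: osc => //; exact: ltW.
have hi : 0 < h^-1 by rewrite invr_gt0.
have hi0 := ltW hi.
have hhi : h * h^-1 = 1 by rewrite mulfV ?gt_eqF.
(* The bound on g given by the difference quotient of u between x and y and by
   the oscillation w of each component of g. *)
pose G := 18 * nu * h^-1 ^+ 2 + 2 * w.
have gG s : a <= s <= t -> nrm (g s) <= G.
  move=> sI; have [g1 g2] := gi x y.
  have xyI z : x <= z <= y -> a <= z <= t.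
    by move=> /andP[xz zy]; rewrite (le_trans ax xz) (le_trans zy yt).
  have o1 z : x <= z <= y -> `|re_fun g s - re_fun g z| <= w.
    move=> /xyI zI; have := osc' _ _ zI sI; apply: le_trans.
    by apply: le_trans (nrm_Re _); rewrite Re_add Re_opp.
  have o2 z : x <= z <= y -> `|im_fun g s - im_fun g z| <= w.
    move=> /xyI zI; have := osc' _ _ zI sI; apply: le_trans.
    by apply: le_trans (nrm_Im _); rewrite Im_add Im_opp.
  have e1 : re_fun u y = re_fun u x + \int[leb]_(s in `]x, y]) re_fun g s.
    by rewrite /re_fun (uE x y xy) Re_add.
  have e2 : im_fun u y = im_fun u x + \int[leb]_(s in `]x, y]) im_fun g s.
    by rewrite /im_fun (uE x y xy) Im_add.
  have b1 := mean_bound xy g1 e1 o1; have b2 := mean_bound xy g2 e2 o2.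
  have b : nrm (g s) * (y - x) <= nrm (u x) + nrm (u y) + 2 * w * (y - x).
    by move: b1 b2; rewrite /nrm /re_fun /im_fun; lra.
  have nx : nrm (u x) <= 3 * nu * h^-1.
    rewrite -(ler_pM2r (_ : 0 < h / 3)); last by lra.
    by apply: le_trans nux _; rewrite le_eqVlt; apply/orP; left; apply/eqP; nra.
  have ny : nrm (u y) <= 3 * nu * h^-1.
    rewrite -(ler_pM2r (_ : 0 < h / 3)); last by lra.
    by apply: le_trans nuy _; rewrite le_eqVlt; apply/orP; left; apply/eqP; nra.
  have b' : (nrm (g s) - 2 * w) * (y - x) <= 6 * nu * h^-1 by lra.
  suff : nrm (g s) - 2 * w <= 18 * nu * h^-1 ^+ 2 by rewrite /G; lra.
  have [le0|gt0] := leP (nrm (g s) - 2 * w) 0.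
    by apply: le_trans le0 _; rewrite !mulr_ge0 ?exprn_ge0.
  have b3 : (nrm (g s) - 2 * w) * (h / 3) <= 6 * nu * h^-1.
    by apply: le_trans b'; rewrite ler_pM2l.
  rewrite -(ler_pM2r (_ : 0 < h / 3)); last by lra.
  apply: le_trans b3 _; rewrite le_eqVlt; apply/orP; left; apply/eqP.
  by rewrite expr2; transitivity (6 * nu * h^-1 * (h * h^-1)); [rewrite hhi mulr1|field; rewrite gt_eqF].
have gI : cintegrable leb `]a, t] g by exact: gi.
(* Conversely, U is at most the value at x plus the variation of u, and G * h
   contains U only with the factor 2 * C * h <= 1 / 2. *)
have Ub : U <= 3 * nu * h^-1 + G * h.
  have nx : nrm (u x) <= 3 * nu * h^-1.
    rewrite -(ler_pM2r (_ : 0 < h / 3)); last by lra.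
    by apply: le_trans nux _; rewrite le_eqVlt; apply/orP; left; apply/eqP; nra.
  have G0 : 0 <= G.
    by rewrite /G addr_ge0 ?mulr_ge0 ?exprn_ge0.
  move: t0I; rewrite in_itv/= => /andP[at0 t0t].
  have xt : x <= t by lra.
  have [xt0|t0x] := leP x t0.
    rewrite /U (uE x t0 xt0); apply: le_trans (nrmD _ _) _; apply: lerD => //.
    apply: le_trans (integral_nrm_le ax xt0 t0t gI gG) _.
    by rewrite ler_wpM2l//; move: t0t ax; rewrite /a; lra.
  have ut0 : u t0 = u x - cintegral leb `]t0, x] g by rewrite (uE t0 x (ltW t0x)) addrK.
  rewrite /U ut0; apply: le_trans (nrmB _ _) _; apply: lerD => //.
  apply: le_trans (integral_nrm_le at0 (ltW t0x) xt gI gG) _.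
  by rewrite ler_wpM2l//; move: xt at0; rewrite /a; lra.
have Ub2 : U <= 42 * nu * h^-1 + 4 * phi.
  have e : G * h = 18 * nu * h^-1 + 2 * w * h.
    rewrite /G mulrDl; congr (_ + _); rewrite expr2.
    by transitivity (18 * nu * h^-1 * (h * h^-1)); [ring|rewrite hhi mulr1].
  have e2 : 2 * w * h <= U / 2 + 2 * phi.
    rewrite /w; have : 4 * h * C * U <= U by rewrite -[leRHS]mul1r ler_wpM2r.
    have : phi * h <= phi by rewrite -[leRHS]mulr1 ler_wpM2l.
    by nra.
  by move: Ub; rewrite e; lra.
have tI : a <= t <= t by rewrite at_ lexx.
apply: le_trans (gG t tI) _.
exact: derivative_bound_aux Ub2.
Qed.

End estimates.

(** * The integrated equation *)

Section four_measures.
Context {R : realType}.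
Local Notation RR := (measurableTypeR R).
Local Notation leb := (@lebesgue_measure R).
Implicit Types (f g u v w : R -> R[i]).

Variables (M1 M2 M3 M4 : {sigma_finite_measure set RR -> \bar R}) (C : R).
Hypotheses (M1C : unif_bounded C M1) (M2C : unif_bounded C M2).
Hypotheses (M3C : unif_bounded C M3) (M4C : unif_bounded C M4).

Let mitv (i : interval R) : measurable ([set` i] : set RR).
Proof. exact: measurable_itv. Qed.

(** Integration against M1 - M2 + i (M3 - M4). *)
Definition four_integral (D : set R) f : R[i] :=
  (cintegral M1 D f - cintegral M2 D f) +
  'i%C * (cintegral M3 D f - cintegral M4 D f).

(** Integrability with respect to each of the four measures. *)
Definition four_integrable (D : set R) f :=
  [/\ cintegrable M1 D f, cintegrable M2 D f, cintegrable M3 D f &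
      cintegrable M4 D f].

Lemma four_integrable_continuous u (a b : R) : ccontinuous u ->
  four_integrable `]a, b] u.
Proof.
move=> cu; split; apply: cintegrable_continuous => //.
- exact: unif_bounded_itv M1C.
- exact: unif_bounded_itv M2C.
- exact: unif_bounded_itv M3C.
- exact: unif_bounded_itv M4C.
Qed.

Lemma cintegral_split (m : {measure set RR -> \bar R}) f (a b c : R) :
  a <= b -> b <= c -> cintegrable m `]a, c] f ->
  cintegral m `]a, c] f = cintegral m `]a, b] f + cintegral m `]b, c] f.
Proof.
move=> ab bc [f1 f2]; apply: complex_ext; rewrite ?Re_add ?Im_add /=;
  exact: Rintegral_split.
Qed.

Lemma cintegral_set0 (m : {measure set RR -> \bar R}) f : cintegral m set0 f = 0.
Proof. by apply: complex_ext; rewrite /= Rintegral_set0. Qed.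

Lemma four_integral_split f (a b c : R) : a <= b -> b <= c ->
  four_integrable `]a, c] f ->
  four_integral `]a, c] f = four_integral `]a, b] f + four_integral `]b, c] f.
Proof.
move=> ab bc [i1 i2 i3 i4]; rewrite /four_integral.
rewrite (cintegral_split ab bc i1) (cintegral_split ab bc i2).
by rewrite (cintegral_split ab bc i3) (cintegral_split ab bc i4); ring.
Qed.

Lemma four_integral_cvg f : four_integrable setT f ->
  ccvg (fun n => four_integral `]- n%:R, n%:R] f) (four_integral setT f).
Proof.
move=> [i1 i2 i3 i4]; apply: ccvgD; first by apply: ccvgB; exact: cintegral_itv_cvg.
by apply: ccvgZ; apply: ccvgB; exact: cintegral_itv_cvg.
Qed.

Lemma cintegral_bounded (M : {sigma_finite_measure set RR -> \bar R}) u (s t U : R) :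
  unif_bounded C M -> ccontinuous u -> s <= t -> t - s <= 1 -> 0 <= U ->
  (forall x, s <= x <= t -> nrm (u x) <= U) ->
  nrm (cintegral M `]s, t] u) <= C * U.
Proof.
move=> MC cu st ts U0 uU.
have Mfin := unif_bounded_itv s t MC.
have ui : cintegrable M `]s, t] u by exact: cintegrable_continuous.
apply: (le_trans (nrm_cintegral (mitv _) ui)).
apply: (@le_trans _ _ (\int[M]_(x in `]s, t]) cst U x)).
  apply: le_Rintegral => //.
  - exact: integrable_nrm.
  - by apply: integrable_continuous => //; exact: cst_continuous.
  - by move=> x; rewrite /= in_itv/= => /andP[sx xt]; apply: uU; rewrite (ltW sx).
rewrite Rintegral_cst// mulrC ler_wpM2r//.
rewrite -lee_fin fineK ?ge0_fin_numE//; apply: le_trans (MC s).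
apply: le_measure; rewrite ?inE; [exact: mitv|exact: mitv|].
by apply: subset_itvl; rewrite bnd_simp; lra.
Qed.

Lemma four_integral_bounded u (s t U : R) :
  ccontinuous u -> s <= t -> t - s <= 1 -> 0 <= U ->
  (forall x, s <= x <= t -> nrm (u x) <= U) ->
  nrm (four_integral `]s, t] u) <= 4 * C * U.
Proof.
move=> cu st ts U0 uU; rewrite /four_integral.
have b1 := cintegral_bounded M1C cu st ts U0 uU.
have b2 := cintegral_bounded M2C cu st ts U0 uU.
have b3 := cintegral_bounded M3C cu st ts U0 uU.
have b4 := cintegral_bounded M4C cu st ts U0 uU.
apply: le_trans (nrmD _ _) _; rewrite nrm_i.
have h1 := nrmB (cintegral M1 `]s, t] u) (cintegral M2 `]s, t] u).
have h2 := nrmB (cintegral M3 `]s, t] u) (cintegral M4 `]s, t] u).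
move: b1 b2 b3 b4 h1 h2; do 6! move: (nrm _) => ?.
by clear; move=> *; lra.
Qed.

(** The equation, integrated over ]s, t]: - g' + u mu = f, where g stands
for the derivative of u. *)
Definition driven u f g := forall s t : R, s <= t ->
  g t = g s + (four_integral `]s, t] u - cintegral leb `]s, t] f).

Let by_parts_aux (A1 A2 A3 A4 A5 B1 B2 B3 B4 B5 c1 c2 c3 c4 c5 p x y z : R[i]) :
  A1 + B1 = c1 * x -> A2 + B2 = c2 * x -> A3 + B3 = c3 * x ->
  A4 + B4 = c4 * x -> A5 + B5 = c5 * x ->
  p * (x - y) + ((A1 - A2 + z * (A3 - A4)) - A5) + (B1 - B2 + z * (B3 - B4)) - B5
  = (p + ((c1 - c2 + z * (c3 - c4)) - c5)) * x - p * y.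
Proof.
move=> e1 e2 e3 e4 e5.
have -> : A1 = c1 * x - B1 by rewrite -e1 addrK.
have -> : A2 = c2 * x - B2 by rewrite -e2 addrK.
have -> : A3 = c3 * x - B3 by rewrite -e3 addrK.
have -> : A4 = c4 * x - B4 by rewrite -e4 addrK.
have -> : A5 = c5 * x - B5 by rewrite -e5 addrK.
by ring.
Qed.

(** Integration by parts for each of the five measures that drive g. *)
Lemma driven_by_parts u f g w W (a b : R) : ccontinuous u ->
  cintegrable leb `]a, b] f -> cintegrable leb `]a, b] w ->
  driven u f g ->
  (forall t : R, a <= t <= b -> W t = W a + cintegral leb `]a, t] w) ->
  a <= b ->
  [/\ cintegrable leb `]a, b] (fun t => g t * w t),
      cintegrable leb `]a, b] (fun t => f t * W t),
      four_integrable `]a, b] (fun t => u t * W t) &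
      cintegral leb `]a, b] (fun t => g t * w t) +
        four_integral `]a, b] (fun t => u t * W t) -
        cintegral leb `]a, b] (fun t => f t * W t) = g b * W b - g a * W a].
Proof.
move=> cu fi wi gE WE ab.
have [i1 i2 i3 i4] := four_integrable_continuous a b cu.
have z (m : {measure set RR -> \bar R}) h : forall t, a <= t <= b ->
    cintegral m `]a, t] h = cintegral m `]a, a] h + cintegral m `]a, t] h.
  by move=> t _; rewrite set_itvoc0 cintegral_set0 add0r.
have mI := mitv `]a, b].
have [p1 q1 e1] := cintegral_by_parts ab i1 wi (z M1 u) WE.
have [p2 q2 e2] := cintegral_by_parts ab i2 wi (z M2 u) WE.
have [p3 q3 e3] := cintegral_by_parts ab i3 wi (z M3 u) WE.
have [p4 q4 e4] := cintegral_by_parts ab i4 wi (z M4 u) WE.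
have [p5 q5 e5] := cintegral_by_parts ab fi wi (z leb f) WE.
have gwE t : `]a, b]%classic t -> g a * w t +
    (((cintegral M1 `]a, t] u * w t - cintegral M2 `]a, t] u * w t) +
      'i%C * (cintegral M3 `]a, t] u * w t - cintegral M4 `]a, t] u * w t)) -
      cintegral leb `]a, t] f * w t) = g t * w t.
  rewrite /= in_itv/= => /andP[at_ _]; rewrite (gE a t (ltW at_)) /four_integral.
  by ring.
have k0 := cintegrableZ (g a) mI wi.
have k1 := cintegrableB mI p1 p2.
have k2 := cintegrableB mI p3 p4.
have k2' := cintegrableZ 'i%C mI k2.
have k3 := cintegrableD mI k1 k2'.
have k4 := cintegrableB mI k3 p5.
have k5 := cintegrableD mI k0 k4.
have gwi : cintegrable leb `]a, b] (fun t => g t * w t).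
  have [k51 k52] := k5; split; [move: k51|move: k52]; apply: eq_integrable => //;
    by move=> t /[!inE] tI /=; congr EFin; rewrite /re_fun /im_fun gwE.
split => //.
rewrite -(eq_cintegral _ gwE).
rewrite (cintegralD mI k0 k4) (cintegralB mI k3 p5) (cintegralD mI k1 k2').
rewrite (cintegralZ _ mI k2) (cintegralB mI p1 p2) (cintegralB mI p3 p4).
rewrite (cintegralZ _ mI wi).
have ew : cintegral leb `]a, b] w = W b - W a.
  by rewrite (WE b) ?ab ?lexx// addrC addKr.
rewrite ew /four_integral (gE a b ab) /four_integral.
move: e1 e2 e3 e4 e5.
rewrite !set_itvoc0 !cintegral_set0 !mul0r !subr0.
exact: by_parts_aux.
Qed.

(** Integration by parts against W t = t, whose derivative is 1. *)
Lemma driven_integrable u f g : ccontinuous u ->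
  (forall a b : R, cintegrable leb `]a, b] f) -> driven u f g ->
  forall a b : R, cintegrable leb `]a, b] g.
Proof.
move=> cu fi gE a b; have [ba|ab] := ltP b a.
  by rewrite set_itv_ge ?bnd_simp -?leNgt ?ltW//; split; exact: integrable_set0.
have ci (c : R[i]) : cintegrable leb `]a, b] (cst c).
  by split; apply: integrable_continuous; try exact: leb_itv_fin; exact: cst_continuous.
have WE (t : R) : a <= t <= b ->
    (t%:C)%C = (a%:C)%C + cintegral leb `]a, t] (cst 1 : R -> R[i]).
  move=> /andP[at_ _]; apply: complex_ext; rewrite ?Re_add ?Im_add /=.
    by rewrite Rintegral_cst// leb_itvE//; ring.
  by rewrite Rintegral_cst// mul0r addr0.
have [gi _ _ _] := driven_by_parts cu (fi a b) (ci 1) gE WE ab.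
by move: gi; congr cintegrable; apply/funext => t; rewrite mulr1.
Qed.

(** The primitive that vanishes at 0, with the orientation convention for
negative upper bounds. *)
Definition four_primitive f (t : R) : R[i] :=
  if 0 <= t then four_integral `]0, t] f else - four_integral `]t, 0] f.

Lemma four_primitive_driven u : ccontinuous u ->
  driven u (cst 0) (four_primitive u).
Proof.
move=> cu s t st; have i a b := four_integrable_continuous a b cu.
have -> : cintegral leb `]s, t] (cst 0 : R -> R[i]) = 0.
  by apply: complex_ext; rewrite /= Rintegral_cst// mul0r.
rewrite subr0 /four_primitive; have [t0|t0] := leP 0 t; have [s0|s0] := leP 0 s.
- exact: four_integral_split.
- by rewrite (four_integral_split (ltW s0) t0 (i s t)); ring.
- by have := lt_le_trans t0 s0; rewrite ltNge st.
- by rewrite (four_integral_split st (ltW t0) (i s 0)); ring.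
Qed.

(** The oscillation estimate that is the hypothesis of [derivative_bound]. *)
Lemma driven_osc u f g : ccontinuous u ->
  (forall a b : R, cintegrable leb `]a, b] f) -> driven u f g ->
  forall s t U : R, s <= t -> t - s <= 1 ->
  (forall x, s <= x <= t -> nrm (u x) <= U) ->
  nrm (g t - g s) <= 4 * C * U + \int[leb]_(x in `]s, t]) nrm (f x).
Proof.
move=> cu fi gE s t U st ts uU.
have U0 : 0 <= U by apply: le_trans (uU s _); rewrite ?nrm_ge0// lexx.
rewrite (gE s t st) addrAC subrr add0r.
apply: le_trans (nrmB _ _) _; apply: lerD.
  exact: four_integral_bounded.
by apply: nrm_cintegral.
Qed.

End four_measures.

(** * Square integrability *)

Section square_integrable.
Context {R : realType}.
Local Notation RR := (measurableTypeR R).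
Local Notation leb := (@lebesgue_measure R).
Implicit Types (f g u v w : R -> R[i]) (q r : R -> R).

Let mitv (i : interval R) : measurable ([set` i] : set RR).
Proof. exact: measurable_itv. Qed.

Lemma Lfun2P r : r \in Lfun leb 2%:E <->
  measurable_fun setT r /\ leb.-integrable setT (EFin \o (fun x => r x ^+ 2)).
Proof.
split=> [r2|[mr r2]].
  split; last exact: Lfun2_integrable_sqr.
  by move: r2; rewrite inE => /andP[]; rewrite inE.
rewrite inE; apply/andP; split; rewrite inE//=.
rewrite /finite_norm unlock; apply: poweR_lty.
have /integrableP[_] := r2; apply: le_lt_trans.
rewrite le_eqVlt; apply/orP; left; apply/eqP; apply: eq_integral => x _.
by rewrite /comp !abse_EFin poweR_EFin powR_mulrn// normrX.
Qed.

(** Membership in L2, stated with [nrm] instead of the two components. *)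
Definition sqr_integrable f :=
  [/\ measurable_fun setT (re_fun f), measurable_fun setT (im_fun f) &
    leb.-integrable setT (EFin \o (fun x => nrm (f x) ^+ 2))].

Lemma sqr_integrableP f : L2 f <-> sqr_integrable f.
Proof.
split.
  move=> [/Lfun2P[m1 i1] /Lfun2P[m2 i2]]; split => //.
  have mn : measurable_fun setT (fun x => nrm (f x)).
    by apply: measurable_funD; exact: measurableT_comp.
  have i12 := integrableD (measurableT : measurable (setT : set RR)) i1 i2.
  apply: (le_integrable _ _ _ (integrableZl _ 2 i12)) => //.
    by apply/measurable_EFinP; exact: measurable_funX.
  move=> x _ /=; rewrite lee_fin ger0_norm ?sqr_ge0// ger0_norm; last first.
    by rewrite mulr_ge0// addr_ge0 ?sqr_ge0.
  rewrite /nrm /re_fun /im_fun -[Re (f x) ^+ 2]real_normK ?num_real//.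
  rewrite -[Im (f x) ^+ 2]real_normK ?num_real//.
  by have := sqr_ge0 (`|Re (f x)| - `|Im (f x)|); nra.
move=> [m1 m2 i]; split; apply/Lfun2P; split => //.
- apply: (le_integrable _ _ _ i) => //.
    by apply/measurable_EFinP; exact: measurable_funX.
  move=> x _ /=; rewrite lee_fin ger0_norm ?sqr_ge0// ger0_norm ?sqr_ge0//.
  by rewrite -[leLHS]real_normK ?num_real// lerXn2r ?nnegrE ?nrm_ge0// nrm_Re.
- apply: (le_integrable _ _ _ i) => //.
    by apply/measurable_EFinP; exact: measurable_funX.
  move=> x _ /=; rewrite lee_fin ger0_norm ?sqr_ge0// ger0_norm ?sqr_ge0//.
  by rewrite -[leLHS]real_normK ?num_real// lerXn2r ?nnegrE ?nrm_ge0// nrm_Im.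
Qed.

Lemma measurable_nrm f : measurable_fun setT (re_fun f) ->
  measurable_fun setT (im_fun f) -> measurable_fun setT (fun x => nrm (f x)).
Proof. by move=> m1 m2; apply: measurable_funD; exact: measurableT_comp. Qed.

Lemma measurable_cmul f g : measurable_fun setT (re_fun f) ->
  measurable_fun setT (im_fun f) -> measurable_fun setT (re_fun g) ->
  measurable_fun setT (im_fun g) ->
  measurable_fun setT (re_fun (fun x => f x * g x)) /\
  measurable_fun setT (im_fun (fun x => f x * g x)).
Proof.
move=> f1 f2 g1 g2; split.
- rewrite (_ : re_fun _ = (fun x => re_fun f x * re_fun g x - im_fun f x * im_fun g x)).
    by apply: measurable_funB; exact: measurable_funM.
  by apply/funext => x; exact: Re_mul.
- rewrite (_ : im_fun _ = (fun x => re_fun f x * im_fun g x + im_fun f x * re_fun g x)).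
    by apply: measurable_funD; exact: measurable_funM.
  by apply/funext => x; exact: Im_mul.
Qed.

Lemma cintegrable_mul (M : {measure set RR -> \bar R}) f g :
  measurable_fun setT (re_fun f) -> measurable_fun setT (im_fun f) ->
  measurable_fun setT (re_fun g) -> measurable_fun setT (im_fun g) ->
  M.-integrable setT (EFin \o (fun x => nrm (f x) ^+ 2)) ->
  M.-integrable setT (EFin \o (fun x => nrm (g x) ^+ 2)) ->
  cintegrable M setT (fun x => f x * g x).
Proof.
move=> f1 f2 g1 g2 fi gi; have [m1 m2] := measurable_cmul f1 f2 g1 g2.
apply: (@cintegrable_le _ _ _ _ (fun x => nrm (f x) ^+ 2 + nrm (g x) ^+ 2)) => //.
  exact: (integrableD _ fi gi).
move=> x _; apply: le_trans (nrmM _ _) _.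
by have := sqr_ge0 (nrm (f x) - nrm (g x)); have := sqr_ge0 (nrm (f x)); have := sqr_ge0 (nrm (g x)); nra.
Qed.

Lemma sqr_integrable_itv f (a b : R) : sqr_integrable f -> cintegrable leb `]a, b] f.
Proof.
move=> [m1 m2 fi].
have f2 : leb.-integrable `]a, b] (EFin \o (fun x => nrm (f x) ^+ 2)).
  exact: integrableS fi.
have c1 : leb.-integrable `]a, b] (EFin \o cst (1 : R)).
  by apply: integrable_continuous; [exact: cst_continuous|exact: leb_itv_fin].
apply: (@cintegrable_le _ _ _ _ (fun x => 1 + nrm (f x) ^+ 2)) => //.
- exact: measurable_funTS.
- exact: measurable_funTS.
- exact: (integrableD (mitv `]a, b]) c1 f2).
- by move=> x _; have := sqr_ge0 (nrm (f x) - 1); have := sqr_ge0 (nrm (f x)); nra.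
Qed.

(** A function controlled by local L1 norms of square integrable functions has
its square controlled by a sliding integral. *)
Lemma window_sqr f g (K h t x : R) : 0 < h -> h <= 1 -> 0 <= K -> 0 <= x ->
  sqr_integrable f -> sqr_integrable g ->
  x <= K * (\int[leb]_(s in `]t - h, t]) nrm (f s) +
            \int[leb]_(s in `]t - h, t]) nrm (g s)) ->
  x ^+ 2 <= (2 * K ^+ 2) *
    \int[leb]_(s in `]t - h, t]) (nrm (f s) ^+ 2 + nrm (g s) ^+ 2).
Proof.
move=> h0 h1 K0 x0 sf sg xK.
have th : t - h <= t by lra.
have th1 : t - (t - h) <= 1 by lra.
have [_ _ f2] := sf; have [_ _ g2] := sg.
have f2' : leb.-integrable `]t - h, t] (EFin \o (fun x => nrm (f x) ^+ 2)).
  exact: integrableS f2.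
have g2' : leb.-integrable `]t - h, t] (EFin \o (fun x => nrm (g x) ^+ 2)).
  exact: integrableS g2.
have fi := integrable_nrm (mitv _) (sqr_integrable_itv (t - h) t sf).
have gi := integrable_nrm (mitv _) (sqr_integrable_itv (t - h) t sg).
have Jf := sqr_Rintegral_le th th1 fi f2'.
have Jg := sqr_Rintegral_le th th1 gi g2'.
rewrite RintegralD//.
have A0 : 0 <= \int[leb]_(s in `]t - h, t]) nrm (f s).
  by apply: Rintegral_ge0 => s _; exact: nrm_ge0.
have B0 : 0 <= \int[leb]_(s in `]t - h, t]) nrm (g s).
  by apply: Rintegral_ge0 => s _; exact: nrm_ge0.
move: xK Jf Jg A0 B0.
move: (Rintegral _ _ _) => A; move: (Rintegral _ _ _) => B.
move: (Rintegral _ _ _) => P; move: (Rintegral _ _ _) => Q xK Jf Jg A0 B0.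
have x2 : x ^+ 2 <= (K * (A + B)) ^+ 2.
  by rewrite lerXn2r ?nnegrE// mulr_ge0// addr_ge0.
apply: (le_trans x2); rewrite exprMn.
rewrite -[leRHS]mulrA [leRHS]mulrCA ler_wpM2l ?sqr_ge0//.
by have := sqr_ge0 (A - B); rewrite sqrrB sqrrD; lra.
Qed.

Lemma sqr_sum_integrable f g : sqr_integrable f -> sqr_integrable g ->
  leb.-integrable setT (EFin \o (fun s => nrm (f s) ^+ 2 + nrm (g s) ^+ 2)).
Proof. by move=> [_ _ f2] [_ _ g2]; exact: (integrableD _ f2 g2). Qed.

(** u is a continuous primitive of g. *)
Definition primitive_of u g :=
  ccontinuous u /\ forall s t : R, s <= t -> u t = u s + cintegral leb `]s, t] g.

Lemma primitive_sqr_bound u g : sqr_integrable u -> sqr_integrable g ->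
  primitive_of u g -> forall t, nrm (u t) ^+ 2 <=
  2 * \int[leb]_(s in `]t - 1, t]) (nrm (u s) ^+ 2 + nrm (g s) ^+ 2).
Proof.
move=> su sg [cu uE] t.
have := @window_sqr u g 1 1 t (nrm (u t)) ltr01 (lexx _) ler01 (nrm_ge0 _) su sg.
rewrite mul1r expr1n mulr1; apply; apply: primitive_bound => // a b.
exact: sqr_integrable_itv.
Qed.

Lemma measurable_ccontinuous u : ccontinuous u ->
  measurable_fun setT (re_fun u) /\ measurable_fun setT (im_fun u).
Proof. by move=> [c1 c2]; split; exact: continuous_measurable_fun. Qed.

(** A function of W12 is square integrable with respect to every measure of
bounded mass on unit intervals. *)
Lemma primitive_sqr_integrable (M : {sigma_finite_measure set RR -> \bar R}) (C : R) u g :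
  unif_bounded C M -> sqr_integrable u -> sqr_integrable g -> primitive_of u g ->
  M.-integrable setT (EFin \o (fun x => nrm (u x) ^+ 2)).
Proof.
move=> MC su sg pu; have [cu _] := pu.
have q0 x : 0 <= nrm (u x) ^+ 2 + nrm (g x) ^+ 2 by rewrite addr_ge0 ?sqr_ge0.
have wi := window_integrable ltr01 (lexx 1) MC q0 (sqr_sum_integrable su sg).
apply: (le_integrable _ _ _ (integrableZl _ 2 wi)) => //.
  apply/measurable_EFinP; apply: measurable_funX.
  by have [m1 m2] := measurable_ccontinuous cu; exact: measurable_nrm.
move=> x _ /=; rewrite lee_fin ger0_norm ?sqr_ge0//.
apply: le_trans (primitive_sqr_bound su sg pu x) _; exact: ler_norm.
Qed.

(** A function of W12 vanishes at infinity: its square at t is at most twice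
the integral of an integrable function over ]t - 1, t]. *)
Lemma primitive_cvg0 u g : sqr_integrable u -> sqr_integrable g ->
  primitive_of u g ->
  ((fun n : nat => nrm (u n%:R)) @ \oo --> (0 : R)) /\
  ((fun n : nat => nrm (u (- n%:R))) @ \oo --> (0 : R)).
Proof.
move=> su sg pu; have qi := sqr_sum_integrable su sg.
set q := (fun s => nrm (u s) ^+ 2 + _) in qi.
have q0 x : 0 <= q x by rewrite addr_ge0 ?sqr_ge0.
pose S (n : nat) := \int[leb]_(x in `]- n%:R, n%:R]) q x.
have qI (a b : R) : leb.-integrable `]a, b] (EFin \o q) by exact: integrableS qi.
have Scvg : S @ \oo --> \int[leb]_x q x by exact: Rintegral_itv_cvg.
have Sc1 : (fun n => S n.+1) @ \oo --> \int[leb]_x q x by rewrite cvg_shiftS.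
have e0 : (fun n => Num.sqrt (2 * (S n.+1 - S n))) @ \oo --> (0 : R).
  rewrite -[X in _ --> X]sqrtr0.
  apply: (@continuous_cvg _ _ _ _ _ _ Num.sqrt); first exact: sqrt_continuous.
  rewrite -(mulr0 2) -(subrr (\int[leb]_x q x)).
  by apply: cvgMr; exact: cvgB.
pose J (a b : R) := \int[leb]_(x in `]a, b]) q x.
have SE n : S n.+1 = J (- n.+1%:R) (- n%:R) + S n + J n%:R n.+1%:R.
  have n1 : - n.+1%:R <= - n%:R :> R by rewrite lerN2 ler_nat.
  have n2 : - n%:R <= n%:R :> R by rewrite (@le_trans _ _ 0) ?oppr_le0 ?ler0n.
  have n3 : n%:R <= n.+1%:R :> R by rewrite ler_nat.
  rewrite /S (Rintegral_split n1 (le_trans n2 n3) (qI _ _)).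
  by rewrite (Rintegral_split n2 n3 (qI _ _)) addrA.
have J0 (a b : R) : 0 <= J a b by apply: Rintegral_ge0 => x _; exact: q0.
have JS n : J n%:R n.+1%:R <= S n.+1 - S n.
  by rewrite SE; have := J0 (- n.+1%:R) (- n%:R); lra.
have JS' n : J (- n.+1%:R) (- n%:R) <= S n.+1 - S n.
  by rewrite SE; have := J0 n%:R n.+1%:R; lra.
have S0 n : 0 <= 2 * (S n.+1 - S n).
  by rewrite mulr_ge0// (le_trans (J0 _ _) (JS n)).
have bound t n : J (t - 1) t <= S n.+1 - S n ->
    0 <= nrm (u t) <= Num.sqrt (2 * (S n.+1 - S n)).
  move=> Jt; rewrite nrm_ge0/= -[leLHS]ger0_norm ?nrm_ge0// -sqrtr_sqr ler_sqrt//.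
  by apply: le_trans (primitive_sqr_bound su sg pu _) _; rewrite ler_pM2l.
split.
- rewrite -cvg_shiftS; apply: (squeeze_cvgr _ (cvg_cst (0 : R)) e0).
  by apply: nearW => n; apply: bound; rewrite -[X in J (X - 1)]natr1 addrK.
- apply: (squeeze_cvgr _ (cvg_cst (0 : R)) e0).
  by apply: nearW => n; apply: bound; rewrite -opprD natr1.
Qed.

Section whole_line.
Variables (M1 M2 M3 M4 : {sigma_finite_measure set RR -> \bar R}) (C : R).
Hypotheses (M1C : unif_bounded C M1) (M2C : unif_bounded C M2).
Hypotheses (M3C : unif_bounded C M3) (M4C : unif_bounded C M4).
Hypothesis C0 : 0 <= C.

(* Up to the integral of f, the oscillation of g on an interval of length at
   most 1 is at most 4 C times the supremum of u; h is chosen so that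
   [derivative_bound] applies to the constant 4 C. *)
Let h : R := (1 + 16 * C)^-1.

Let h_gt0 : 0 < h.
Proof. by rewrite invr_gt0; have := C0; lra. Qed.

Let h_le1 : h <= 1.
Proof. by rewrite invf_le1; have := C0; lra. Qed.

Let h_small : 4 * h * (4 * C) <= 1.
Proof.
have p : 0 < 1 + 16 * C by have := C0; lra.
rewrite (_ : 4 * h * (4 * C) = (16 * C) / (1 + 16 * C)); last by rewrite /h; ring.
by rewrite ler_pdivrMr// mul1r lerDr.
Qed.

Let K : R := 18 * h^-1 ^+ 2 + 84 * (4 * C) * h^-1 + 8 * (4 * C) + 2.

Let K_ge0 : 0 <= K.
Proof.
have hi : 0 <= h^-1 by rewrite invr_ge0 ltW.
by rewrite /K !addr_ge0// ?mulr_ge0// ?exprn_ge0// mulr_ge0.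
Qed.

Lemma driven_sqr_bound u f g : sqr_integrable u -> sqr_integrable f ->
  ccontinuous u -> driven M1 M2 M3 M4 u f g ->
  (forall s t : R, s <= t -> u t = u s + cintegral leb `]s, t] g) ->
  forall t, nrm (g t) ^+ 2 <= (2 * K ^+ 2) *
    \int[leb]_(s in `]t - h, t]) (nrm (u s) ^+ 2 + nrm (f s) ^+ 2).
Proof.
move=> su sf cu gE uE t; apply: window_sqr => //; first exact: nrm_ge0.
have fi a b := sqr_integrable_itv a b sf.
apply: derivative_bound => //; first by rewrite mulr_ge0.
- exact: (driven_integrable M1C M2C M3C M4C cu fi gE).
- exact: (driven_osc M1C M2C M3C M4C cu fi gE).
Qed.

(** The derivative of a square integrable solution is square integrable. *)
Lemma driven_sqr_integrable u f g : sqr_integrable u -> sqr_integrable f ->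
  ccontinuous u -> driven M1 M2 M3 M4 u f g ->
  (forall s t : R, s <= t -> u t = u s + cintegral leb `]s, t] g) ->
  measurable_fun setT (re_fun g) -> measurable_fun setT (im_fun g) ->
  sqr_integrable g.
Proof.
move=> su sf cu gE uE m1 m2; split => //.
have q0 x : 0 <= nrm (u x) ^+ 2 + nrm (f x) ^+ 2 by rewrite addr_ge0 ?sqr_ge0.
have wi := window_integrable h_gt0 h_le1 (@unif_bounded_leb R) q0 (sqr_sum_integrable su sf).
apply: (le_integrable _ _ _ (integrableZl _ (2 * K ^+ 2) wi)) => //.
  by apply/measurable_EFinP; apply: measurable_funX; exact: measurable_nrm.
move=> x _ /=; rewrite lee_fin ger0_norm ?sqr_ge0//.
by apply: le_trans (driven_sqr_bound su sf cu gE uE x) _; exact: ler_norm.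
Qed.

Lemma driven_bounded u f g : sqr_integrable u -> sqr_integrable f ->
  ccontinuous u -> driven M1 M2 M3 M4 u f g ->
  (forall s t : R, s <= t -> u t = u s + cintegral leb `]s, t] g) ->
  exists G, forall t, nrm (g t) <= G.
Proof.
move=> su sf cu gE uE; have qi := sqr_sum_integrable su sf.
set q := (fun s => _ + _) in qi.
exists (Num.sqrt (2 * K ^+ 2 * \int[leb]_s q s)) => t.
have q0 x : 0 <= q x by rewrite addr_ge0 ?sqr_ge0.
have Q0 : 0 <= \int[leb]_s q s by apply: Rintegral_ge0 => x _; exact: q0.
rewrite -[leLHS]ger0_norm ?nrm_ge0// -sqrtr_sqr ler_sqrt; last first.
  by rewrite !mulr_ge0 ?exprn_ge0.
apply: le_trans (driven_sqr_bound su sf cu gE uE t) _.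
rewrite ler_wpM2l ?mulr_ge0 ?exprn_ge0//.
have qI : leb.-integrable `]t - h, t] (EFin \o q) by exact: integrableS qi.
rewrite -lee_fin !EFin_Rintegral//; apply: ge0_subset_integral => //.
- exact: (measurable_int leb qi).
- by move=> x _; rewrite lee_fin; exact: q0.
Qed.

(** The limit of integration by parts over ]-n, n]: g is bounded and v vanishes
at infinity, so that the boundary terms vanish in the limit. *)
Lemma driven_form u f g v w : sqr_integrable u -> sqr_integrable f ->
  ccontinuous u -> driven M1 M2 M3 M4 u f g ->
  (forall s t : R, s <= t -> u t = u s + cintegral leb `]s, t] g) ->
  sqr_integrable g ->
  sqr_integrable v -> sqr_integrable w -> primitive_of v w ->
  cintegral leb setT (fun t => g t * w t) +
    four_integral M1 M2 M3 M4 setT (fun t => u t * v t) =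
  cintegral leb setT (fun t => f t * v t).
Proof.
move=> su sf cu gE uE sg sv sw pv; have [cv vE] := pv.
have mulI a b : sqr_integrable a -> sqr_integrable b ->
    cintegrable leb setT (fun t => a t * b t).
  by move=> [a1 a2 a3] [b1 b2 b3]; exact: cintegrable_mul.
have [mu1 mu2] := measurable_ccontinuous cu.
have [mv1 mv2] := measurable_ccontinuous cv.
have pu : primitive_of u g by [].
have mulM (M : {sigma_finite_measure set RR -> \bar R}) : unif_bounded C M ->
    cintegrable M setT (fun t => u t * v t).
  move=> MC; apply: cintegrable_mul => //.
  - exact: primitive_sqr_integrable MC su sg pu.
  - exact: primitive_sqr_integrable MC sv sw pv.
have cX := cintegral_itv_cvg (mulI _ _ sg sw).
have cZ := cintegral_itv_cvg (mulI _ _ sf sv).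
have cY : ccvg (fun n => four_integral M1 M2 M3 M4 `]- n%:R, n%:R] (fun t => u t * v t))
    (four_integral M1 M2 M3 M4 setT (fun t => u t * v t)).
  by apply: four_integral_cvg; split; exact: mulM.
have cL := ccvgB (ccvgD cX cY) cZ.
suff cB : ccvg (fun n : nat => g n%:R * v n%:R - g (- n%:R) * v (- n%:R)) 0.
  apply/eqP; rewrite -subr_eq0; apply/eqP; apply: (ccvg_unique cL).
  move: cB; congr ccvg; apply/funext => n; apply/esym.
  have n2 : - n%:R <= n%:R :> R by rewrite (@le_trans _ _ 0) ?oppr_le0 ?ler0n.
  have fi := sqr_integrable_itv (- n%:R) n%:R sf.
  have wi := sqr_integrable_itv (- n%:R) n%:R sw.
  have vE' t : - n%:R <= t <= n%:R ->
      v t = v (- n%:R) + cintegral leb `]- n%:R, t] w.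
    by move=> /andP[nt _]; exact: vE.
  by have [_ _ _ E] := driven_by_parts M1C M2C M3C M4C cu fi wi gE vE' n2.
have [G gG] := driven_bounded su sf cu gE uE.
have [v1 v2] := primitive_cvg0 sv sw pv.
apply: ccvg_nrm0.
have bG : (fun n : nat => G * nrm (v n%:R) + G * nrm (v (- n%:R))) @ \oo --> (0 : R).
  rewrite -[X in _ --> X](addr0 0) -[X in _ --> X + _](mulr0 G) -[X in _ --> _ + X](mulr0 G).
  by apply: cvgD; apply: cvgMr.
apply: (squeeze_cvgr _ (cvg_cst (0 : R)) bG).
apply: nearW => n; rewrite nrm_ge0/=.
apply: le_trans (nrmB _ _) _; apply: lerD.
  by apply: le_trans (nrmM _ _) _; rewrite ler_wpM2r ?nrm_ge0.
by apply: le_trans (nrmM _ _) _; rewrite ler_wpM2r ?nrm_ge0.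
Qed.

End whole_line.
End square_integrable.

(** * Complex weak derivatives and continuous representatives *)

Section complex_weak_derivatives.
Context {R : realType}.
Local Notation RR := (measurableTypeR R).
Local Notation leb := (@lebesgue_measure R).
Implicit Types (f g u v w phi : R -> R[i]).

Lemma ae_eqP u v : u = v %[ae leb] <-> {ae leb, forall x, u x = v x}.
Proof.
split=> [|uv]; first by apply: leb_aeS => x /(_ I).
by move: uv; apply: leb_aeS => x + _.
Qed.

Lemma ae_comp u v (S : Type) (h : R[i] -> S) :
  {ae leb, forall x, u x = v x} -> {ae leb, forall x, h (u x) = h (v x)}.
Proof. by apply: (@filterS _ _ (ae_filter_ringOfSetsType leb)) => x /= ->. Qed.

Lemma ae_eq_sym_leb u v : {ae leb, forall x, u x = v x} ->
  {ae leb, forall x, v x = u x}.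
Proof. exact: leb_aeS. Qed.

Lemma ae_eq_trans_leb u v w : {ae leb, forall x, u x = v x} ->
  {ae leb, forall x, v x = w x} -> {ae leb, forall x, u x = w x}.
Proof. by apply: leb_aeS2 => x -> ->. Qed.

(** Measurability of both components. *)
Definition cmeasurable f :=
  measurable_fun setT (re_fun f) /\ measurable_fun setT (im_fun f).

Lemma cmeasurable_mul f g : cmeasurable f -> cmeasurable g ->
  cmeasurable (fun x => f x * g x).
Proof. by move=> [f1 f2] [g1 g2]; exact: measurable_cmul. Qed.

Lemma cmeasurable_conj f : cmeasurable f -> cmeasurable (fun x => conjc (f x)).
Proof.
move=> [f1 f2]; split.
- by rewrite (_ : re_fun _ = re_fun f)//; apply/funext => x; exact: Re_conjc.
- rewrite (_ : im_fun _ = (fun x => - im_fun f x)); first exact: measurable_funN.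
  by apply/funext => x; exact: Im_conjc.
Qed.

Lemma cmeasurableB f g : cmeasurable f -> cmeasurable g ->
  cmeasurable (fun x => f x - g x).
Proof.
move=> [f1 f2] [g1 g2]; split.
- rewrite (_ : re_fun _ = (fun x => re_fun f x - re_fun g x)).
    exact: measurable_funB.
  by apply/funext => x; rewrite /re_fun Re_add Re_opp.
- rewrite (_ : im_fun _ = (fun x => im_fun f x - im_fun g x)).
    exact: measurable_funB.
  by apply/funext => x; rewrite /im_fun Im_add Im_opp.
Qed.

Lemma ae_eq_cintegral f g (D : set R) : measurable (D : set RR) ->
  cmeasurable f -> cmeasurable g ->
  {ae leb, forall x, f x = g x} -> cintegral leb D f = cintegral leb D g.
Proof.
move=> mD [f1 f2] [g1 g2] fg; apply: complex_ext => /=;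
  apply: ae_eq_Rintegral => //; try exact: measurable_funTS.
- exact: ae_comp fg.
- exact: ae_comp fg.
Qed.

Lemma ae_sqr_integrable f g : sqr_integrable f -> cmeasurable g ->
  {ae leb, forall x, f x = g x} -> sqr_integrable g.
Proof.
move=> [f1 f2 fi] [g1 g2] fg; split => //.
have mn h : cmeasurable h -> measurable_fun setT (fun x => nrm (h x) ^+ 2).
  by move=> [h1 h2]; apply: measurable_funX; exact: measurable_nrm.
have /integrableP[_ fin] := fi.
apply/integrableP; split; first by apply/measurable_EFinP; exact: mn.
pose sq (h : R -> R[i]) (x : R) := (nrm (h x) ^+ 2)%:E.
rewrite -(@ae_eq_integral _ RR R leb setT (fun x => `|sq g x|%E) (fun x => `|sq f x|%E))//.
- by apply: measurableT_comp => //; apply/measurable_EFinP; exact: mn.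
- by apply: measurableT_comp => //; apply/measurable_EFinP; exact: mn.
- by move: fg; apply: leb_aeS => x e _; rewrite /sq e.
Qed.

Lemma sqr_integrable_conj f : sqr_integrable f ->
  sqr_integrable (fun x => conjc (f x)).
Proof.
move=> [f1 f2 fi]; have [m1 m2] := cmeasurable_conj (conj f1 f2); split => //.
rewrite (_ : (fun x => _) = (fun x => nrm (f x) ^+ 2))//.
by apply/funext => x; rewrite nrm_conj.
Qed.

Lemma test_functionP phi : test_function phi <->
  real_test (re_fun phi) /\ real_test (im_fun phi).
Proof.
split.
  move=> [s1 s2 /compact_bounded[M [_ HM]]].
  have z x : `|M| + 2 <= `|x| -> phi x = 0.
    move=> Mx; apply: contrapT => /eqP px.
    have : `|x| <= `|M| + 1.
      apply: (HM (`|M| + 1)); first by rewrite (le_lt_trans (ler_norm _))// ltrDl.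
      exact: subset_closure.
    by lra.
  split; split => //; exists (`|M| + 2) => x /z; rewrite /re_fun /im_fun => -> //.
move=> [[s1 [N N0]] [s2 [M M0]]]; split => //.
pose b := `|N| + `|M|.
apply: (@subclosed_compact _ _ `[- b, b]%classic).
- exact: closed_closure.
- exact: segment_compact.
- have cl : closed (`[- b, b]%classic : set R) by exact: interval_closed.
  rewrite [X in _ `<=` X](closure_id _).1//.
  apply: closureS => x /= px; rewrite in_itv/= -ler_norml leNgt.
  apply/negP => bx; move/eqP: px; apply; apply: complex_ext => /=.
    apply: N0; apply: le_trans (ltW bx); apply: le_trans (ler_norm N) _.
    by rewrite lerDl.
  apply: M0; apply: le_trans (ltW bx); apply: le_trans (ler_norm M) _.
  by rewrite lerDr.
Qed.

Lemma real_test_function (psi : R -> R) : real_test psi ->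
  test_function (fun x => (psi x)%:C%C).
Proof. by move=> tpsi; apply/test_functionP; split => //; exact: real_test0. Qed.

Lemma cderive_real (psi : R -> R) :
  cderive (fun x => (psi x)%:C%C) = (fun x => (derive1 psi x)%:C%C).
Proof.
apply/funext => x; apply: complex_ext => //=.
rewrite (_ : im_fun _ = cst 0); first by rewrite derive1_cst.
by apply/funext.
Qed.

Lemma test_function_cderive phi : test_function phi -> test_function (cderive phi).
Proof.
move=> /test_functionP[t1 t2]; apply/test_functionP; split.
- exact: (real_test_derive1 t1).
- exact: (real_test_derive1 t2).
Qed.

Lemma re_mul_real f (psi : R -> R) :
  re_fun (fun x => f x * (psi x)%:C%C) = (fun x => re_fun f x * psi x).
Proof. by apply/funext => x; rewrite /re_fun Re_mul/= mulr0 subr0. Qed.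

Lemma im_mul_real f (psi : R -> R) :
  im_fun (fun x => f x * (psi x)%:C%C) = (fun x => im_fun f x * psi x).
Proof. by apply/funext => x; rewrite /im_fun Im_mul/= mulr0 add0r. Qed.

Lemma test_function_conj phi : test_function phi ->
  test_function (fun x => conjc (phi x)).
Proof.
move=> /test_functionP[t1 t2]; apply/test_functionP; split.
- by rewrite (_ : re_fun _ = re_fun phi)//; apply/funext => x; exact: Re_conjc.
- rewrite (_ : im_fun _ = (fun x => -1 * im_fun phi x)); first exact: real_testZ.
  by apply/funext => x; rewrite mulN1r; exact: Im_conjc.
Qed.

Lemma cderive_conj phi : test_function phi ->
  cderive (fun x => conjc (phi x)) = (fun x => conjc (cderive phi x)).
Proof.
move=> /test_functionP[[s1 _] [s2 _]]; apply/funext => x.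
apply: complex_ext; rewrite /= ?Re_conjc ?Im_conjc /=.
- by rewrite (_ : re_fun _ = re_fun phi)//; apply/funext => y; exact: Re_conjc.
- rewrite (_ : im_fun _ = (fun x => -1 * im_fun phi x + cst 0 x)).
    by rewrite (derive1_comb _ s2 (@smooth_cst R 0)) derive1_cst addr0 mulN1r.
  by apply/funext => y; rewrite mulN1r addr0; exact: Im_conjc.
Qed.

Lemma ccontinuous_test phi : test_function phi -> ccontinuous phi.
Proof.
by move=> /test_functionP[[s1 _] [s2 _]]; split; exact: smooth_continuous.
Qed.

Lemma L2_test phi : test_function phi -> L2 phi.
Proof.
have real_L2 psi : real_test psi -> psi \in Lfun leb 2%:E.
  move=> tpsi; have [spsi _] := tpsi.
  have cpsi := smooth_continuous spsi.
  apply/Lfun2P; split; first exact: continuous_measurable_fun.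
  have := integrable_mul_test (locally_integrable_continuous cpsi) tpsi.
  by apply: eq_integrable => // x _ /=; rewrite expr2.
by move=> /test_functionP[t1 t2]; split; exact: real_L2.
Qed.

Lemma is_weak_derivativeP u g : is_weak_derivative u g <->
  real_weak_derivative (re_fun u) (re_fun g) /\
  real_weak_derivative (im_fun u) (im_fun g).
Proof.
split.
  move=> [[lu1 lu2] [lg1 lg2] ug]; split; split => // psi tpsi;
    have := ug _ (real_test_function tpsi); rewrite cderive_real => /(congr1 (fun z : R[i] => (Re z, Im z)));
    rewrite Re_opp Im_opp /= !re_mul_real !im_mul_real; by case.
move=> [[lu1 lg1 ug1] [lu2 lg2 ug2]]; split => // phi /test_functionP[t1 t2].
have t1' := real_test_derive1 t1; have t2' := real_test_derive1 t2.
have int (w psi : R -> R) (lw : locally_integrable setT w) (tpsi : real_test psi) := integrable_mul_test lw tpsi.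
have reM f h : re_fun (fun t => f t * h t) =
    (fun t => re_fun f t * re_fun h t - im_fun f t * im_fun h t).
  by apply/funext => t; exact: Re_mul.
have imM f h : im_fun (fun t => f t * h t) =
    (fun t => re_fun f t * im_fun h t + im_fun f t * re_fun h t).
  by apply/funext => t; exact: Im_mul.
have dre : re_fun (cderive phi) = derive1 (re_fun phi) by [].
have dim : im_fun (cderive phi) = derive1 (im_fun phi) by [].
apply: complex_ext; rewrite ?Re_opp ?Im_opp /= ?reM ?imM ?dre ?dim.
- rewrite RintegralB//; [|exact: int lu1 t1'|exact: int lu2 t2'].
  rewrite RintegralB//; [|exact: int lg1 t1|exact: int lg2 t2].
  by rewrite ug1// ug2//; ring.
- rewrite RintegralD//; [|exact: int lu1 t2'|exact: int lu2 t1'].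
  rewrite RintegralD//; [|exact: int lg1 t2|exact: int lg2 t1].
  by rewrite ug1// ug2//; ring.
Qed.

Lemma weak_derivativeP u : W11loc u -> is_weak_derivative u (weak_derivative u).
Proof. by move=> [g ug]; apply: (xgetPex (cst 0)); exists g. Qed.

Lemma cmeasurable_L1loc u : L1loc u -> cmeasurable u.
Proof. by move=> [[m1 _ _] [m2 _ _]]. Qed.

Lemma cmeasurable_L2 u : L2 u -> cmeasurable u.
Proof. by move=> /sqr_integrableP[]. Qed.

Lemma cmeasurable_continuous u : ccontinuous u -> cmeasurable u.
Proof. by move=> /measurable_ccontinuous. Qed.

Lemma cintegrable_L1loc u : L1loc u -> forall a b : R, cintegrable leb `]a, b] u.
Proof.
by move=> [l1 l2] a b; split; exact: locally_integrable_itv.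
Qed.

Lemma is_weak_derivative_unique u g g' : is_weak_derivative u g ->
  is_weak_derivative u g' -> {ae leb, forall x, g x = g' x}.
Proof.
move=> /is_weak_derivativeP[d1 d2] /is_weak_derivativeP[d1' d2'].
have := weak_derivative_unique d2 d2'; have := weak_derivative_unique d1 d1'.
by apply: leb_aeS2 => x e1 e2; exact: complex_ext.
Qed.

Lemma eq_ae_is_weak_derivative u u' g g' : is_weak_derivative u g ->
  cmeasurable u' -> cmeasurable g' -> {ae leb, forall x, u x = u' x} ->
  {ae leb, forall x, g x = g' x} -> is_weak_derivative u' g'.
Proof.
move=> /is_weak_derivativeP[d1 d2] [u1 u2] [g1 g2] uu' gg'.
apply/is_weak_derivativeP; split.
- by apply: (eq_ae_weak_derivative d1) => //; [exact: ae_comp uu'|exact: ae_comp gg'].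
- by apply: (eq_ae_weak_derivative d2) => //; [exact: ae_comp uu'|exact: ae_comp gg'].
Qed.

Lemma is_weak_derivative_primitive u g : L1loc g ->
  (forall s t : R, s <= t -> u t = u s + cintegral leb `]s, t] g) ->
  ccontinuous u /\ is_weak_derivative u g.
Proof.
move=> [l1 l2] uE.
have e1 s t : s <= t -> re_fun u t = re_fun u s + \int[leb]_(x in `]s, t]) re_fun g x.
  by move=> st; rewrite /re_fun (uE s t st) Re_add.
have e2 s t : s <= t -> im_fun u t = im_fun u s + \int[leb]_(x in `]s, t]) im_fun g x.
  by move=> st; rewrite /im_fun (uE s t st) Im_add.
split.
  by split; [exact: primitive_continuous l1 e1|exact: primitive_continuous l2 e2].
apply/is_weak_derivativeP; split.
- exact: primitive_weak_derivative e1.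
- exact: primitive_weak_derivative e2.
Qed.

Lemma is_weak_derivative_cderive phi : test_function phi ->
  is_weak_derivative phi (cderive phi).
Proof.
move=> tphi; have [c1 c2] := ccontinuous_test (test_function_cderive tphi).
have /test_functionP[[s1 _] [s2 _]] := tphi.
apply/is_weak_derivativeP; split.
- apply: primitive_weak_derivative; first exact: locally_integrable_continuous.
  exact: smooth_FTC.
- apply: primitive_weak_derivative; first exact: locally_integrable_continuous.
  exact: smooth_FTC.
Qed.

Lemma continuous_ae_eq (r s : R -> R) : continuous r -> continuous s ->
  {ae leb, forall x, r x = s x} -> r = s.
Proof.
move=> cr cs rs; apply/funext => x; apply: contrapT => /eqP rsx.
have d0 : 0 < `|r x - s x| by rewrite normr_gt0 subr_eq0.
have cd : continuous (fun y => r y - s y).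
  by move=> y; apply: cvgB; [exact: cr|exact: cs].
have nb : \forall y \near x, r y != s y.
  near=> y; rewrite -subr_eq0 -normr_gt0.
  have : `|(r x - s x) - (r y - s y)| < `|r x - s x|.
    by near: y; apply: cvgr_dist_lt => //; exact: cd.
  have := ler_dist_dist (r x - s x) (r y - s y).
  have := ler_norm (`|r x - s x| - `|r y - s y|).
  by lra.
have [e /= e0 be] := nb.
have [A [mA A0 sA]] := rs.
have : (leb (ball x e) <= leb A)%E.
  apply: le_measure; rewrite ?inE//; first exact: measurable_ball.
  by move=> y /be /eqP ne; apply: sA.
rewrite A0 lebesgue_measure_ball; last exact: ltW.
move=> e2.
have : e *+ 2 <= 0 by rewrite -lee_fin.
by rewrite leNgt mulrn_wgt0.
Unshelve. all: by end_near. Qed.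

Lemma continuous_repE u v : is_continuous_rep u v -> continuous_rep u = v.
Proof.
move=> uv; have [[c1 c2] /ae_eqP vu] := uv.
have [[d1 d2] /ae_eqP wu] : is_continuous_rep u (continuous_rep u).
  by apply: (xgetPex u); exists v.
have wv := ae_eq_trans_leb wu (ae_eq_sym_leb vu).
have e1 := continuous_ae_eq d1 c1 (ae_comp (@complex.Re R) wv).
have e2 := continuous_ae_eq d2 c2 (ae_comp (@complex.Im R) wv).
by apply/funext => x; apply: complex_ext; [exact: (congr1 (fun h => h x) e1)|exact: (congr1 (fun h => h x) e2)].
Qed.

Lemma continuous_rep_id u : ccontinuous u -> continuous_rep u = u.
Proof.
by move=> cu; apply: continuous_repE; split => //; apply/ae_eqP; exact: aeW.
Qed.

(** A function with a weak derivative has a continuous representative, which is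
a primitive of the weak derivative. *)
Lemma weak_derivative_rep u g : is_weak_derivative u g ->
  is_continuous_rep u (continuous_rep u) /\ primitive_of (continuous_rep u) g.
Proof.
move=> ug; have [_ lg _] := ug; have /is_weak_derivativeP[d1 d2] := ug.
have [v1 uv1 e1] := weak_derivative_primitive d1.
have [v2 uv2 e2] := weak_derivative_primitive d2.
pose v x := (v1 x +i* v2 x)%C.
have vE (s t : R) : s <= t -> v t = v s + cintegral leb `]s, t] g.
  move=> st; apply: complex_ext; rewrite ?Re_add ?Im_add /=; [exact: e1|exact: e2].
have [cv _] := is_weak_derivative_primitive lg vE.
have uv : is_continuous_rep u v.
  split => //; apply/ae_eqP; move: uv1 uv2; apply: leb_aeS2 => x h1 h2.
  by apply: complex_ext; rewrite /= -?h1 -?h2.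
by rewrite (continuous_repE uv).
Qed.

End complex_weak_derivatives.

(** * The three operators *)

Section operators.
Context {R : realType}.
Local Notation RR := (measurableTypeR R).
Local Notation leb := (@lebesgue_measure R).
Implicit Types (f g u v w phi : R -> R[i]).

Variable mu : local_measure R.
Hypothesis mu_unif : (unif_norm mu < +oo)%E.

Let mitv (i : interval R) : measurable ([set` i] : set RR).
Proof. exact: measurable_itv. Qed.

Let C := unif_cst mu.
Let C0 : 0 <= C := unif_cst_ge0 mu_unif.

Let U1 := unif_re_pos mu_unif.
Let U2 := unif_re_neg mu_unif.
Let U3 := unif_im_pos mu_unif.
Let U4 := unif_im_neg mu_unif.

Let M1 := line_measure U1.
Let M2 := line_measure U2.
Let M3 := line_measure U3.
Let M4 := line_measure U4.

Let M1C : unif_bounded C M1 := U1.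
Let M2C : unif_bounded C M2 := U2.
Let M3C : unif_bounded C M3 := U3.
Let M4C : unif_bounded C M4 := U4.

Local Notation muint := (four_integral M1 M2 M3 M4).
Local Notation mudriven := (driven M1 M2 M3 M4).

Let local_integralE (D : set R) f : measurable D -> cmeasurable f ->
  local_integral mu D f = muint D f.
Proof.
move=> mD [m1 m2]; have [d1 d2] : measurable_fun D (re_fun f) /\ measurable_fun D (im_fun f).
  by split; exact: measurable_funTS.
rewrite /local_integral /four_integral.
rewrite (cintegral_line_measure U1 mD d1 d2) (cintegral_line_measure U2 mD d1 d2).
by rewrite (cintegral_line_measure U3 mD d1 d2) (cintegral_line_measure U4 mD d1 d2).
Qed.

Let oriented_integralE u (t : R) : ccontinuous u ->
  oriented_integral mu 0 t u = four_primitive M1 M2 M3 M4 u t.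
Proof.
move=> cu; have mu_ := cmeasurable_continuous cu.
by rewrite /oriented_integral /four_primitive !local_integralE.
Qed.

(* The primitive of u mu that vanishes at 0. *)
Let F u := four_primitive M1 M2 M3 M4 u.

Let A_SLE u : ccontinuous (continuous_rep u) ->
  A_SL mu u = (fun t => weak_derivative u t - F (continuous_rep u) t).
Proof. by move=> cu; apply/funext => t; rewrite /A_SL oriented_integralE. Qed.

Let F_driven u : ccontinuous u -> mudriven u (cst 0) (F u).
Proof. by move=> cu; apply: (four_primitive_driven M1C M2C M3C M4C). Qed.

Let driven_L1loc u f g : ccontinuous u ->
  (forall a b : R, cintegrable leb `]a, b] f) -> mudriven u f g -> L1loc g.
Proof.
move=> cu fi gE; have gi := driven_integrable M1C M2C M3C M4C cu fi gE.
by split; apply: itv_locally_integrable => n; have [] := gi (- n%:R) n%:R.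
Qed.

Let cintegrable0 (a b : R) : cintegrable leb `]a, b] (cst 0 : R -> R[i]).
Proof. by split; exact: integrable0. Qed.

Let F_measurable u : ccontinuous u -> cmeasurable (F u).
Proof.
move=> cu; apply: cmeasurable_L1loc.
exact: (driven_L1loc cu cintegrable0 (F_driven cu)).
Qed.

Let cintegral_supp (m : {measure set RR -> \bar R}) f (D : set R) :
  (forall x, ~ D x -> f x = 0) -> cintegral m setT f = cintegral m D f.
Proof.
by move=> f0; apply: complex_ext => /=; apply: Rintegral_supp => x /f0;
  rewrite /re_fun /im_fun => ->.
Qed.

Let muint_supp f (D : set R) : (forall x, ~ D x -> f x = 0) ->
  muint setT f = muint D f.
Proof.
by move=> f0; rewrite /four_integral; do 4! (rewrite (cintegral_supp _ f0)).
Qed.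

(** Integration by parts over an interval that contains the supports of the test
function and of its derivative. *)
Let driven_test u f g phi : ccontinuous u ->
  (forall a b : R, cintegrable leb `]a, b] f) -> mudriven u f g ->
  test_function phi ->
  cintegral leb setT (fun t => g t * cderive phi t) +
    muint setT (fun t => u t * phi t) -
    cintegral leb setT (fun t => f t * phi t) = 0.
Proof.
move=> cu fi gE tphi.
have tphi' := test_function_cderive tphi.
have bnd psi : test_function psi -> exists2 N : R, 0 <= N & forall x, N <= `|x| -> psi x = 0.
  move=> /test_functionP[[_ [N N0]] [_ [M M0]]].
  exists (`|N| + `|M|) => [|x Nx]; first by rewrite addr_ge0.
  apply: complex_ext; [apply: N0|apply: M0]; apply: le_trans Nx.
    by rewrite (le_trans (ler_norm _))// lerDl.
  by rewrite (le_trans (ler_norm _))// lerDr.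
have [N N0 phi0] := bnd _ tphi; have [N' N'0 phi'0] := bnd _ tphi'.
pose b := N + N'; pose a := - b.
have b0 : 0 <= b by rewrite addr_ge0.
have Nb : N <= b by rewrite lerDl.
have Nb' : N' <= b by rewrite lerDr.
have ab : a <= b by rewrite /a; lra.
have supp psi L : L <= b -> (forall x, L <= `|x| -> psi x = 0 :> R[i]) ->
    forall x, ~ (`]a, b]%classic x) -> psi x = 0.
  move=> Lb psi0 x xN; apply: psi0; rewrite (le_trans Lb)// leNgt.
  apply/negP => xl; apply: xN; rewrite /= in_itv/= /a.
  by move: xl; rewrite ltr_norml => /andP[-> /ltW].
have sphi := supp _ _ Nb phi0; have sphi' := supp _ _ Nb' phi'0.
have [_ [w1 w2]] := (is_weak_derivative_cderive tphi, ccontinuous_test tphi').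
have wi : cintegrable leb `]a, b] (cderive phi).
  by apply: cintegrable_continuous; [split|exact: leb_itv_fin].
have /test_functionP[[s1 _] [s2 _]] := tphi.
have WE t : a <= t <= b -> phi t = phi a + cintegral leb `]a, t] (cderive phi).
  move=> /andP[at_ _]; apply: complex_ext; rewrite ?Re_add ?Im_add.
    exact: (smooth_FTC s1 at_).
  exact: (smooth_FTC s2 at_).
have [_ _ _ E] := driven_by_parts M1C M2C M3C M4C cu (fi a b) wi gE WE ab.
rewrite (@cintegral_supp _ _ `]a, b]%classic); last first.
  by move=> x /sphi' ->; rewrite mulr0.
rewrite (@muint_supp _ `]a, b]%classic); last first.
  by move=> x /sphi ->; rewrite mulr0.
rewrite (@cintegral_supp _ (fun t => f t * phi t) `]a, b]%classic); last first.
  by move=> x /sphi ->; rewrite mulr0.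
rewrite E [phi b]phi0 ?ger0_norm// [phi a]phi0 ?normrN ?ger0_norm//.
by rewrite !mulr0 subrr.
Qed.

Let cprimitive f (t : R) : R[i] :=
  (primitive leb (re_fun f) t +i* primitive leb (im_fun f) t)%C.

Let cprimitiveE f : L1loc f -> forall s t : R, s <= t ->
  cprimitive f t = cprimitive f s + cintegral leb `]s, t] f.
Proof.
move=> [l1 l2] s t st; apply: complex_ext; rewrite ?Re_add ?Im_add /=.
- exact: (primitiveB (locally_integrable_itv l1)).
- exact: (primitiveB (locally_integrable_itv l2)).
Qed.

Let L1loc_L2 f : L2 f -> L1loc f.
Proof.
move=> /sqr_integrableP sf.
by split; apply: itv_locally_integrable => n;
  have [] := sqr_integrable_itv (- n%:R) n%:R sf.
Qed.

Let rep_spec u : has_continuous_rep u -> is_continuous_rep u (continuous_rep u).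
Proof. exact: xgetPex. Qed.

Let L2_ae u v : L2 u -> cmeasurable v -> {ae leb, forall x, u x = v x} -> L2 v.
Proof.
move=> /sqr_integrableP su mv uv; apply/sqr_integrableP.
exact: ae_sqr_integrable uv.
Qed.

(** The distributional equation integrates once: the weak derivative of u is,
up to a constant, the primitive of u mu minus the primitive of f. *)
Lemma H_max_sub_SL : H_max mu `<=` H_SL mu.
Proof.
move=> [u f] /= [L2u L2f cru uf].
have [cu /ae_eqP cuu] := rep_spec cru.
set cr := continuous_rep u in uf cu cuu.
have lf := L1loc_L2 L2f; have fi := cintegrable_L1loc lf.
have lu := L1loc_L2 L2u.
(* A derivative of u in the sense of the integrated equation; it remains to be
   seen that it is the weak derivative of u up to a constant. *)
pose k t := F cr t - cprimitive f t.
have kE : mudriven cr f k.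
  move=> s t st; rewrite /k (F_driven cu st) (cprimitiveE lf st).
  rewrite (_ : cintegral leb `]s, t] (cst 0 : R -> R[i]) = 0); first by ring.
  by apply: complex_ext; rewrite /= Rintegral_cst// mul0r.
have lk := driven_L1loc cu fi kE.
have mcr := cmeasurable_continuous cu.
have key (psi : R -> R) : real_test psi ->
    cintegral leb setT (fun t => u t * (derive1 (derive1 psi) t)%:C%C) =
    - cintegral leb setT (fun t => k t * (derive1 psi t)%:C%C).
  move=> tpsi; have tphi := real_test_function tpsi.
  have := uf _ tphi; have := driven_test cu fi kE tphi.
  have mphi := cmeasurable_continuous (ccontinuous_test tphi).
  rewrite (local_integralE measurableT (cmeasurable_mul mcr mphi)).
  rewrite !cderive_real => e1 e2.
  move: e1; rewrite e2; move: (cintegral _ _ _) => X; move: (cintegral _ _ _) => Y.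
  move: (muint _ _) => Z e1.
  by apply/eqP; rewrite -subr_eq0 -e1; apply/eqP; ring.
have real_key (psi : R -> R) : real_test psi ->
    (\int[leb]_x (re_fun u x * derive1 (derive1 psi) x)) =
      - (\int[leb]_x (re_fun k x * derive1 psi x)) /\
    (\int[leb]_x (im_fun u x * derive1 (derive1 psi) x)) =
      - (\int[leb]_x (im_fun k x * derive1 psi x)).
  move=> /key /(congr1 (fun z : R[i] => (Re z, Im z))).
  by rewrite Re_opp Im_opp /= !re_mul_real !im_mul_real => -[].
have [lu1 lu2] := lu; have [lk1 lk2] := lk.
have [c1 d1] := weak_derivative_up_to_cst lu1 lk1 (fun psi t => (real_key psi t).1).
have [c2 d2] := weak_derivative_up_to_cst lu2 lk2 (fun psi t => (real_key psi t).2).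
pose c := (c1 +i* c2)%C.
have ukc : is_weak_derivative u (fun t => k t + c).
  apply/is_weak_derivativeP; split; [move: d1|move: d2]; congr real_weak_derivative;
    by apply/funext => t; rewrite /re_fun /im_fun ?Re_add ?Im_add.
have Wu : W11loc u by exists (fun t => k t + c).
have wdu := weak_derivativeP Wu.
have wdE := is_weak_derivative_unique wdu ukc.
have [_ lwd _] := wdu.
have AE := A_SLE cu.
(* The function p equals A_SL mu u almost everywhere and is a primitive of - f. *)
pose p t := c - cprimitive f t.
have lNf : L1loc (fun t => - f t).
  have [lf1 lf2] := lf; split.
    rewrite (_ : re_fun _ = \- re_fun f); first exact: locally_integrableN.
    by apply/funext => t; rewrite /re_fun Re_opp.
  rewrite (_ : im_fun _ = \- im_fun f); first exact: locally_integrableN.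
  by apply/funext => t; rewrite /im_fun Im_opp.
have pE (s t : R) : s <= t -> p t = p s + cintegral leb `]s, t] (fun t => - f t).
  move=> st; rewrite /p (cprimitiveE lf st).
  rewrite (_ : cintegral leb `]s, t] (fun t => - f t) = - cintegral leb `]s, t] f); first by ring.
  rewrite -mulN1r -(cintegralZ _ (mitv _) (fi s t)).
  by apply: eq_cintegral => x _; rewrite mulN1r.
have [_ pd] := is_weak_derivative_primitive lNf pE.
have mA : cmeasurable (A_SL mu u).
  rewrite AE; apply: cmeasurableB; first exact: cmeasurable_L1loc.
  exact: F_measurable.
have pA : {ae leb, forall x, p x = A_SL mu u x}.
  rewrite AE; move: wdE; apply: leb_aeS => x ->; rewrite /p /k; ring.
have mNf := cmeasurable_L1loc lNf.
have Ad : is_weak_derivative (A_SL mu u) (fun t => - f t).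
  apply: (eq_ae_is_weak_derivative pd mA mNf pA).
  exact: aeW.
have WA : W11loc (A_SL mu u) by exists (fun t => - f t).
have wdA := weak_derivativeP WA.
have fA := is_weak_derivative_unique Ad wdA.
have [_ lwdA _] := wdA.
have L2Nf : L2 (fun t => - f t).
  apply/sqr_integrableP; have /sqr_integrableP[_ _ i] := L2f.
  have [m1 m2] := mNf; split => //; move: i; congr (leb.-integrable _ _).
  by apply/funext => t /=; rewrite nrmN.
split => //.
  split => //; exact: L2_ae L2Nf (cmeasurable_L1loc lwdA) fA.
by apply/ae_eqP; move: fA; apply: leb_aeS => x <-; rewrite opprK.
Qed.

(** The continuous representative of A_SL u plus the primitive F of u mu is a
derivative of u which satisfies the integrated equation, so that
[driven_sqr_integrable] and [driven_form] apply. *)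
Lemma H_SL_sub_form : H_SL mu `<=` H_form mu.
Proof.
move=> [u f] /= [[L2u Wu WA L2A] L2f /ae_eqP fA].
have wdu := weak_derivativeP Wu; have wdA := weak_derivativeP WA.
have [[cu /ae_eqP cuu] [_ crE]] := weak_derivative_rep wdu.
set cr := continuous_rep u in cu cuu crE.
have [[ca /ae_eqP caA] [_ aE]] := weak_derivative_rep wdA.
set a := continuous_rep (A_SL mu u) in ca caA aE.
have AE := A_SLE cu.
pose g t := a t + F cr t.
have lf := L1loc_L2 L2f; have fi := cintegrable_L1loc lf.
have [_ lwd _] := wdu; have mwd := cmeasurable_L1loc lwd.
have [_ lwdA _] := wdA; have wdAi := cintegrable_L1loc lwdA.
have gwd : {ae leb, forall x, g x = weak_derivative u x}.
  by move: caA; rewrite AE; apply: leb_aeS => x; rewrite /g => ->; rewrite subrK.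
have gE : mudriven cr f g.
  move=> s t st; rewrite /g (aE s t st) (F_driven cu st).
  rewrite (_ : cintegral leb `]s, t] (cst 0 : R -> R[i]) = 0); last first.
    by apply: complex_ext; rewrite /= Rintegral_cst// mul0r.
  rewrite (_ : cintegral leb `]s, t] (weak_derivative (A_SL mu u)) = - cintegral leb `]s, t] f); first by ring.
  have mA := cmeasurable_L1loc lwdA.
  rewrite -mulN1r -(cintegralZ _ (mitv _) (fi s t)).
  have fi1 := cintegrableZ (-1) (mitv `]s, t]) (fi s t).
  apply: ae_eq_cintegral => //.
    have [m1 m2] := cmeasurable_L1loc lf.
    apply: cmeasurable_mul; last by split.
    by split; exact: measurable_cst.
  by move: fA; apply: leb_aeS => x ->; rewrite mulN1r opprK.
have lg := driven_L1loc cu fi gE; have mg := cmeasurable_L1loc lg.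
have uE (s t : R) : s <= t -> cr t = cr s + cintegral leb `]s, t] g.
  move=> st; rewrite (crE s t st); congr (_ + _).
  by apply: ae_eq_cintegral => //; exact: ae_eq_sym_leb.
have su : sqr_integrable cr.
  have /sqr_integrableP su := L2u.
  apply: ae_sqr_integrable su (cmeasurable_continuous cu) _.
  exact: ae_eq_sym_leb.
have /sqr_integrableP sf := L2f.
have sg := driven_sqr_integrable M1C M2C M3C M4C C0 su sf cu gE uE mg.1 mg.2.
have L2wd : L2 (weak_derivative u).
  by apply/sqr_integrableP; exact: ae_sqr_integrable gwd.
split => // v [L2v Wv L2wv].
have wdv := weak_derivativeP Wv.
have [[cv /ae_eqP cvv] [_ vE]] := weak_derivative_rep wdv.
set cv' := continuous_rep v in cv cvv vE.
(* The form is antilinear in v: integration by parts is against its conjugate. *)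
pose V t := conjc (cv' t); pose w t := conjc (weak_derivative v t).
have conjD (x y : R[i]) : conjc (x + y) = conjc x + conjc y.
  by apply: complex_ext; rewrite ?(Re_add, Im_add, Re_conjc, Im_conjc)// opprD.
have conj_int (D : set R) h : measurable (D : set RR) -> cintegrable leb D h ->
    conjc (cintegral leb D h) = cintegral leb D (fun x => conjc (h x)).
  move=> mD [h1 h2]; apply: complex_ext; rewrite ?Re_conjc ?Im_conjc /=.
    by apply: eq_Rintegral => x _; rewrite /re_fun Re_conjc.
  rewrite -mulN1r -RintegralZl//; apply: eq_Rintegral => x _.
  by rewrite /im_fun Im_conjc mulN1r.
have cV : ccontinuous V.
  have [v1 v2] := cv; split.
    rewrite (_ : re_fun V = re_fun cv')//.
    by apply/funext => x; rewrite /re_fun Re_conjc.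
  rewrite (_ : im_fun V = (fun x => - im_fun cv' x)); last first.
    by apply/funext => x; rewrite /im_fun Im_conjc.
  by move=> x; apply: cvgN; exact: v2.
have [_ lwv _] := wdv; have wvi := cintegrable_L1loc lwv.
have pV : primitive_of V w.
  split => // s t st; rewrite /V (vE s t st) conjD conj_int//.
have sV : sqr_integrable V.
  apply: sqr_integrable_conj; have /sqr_integrableP sv := L2v.
  by apply: ae_sqr_integrable sv (cmeasurable_continuous cv) _; exact: ae_eq_sym_leb.
have sw : sqr_integrable w.
  by apply: sqr_integrable_conj; apply/sqr_integrableP.
have mw : cmeasurable w by have [] := sw.
have mV : cmeasurable V by exact: cmeasurable_continuous.
have := driven_form M1C M2C M3C M4C C0 su sf cu gE uE sg sV sw pV.
rewrite /form_tau /L2_inner (local_integralE measurableT); last first.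
  exact: cmeasurable_mul (cmeasurable_continuous cu) mV.
have -> : cintegral leb setT (fun t => g t * w t) =
    cintegral leb setT (fun x => weak_derivative u x * conjc (weak_derivative v x)).
  apply: ae_eq_cintegral => //.
  - exact: cmeasurable_mul.
  - exact: cmeasurable_mul.
  - by move: gwd; apply: leb_aeS => x ->.
have mv := cmeasurable_L2 L2v; have mf := cmeasurable_L2 L2f.
have -> // : cintegral leb setT (fun t => f t * V t) =
    cintegral leb setT (fun x => f x * conjc (v x)).
apply: ae_eq_cintegral => //.
- exact: cmeasurable_mul.
- by apply: cmeasurable_mul => //; exact: cmeasurable_conj.
- by move: cvv; apply: leb_aeS => x e; rewrite /V e.
Qed.

(** The complex conjugate of a test function is an admissible argument of the
form. *)
Lemma H_form_sub_max : H_form mu `<=` H_max mu.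
Proof.
move=> [u f] /= [[L2u Wu L2wu] L2f uf].
have wdu := weak_derivativeP Wu.
have [cru [cu crE]] := weak_derivative_rep wdu.
split => //; first by exists (continuous_rep u).
move=> phi tphi; pose v x := conjc (phi x).
have tv : test_function v by exact: test_function_conj.
have cv := ccontinuous_test tv.
have dv := is_weak_derivative_cderive tv.
have Wv : W11loc v by exists (cderive v).
have wdv := weak_derivativeP Wv; have [_ lwdv _] := wdv.
have tv' := test_function_cderive tv.
have vwd := is_weak_derivative_unique dv wdv.
have W12v : W12 v.
  split; [exact: L2_test|exact: Wv|].
  exact: L2_ae (L2_test tv') (cmeasurable_L1loc lwdv) vwd.
have := uf v W12v; rewrite /form_tau /L2_inner (continuous_rep_id cv).
have conjK (x : R[i]) : conjc (conjc x) = x.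
  by apply: complex_ext; rewrite ?(Re_conjc, Im_conjc) ?opprK.
have [_ lwdu ibp] := wdu.
have mphi' := cmeasurable_continuous (ccontinuous_test (test_function_cderive tphi)).
have -> : cintegral leb setT (fun x => weak_derivative u x * conjc (weak_derivative v x)) =
    cintegral leb setT (fun x => weak_derivative u x * cderive phi x).
  apply: ae_eq_cintegral => //.
  - apply: cmeasurable_mul; first exact: cmeasurable_L1loc.
    by apply: cmeasurable_conj; exact: cmeasurable_L1loc.
  - by apply: cmeasurable_mul; first exact: cmeasurable_L1loc.
  - by move: vwd; apply: leb_aeS => x <-; rewrite /v cderive_conj// conjK.
have -> : (fun x => continuous_rep u x * conjc (v x)) = (fun x => continuous_rep u x * phi x).
  by apply/funext => x; rewrite /v conjK.
have -> : (fun x => f x * conjc (v x)) = (fun x => f x * phi x).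
  by apply/funext => x; rewrite /v conjK.
move=> <-; rewrite (ibp _ (test_function_cderive tphi)) opprK.
by [].
Qed.

End operators.

Theorem theorem3p6 (R : realType) (mu : local_measure R)
  (mu_unif : (unif_norm mu < +oo)%E) :
  H_max mu = H_SL mu /\ H_SL mu = H_form mu.
Proof.
have max_SL := H_max_sub_SL mu_unif.
have SL_form := H_SL_sub_form mu_unif.
have form_max := @H_form_sub_max R mu.
split; apply/seteqP; split => // x.
- by move=> /SL_form/form_max.
- by move=> /form_max/max_SL.
Qed.
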